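(* Assume: (Sample) the data are a pooled sample of $N_1$ treated observations $(Y_i,X_i)$, $i\in\mathcal I_1$ (with $W_i=1$), drawn i.i.d. from the distribution of $(Y,X)\mid W=1$, and $N_0$ control observations $(Y_i,X_i)$, $i\in\mathcal I_0$ (with $W_i=0$), drawn i.i.d. from the distribution of $(Y,X)\mid W=0$, the treated and control samples being independent; (CIA) $Y(0)\perp W\mid X$; (Covariates) (i) $X\in\mathbb R^k$ is absolutely continuous; (ii) $\mathbb X_1\subseteq\mathbb X_0$, with $\mathbb X_1$ and $\mathbb X_0$ compact; (iii) $f_1$ and $f_0$ are differentiable at all interior points of their supports and bounded from above on $\mathbb X_1$, and $f_0$ is bounded below by a positive constant on $\mathbb X_1$; (iv) there are $\phi>0$ and $\rho_0>0$ such that for every $x\in\mathbb X_1$ and every $0<\rho\le\rho_0$ at least a fraction $\phi$ of the volume of the ball of radius $\rho$ around $x$ belongs to $\mathbb X_1$. Fix $N_1$ and $M$ and let $N_0\to\infty$. (1) If in addition $\mu_0(x)$ is continuous in $x$, then $\mathbb E[\hat\tau]\to\tau$. (2) If in addition, for every continuous and bounded $h:\mathbb R\to\mathbb R$, the function $\tilde h(x)=\mathbb E[h(Y(0))\mid X=x]$ is continuous and bounded, then $$\hat\tau\ \xrightarrow{d}\ \tau+\frac1{N_1}\sum_{i\in\mathcal I_1}\kappa_i,$$ where $\{\kappa_i\}_{i\in\mathcal I_1}$ are mutually independent, each $\kappa_i$ has CDF $\widetilde G(\kappa)=\int_{\mathbb X_1}G(\kappa;x)f_1(x)\,dx$, and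 $\mathbb E[\kappa_i]=0$.
   Context: $(Y(0),Y(1),X,W)$ is a random vector: $Y(0),Y(1)$ are real-valued potential outcomes, $X\in\mathbb R^k$ covariates, $W\in\{0,1\}$ a treatment indicator, $0<\Pr(W=1)<1$, and $\mathbb E|Y(0)|,\mathbb E|Y(1)|<\infty$. The observed outcome is $Y=WY(1)+(1-W)Y(0)$. For $w\in\{0,1\}$, $\mathbb X_w$ is the support of $X$ given $W=w$ and $f_w:\mathbb X_w\to\mathbb R_+$ the conditional density of $X$ given $W=w$. $\tau=\mathbb E[Y(1)-Y(0)\mid W=1]$. $\mu_w(x)=\mathbb E[Y(w)\mid X=x,W=1]$; under $Y(0)\perp W\mid X$ one has $\mu_0(x)=\mathbb E[Y(0)\mid X=x]=\mathbb E[Y\mid X=x,W=0]$, and this defines $\mu_0$ on $\mathbb X_0$. Distance: $d(a,b)=[(a-b)'V(a-b)]^{1/2}$ on $\mathbb R^k$, with $V$ a fixed positive definite matrix. For $i\in\mathcal I_1$, $\mathcal J_M(i)\subset\mathcal I_0$ is the set of the $M$ control observations whose covariates are closest to $X_i$ in $d$ (matching with replacement: a control may be used for several treated units; $M\in\mathbb N$ fixed). The nearest neighbor matching estimator is $$\hat\tau=\frac1{N_1}\sum_{i\in\mathcal I_1}\Big[Y_i-\frac1M\sum_{j\in\mathcal J_M(i)}Y_j\Big].$$ For $x\in\mathbb X_1$, let $\xi_x$ be distributed as $(Y(1)-\mu_1(x))\mid(X=x,W=1)$ and $\eta_x$ as $(Y(0)-\mu_0(x))\mid(X=x,W=0)$.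 $G(\cdot;x)$ is the CDF of $(\mu_1(x)-\mu_0(x)-\tau)+\xi_x-\frac1M\sum_{m=1}^M\eta_x^m$, where $\eta_x^1,\dots,\eta_x^M$ are i.i.d. copies of $\eta_x$ and $(\xi_x,\eta_x^1,\dots,\eta_x^M)$ are mutually independent. *)

(* Defs.v *)
From HB Require Import structures.
From mathcomp Require Import all_boot all_order all_algebra.
From mathcomp Require Import all_classical all_reals all_analysis.
From mathcomp Require Import measurable_realfun.

Set Implicit Arguments.
Unset Strict Implicit.
Unset Printing Implicit Defensive.

Import Order.TTheory GRing.Theory Num.Theory.
Import numFieldNormedType.Exports.

Local Open Scope classical_set_scope.
Local Open Scope ring_scope.

(* R^n is 'rV[R]_n, with the product sigma-algebra of its n coordinates
   (that is, its Borel sigma-algebra). *)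
Definition rV_display : measure_display -> measure_display.
Proof. exact. Qed.

Section measurable_rV.
Context (R : realType) (n : nat).

Let coord (i : 'I_n) (v : 'rV[R]_n) : R := v ord0 i.

Let rV_set0 : g_sigma_preimage coord set0.
Proof. exact: sigma_algebra0. Qed.

Let rV_setC A : g_sigma_preimage coord A -> g_sigma_preimage coord (~` A).
Proof. exact: sigma_algebraC. Qed.

Let rV_bigcup (F : _^nat) : (forall i, g_sigma_preimage coord (F i)) ->
  g_sigma_preimage coord (\bigcup_i (F i)).
Proof. exact: sigma_algebra_bigcup. Qed.

HB.instance Definition _ := @isMeasurable.Build (rV_display default_measure_display)
  'rV[R]_n (g_sigma_preimage coord) rV_set0 rV_setC rV_bigcup.

Lemma measurable_coord (i : 'I_n) :
  measurable_fun [set: 'rV[R]_n] (fun v : 'rV[R]_n => v ord0 i).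
Proof.
move=> _ Y mY; rewrite setTI; apply: sub_sigma_algebra => /=.
rewrite -bigcup_seq/=; exists i => /=; first by rewrite mem_index_enum.
by exists Y => //; rewrite setTI.
Qed.

Lemma measurable_fun_rV d (T : measurableType d) (f : T -> 'rV[R]_n) :
  (forall i, measurable_fun [set: T] (fun x => f x ord0 i)) ->
  measurable_fun [set: T] f.
Proof.
move=> mf _ Y mY; rewrite setTI.
have : (g_sigma_preimage (fun i x => f x ord0 i)) (f @^-1` Y).
  have := @g_sigma_preimage_comp _ R n 'rV[R]_n coord T f.
  rewrite /comp /coord => ->.
  by exists Y => //; rewrite setTI.
apply: smallest_sub; first exact: sigma_algebra_measurable.
rewrite -bigcup_seq; apply: bigcup_sub => i _ _ [B mB <-].
by exact: mf.
Qed.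

End measurable_rV.


(* lebesgue_measure lives on measurableTypeR R, whose sigma-algebra is the
   default one of R under another display. *)
Section lebesgue_R.
Context (R : realType).
Local Open Scope ereal_scope.

Definition lebesgue_R : set R -> \bar R := @lebesgue_measure R.

Let lebesgue_R0 : lebesgue_R set0 = 0.
Proof. exact: (measure0 (@lebesgue_measure R)). Qed.

Let lebesgue_R_ge0 A : 0 <= lebesgue_R A.
Proof. exact: (measure_ge0 (@lebesgue_measure R)). Qed.

Let lebesgue_R_sigma_additive : semi_sigma_additive lebesgue_R.
Proof. exact: (@measure_semi_sigma_additive _ _ _ (@lebesgue_measure R)). Qed.

HB.instance Definition _ := isMeasure.Build _ _ _ lebesgue_R
  lebesgue_R0 lebesgue_R_ge0 lebesgue_R_sigma_additive.

Let lebesgue_R_sigma_finite : sigma_finite setT lebesgue_R.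
Proof. exact: (@sigma_finiteT _ _ _ (@lebesgue_measure R)). Qed.

HB.instance Definition _ := Measure_isSigmaFinite.Build _ _ _ lebesgue_R
  lebesgue_R_sigma_finite.

End lebesgue_R.

Section power_measure.
Context (R : realType).
Local Open Scope ereal_scope.

Definition rV_cons n (p : R * 'rV[R]_n) : 'rV[R]_n.+1 :=
  \row_i oapp (p.2 ord0) p.1 (unlift ord0 i).

Lemma rV_cons0 n (p : R * 'rV[R]_n) : rV_cons p ord0 ord0 = p.1.
Proof. by rewrite mxE unlift_none. Qed.

Lemma rV_consS n (p : R * 'rV[R]_n) (i : 'I_n) :
  rV_cons p ord0 (lift ord0 i) = p.2 ord0 i.
Proof. by rewrite mxE liftK. Qed.

Lemma measurable_rV_cons n : measurable_fun setT (@rV_cons n).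
Proof.
apply: measurable_fun_rV => i; case: (unliftP ord0 i) => [j|] ->.
  under eq_fun do rewrite rV_consS.
  exact: measurableT_comp (@measurable_coord R n j) measurable_snd.
under eq_fun do rewrite rV_cons0.
exact: measurable_fst.
Qed.

Section rV_cons_measure.
Context (m : {sigma_finite_measure set R -> \bar R}) (n : nat)
  (mu : {sigma_finite_measure set 'rV[R]_n -> \bar R}).

Definition rV_cons_measure : set 'rV[R]_n.+1 -> \bar R :=
  pushforward (m \x mu) (@rV_cons n).

Let rVcm0 : rV_cons_measure set0 = 0.
Proof. by rewrite /rV_cons_measure /pushforward preimage_set0 measure0. Qed.

Let rVcm_ge0 A : 0 <= rV_cons_measure A.
Proof. exact: (measure_ge0 (m \x mu)). Qed.

Let rVcm_sigma_additive : semi_sigma_additive rV_cons_measure.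
Proof.
move=> F mF tF mUF; rewrite /rV_cons_measure /pushforward preimage_bigcup.
have mpre A : measurable A -> measurable (@rV_cons n @^-1` A).
  by move=> mA; rewrite -[X in measurable X]setTI; exact: measurable_rV_cons.
apply: measure_semi_sigma_additive.
- by move=> k; exact: mpre.
- apply/trivIsetP => /= i j _ _ ij; rewrite -preimage_setI.
  by move/trivIsetP : tF => /(_ _ _ _ _ ij) ->//; rewrite preimage_set0.
- by rewrite -preimage_bigcup; exact: mpre.
Qed.

HB.instance Definition _ := isMeasure.Build _ _ _ rV_cons_measure
  rVcm0 rVcm_ge0 rVcm_sigma_additive.

Let rVcm_sigma_finite : sigma_finite setT rV_cons_measure.
Proof.
have /sigma_finiteP[F [FT ndF Foo]] := sigma_finiteT m.
have /sigma_finiteP[G [GT ndG Goo]] := sigma_finiteT mu.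
have FGT : setT = \bigcup_i (F i `*` G i).
  rewrite -setXTT FT GT predeqE => -[x y]; split.
    move=> [/= [i _ Fix] [j _ Gjy]]; exists (maxn i j) => //; split.
    - by move: x Fix; exact/subsetPset/ndF/leq_maxl.
    - by move: y Gjy; exact/subsetPset/ndG/leq_maxr.
  by move=> [i _ []/= ? ?]; split; exists i.
pose g (v : 'rV[R]_n.+1) : R * 'rV[R]_n :=
  (v ord0 ord0, \row_j v ord0 (lift ord0 j)).
have gK : cancel (@rV_cons n) g.
  move=> p; rewrite /g rV_cons0 [RHS]surjective_pairing; congr pair.
  by apply/rowP => j; rewrite mxE rV_consS.
have mg : measurable_fun setT g.
  apply/measurable_fun_pairP; split; first exact: measurable_coord.
  apply: measurable_fun_rV => j /=.
  under eq_fun do rewrite mxE.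
  exact: measurable_coord.
exists (fun i => g @^-1` (F i `*` G i)).
  by rewrite -preimage_bigcup -FGT preimage_setT.
move=> i; have [mFi Fioo] := Foo i; have [mGi Gioo] := Goo i; split.
  by rewrite -[X in measurable X]setTI; apply: mg => //; exact: measurableX.
rewrite /rV_cons_measure /pushforward -comp_preimage.
rewrite (_ : g \o _ = id); last by apply/funext => p; exact: gK.
by rewrite preimage_id product_measure1E// lte_mul_pinfty// ge0_fin_numE.
Qed.

HB.instance Definition _ := Measure_isSigmaFinite.Build _ _ _ rV_cons_measure
  rVcm_sigma_finite.

End rV_cons_measure.

Fixpoint rV_power (m : {sigma_finite_measure set R -> \bar R}) (n : nat) :
    {sigma_finite_measure set 'rV[R]_n -> \bar R} :=
  if n is n'.+1 then rV_cons_measure m (rV_power m n')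
  else dirac (0%R : 'rV[R]_0).

Lemma rV_powerE (m : {sigma_finite_measure set R -> \bar R}) n
    (A : 'I_n -> set R) : (forall i, measurable (A i)) ->
  rV_power m n [set v : 'rV[R]_n | forall i, A i (v ord0 i)]
  = \prod_(i < n) m (A i).
Proof.
elim: n A => [|n IH] A mA.
  rewrite big_ord0 /= diracE mem_set//.
  by case.
rewrite big_ord_recl /= /rV_cons_measure /pushforward.
rewrite -IH; last by move=> i; exact: mA.
rewrite -product_measure1E//; last first.
  rewrite (_ : [set v | _] =
      \bigcap_(i in [set: 'I_n]) (fun v : 'rV[R]_n => v ord0 i) @^-1`
        A (lift ord0 i)); last first.
    by apply/seteqP; split => [v Av i _|v Av i]; exact: Av.
  apply: fin_bigcap_measurable => // i _.
  by rewrite -[X in measurable X]setTI; exact: measurable_coord.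
congr ((_ \x _) _); apply/seteqP; split=> -[a v] /=.
  move=> H; split => [|i].
    by have := H ord0; rewrite rV_cons0.
  by have := H (lift ord0 i); rewrite rV_consS.
move=> [Aa Av] i; case: (unliftP ord0 i) => [j|] ->.
  by rewrite rV_consS; exact: Av.
by rewrite rV_cons0.
Qed.

Definition lebesgue_rV n : {sigma_finite_measure set 'rV[R]_n -> \bar R} :=
  rV_power (@lebesgue_R R) n.

End power_measure.

Section probability_notions.
Context d (T : measurableType d) (R : realType) (P : probability T R).
Local Open Scope ereal_scope.

(* The law P(. | W = b); it is P itself when P(W = b) = 0. *)
Definition cond_prob (W : {mfun T >-> bool}) (b : bool) : probability T R :=
  mnormalize
    (mrestr P (measurable_funPTI W (I : measurable [set b]))) P.

(* The rule over the whole index set gives the rule over every subfamily,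
   on taking A i = setT outside that subfamily. *)
Definition mutually_independent d' (U : measurableType d') (I : finType)
    (Z : I -> {mfun T >-> U}) : Prop :=
  forall A : I -> set U, (forall i, measurable (A i)) ->
    P [set w | forall i, A i (Z i w)] = \prod_(i : I) P (Z i @^-1` A i).

Section conditioning.
Context d' (U : measurableType d') (X : {mfun T >-> U}).

(* m is a version of u |-> E[Z | X = u]. *)
Definition cond_expectation (Z : T -> R) (m : U -> R) : Prop :=
  [/\ measurable_fun [set: U] m,
      P.-integrable [set: T] (EFin \o (m \o X)) &
      forall A, measurable A ->
        \int[P]_(w in X @^-1` A) (Z w)%:E
        = \int[P]_(w in X @^-1` A) (m (X w))%:E].

Definition cond_probability (E : set T) (p : U -> R) : Prop :=
  cond_expectation (\1_E) p.

Definition cond_independent d1 (T1 : measurableType d1) d2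
    (T2 : measurableType d2) (Y : {mfun T >-> T1}) (Z : {mfun T >-> T2}) : Prop :=
  forall A B, measurable A -> measurable B ->
    exists p q : U -> R,
      [/\ cond_probability (Y @^-1` A) p, cond_probability (Z @^-1` B) q &
          cond_probability (Y @^-1` A `&` Z @^-1` B) (p \* q)%R].

(* K u is a version of the conditional law of Z given X = u. *)
Definition regular_cond_law (Z : {mfun T >-> R}) (K : U -> probability R R) :
    Prop :=
  (forall B, measurable B -> measurable_fun [set: U] (fun u => K u B : \bar R)) /\
  (forall A B, measurable A -> measurable B ->
    P (X @^-1` A `&` Z @^-1` B) = \int[P]_(w in X @^-1` A) K (X w) B).

End conditioning.

(* Convergence of the distribution functions at every continuity point of the
   limit; the n-th variable may live on its own probability space. *)
Definition cvg_in_distribution (dO : nat -> measure_display)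
    (Omega : forall n, measurableType (dO n))
    (Q : forall n, probability (Omega n) R) (Z : forall n, Omega n -> R)
    (Z' : T -> R) : Prop :=
  forall t : R, {for t, continuous (fun s : R => P (Z' @^-1` `]-oo, s]))} ->
    Q n (Z n @^-1` `]-oo, t]) @[n --> \oo] --> P (Z' @^-1` `]-oo, t]).

End probability_notions.

Arguments cond_prob {d T R} P W b.
Arguments mutually_independent {d T R} P {d' U I} Z.
Arguments cond_expectation {d T R} P {d' U} X Z m.
Arguments cond_probability {d T R} P {d' U} X E p.
Arguments cond_independent {d T R} P {d' U} X {d1 T1 d2 T2} Y Z.
Arguments regular_cond_law {d T R} P {d' U} X Z K.
Arguments cvg_in_distribution {d T R} P {dO Omega} Q Z Z'.

Section euclidean_space.
Context (R : realType) (k : nat).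

Definition law_support (mu : set 'rV[R]_k -> \bar R) : set 'rV[R]_k :=
  [set x | forall U, open U -> U x -> (0 < mu U)%E].

Definition positive_definite (V : 'M[R]_k) : Prop :=
  V^T = V /\
  forall x : 'rV[R]_k, x != 0 -> 0 < (x *m V *m x^T) ord0 ord0.

Definition dist (V : 'M[R]_k) (a b : 'rV[R]_k) : R :=
  Num.sqrt (((a - b) *m V *m (a - b)^T) ord0 ord0).

(* The library's ball on 'rV[R]_k is that of the max norm. *)
Definition euclidean_ball (x : 'rV[R]_k) (r : R) : set 'rV[R]_k :=
  [set y | dist 1%:M x y < r].

(* f is a density on S of the law of X under P; only f on S matters. *)
Definition density_on d (T : measurableType d) (P : probability T R)
    (X : T -> 'rV[R]_k) (S : set 'rV[R]_k) (f : 'rV[R]_k -> R) : Prop :=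
  [/\ measurable_fun S f, forall x, S x -> 0 <= f x &
      forall A, measurable A ->
        P (X @^-1` A) = (\int[lebesgue_rV R k]_(x in A `&` S) (f x)%:E)%E].

End euclidean_space.

Section matching.
Context (R : realType) (k : nat) (V : 'M[R]_k) (M : nat).

(* The M indices j whose z j are closest to x (all of them if n < M).
   The sort is stable, so ties go to the smaller index. *)
Definition nearest_neighbors n (x : 'rV[R]_k) (z : 'I_n -> 'rV[R]_k) :
    {set 'I_n} :=
  [set j in take M (sort (fun i j => dist V x (z i) <= dist V x (z j))
                         (enum 'I_n))].

Lemma card_nearest_neighbors n (x : 'rV[R]_k) (z : 'I_n -> 'rV[R]_k) :
  #|nearest_neighbors x z| = minn M n.
Proof.
rewrite cardsE (card_uniqP _) ?take_uniq ?sort_uniq ?enum_uniq//.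
by rewrite size_take size_sort size_enum_ord.
Qed.

Lemma nearest_neighbors_closest n (x : 'rV[R]_k) (z : 'I_n -> 'rV[R]_k) i j :
  i \in nearest_neighbors x z -> j \notin nearest_neighbors x z ->
  dist V x (z i) <= dist V x (z j).
Proof.
rewrite !inE; set r := (fun i j => _); set s := sort _ _ => si sj.
have {}sj : j \in drop M s.
  have : j \in take M s ++ drop M s.
    by rewrite cat_take_drop mem_sort mem_enum.
  by rewrite mem_cat (negbTE sj).
have : pairwise r (take M s ++ drop M s).
  rewrite cat_take_drop -sorted_pairwise; last first.
    by move=> a b c; exact: le_trans.
  by apply: sort_sorted => a b; exact: le_total.
by rewrite pairwise_cat => /and3P[/allrelP + _ _] => /(_ _ _ si sj).
Qed.

Definition matching_estimator N1 n (treated : 'I_N1 -> R * 'rV[R]_k)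
    (control : 'I_n -> R * 'rV[R]_k) : R :=
  N1%:R^-1 * \sum_(i < N1)
    ((treated i).1 -
     M%:R^-1 * \sum_(j in nearest_neighbors (treated i).2 (snd \o control))
                 (control j).1).

(* G(t; x): with y ~ K1 x and the M coordinates of v i.i.d. of law K0 x and
   independent of y, xi_x is y - mu1 x and eta_x^m is v_m - mu0 x. *)
Definition match_cdf (K1 K0 : 'rV[R]_k -> probability R R)
    (mu1 mu0 : 'rV[R]_k -> R) (tau t : R) (x : 'rV[R]_k) : \bar R :=
  (K1 x \x rV_power (K0 x) M)%E
    [set p : R * 'rV[R]_M |
      (mu1 x - mu0 x - tau) + (p.1 - mu1 x)
      - M%:R^-1 * \sum_(m < M) (p.2 ord0 m - mu0 x) <= t].

End matching.

(* Main.v *)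
(* In the limit law the conditional means cancel: kappa is distributed as
   Y(1) - tau - (1/M) sum_m v_m, with v_1, ..., v_M i.i.d. from the conditional law K0(X) of
   Y(0). Conditional independence and X|W=1 << X|W=0 (f0 > 0 on X1) make K0 a conditional law of
   Y(0) given X in both arms and in the whole population. Since the support of the treated
   covariates is compact and every ball centred in it has positive control mass, all matches
   of the N1 treated units are eventually within any fixed distance, with probability close
   to 1.

   Mean: the bias is an average of mu0(X_i) - mu0(X_j) over matched pairs, small by uniform
   continuity of mu0.

   Law: two treated covariates are far apart with large probability, because f1 is bounded,
   so no control is shared. Integrating out the control outcomes given the covariates then
   turns E g(tau_hat), for a ramp g, into a composition of convolutions by the laws K0(X_j).
   Each K0(X_j) may be replaced by K0(X_i), as K0 is weakly continuous, and what remains is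
   E g(tau + (1/N1) sum_i kappa_i). *)

Require Import Defs.
From HB Require Import structures.
From mathcomp Require Import all_boot all_order all_algebra.
From mathcomp Require Import all_classical all_reals all_analysis.
From mathcomp Require Import measurable_realfun giry.
From mathcomp Require Import ring lra.

Set Implicit Arguments.
Unset Strict Implicit.
Unset Printing Implicit Defensive.

Import Order.TTheory GRing.Theory Num.Theory.
Import numFieldNormedType.Exports.

Local Open Scope classical_set_scope.
Local Open Scope ring_scope.

(** * Kernels, mixtures and product laws *)

(** The matched set of one treated unit depends on all covariates at once, so the matched outcomes
    are not independent by construction. It does not depend on outcomes, however: at frozen
    covariates, redrawing a control outcome changes no match. Invariance of the sample law under
    such a redraw therefore replaces any analysis of the joint law of the matches.

    The convolutions obtained in this way commute. Their order is irrelevant, and any one of them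
    can be brought next to the test function and exchanged there at a cost that the others do not
    amplify. Only [N1 * M] exchanges occur, a number that does not grow with the control sample.
    Separation is needed because a control used twice would contribute twice the same draw instead
    of two independent draws.

    An exchange needs a bound uniform in the shift of the test function, whereas continuity of [K0]
    is given for one test function at a time and only up to null sets. Ramps bridge this gap: they
    are monotone and Lipschitz, and a first moment bound makes both tails negligible, so finitely
    many shifts suffice. The conditional first moment may be unbounded in the covariate; Markov's
    inequality confines its large values to a small event. *)

Section mfun_of.
Context d1 d2 (T1 : measurableType d1) (T2 : measurableType d2).
Variables (f : T1 -> T2) (mf : measurable_fun [set: T1] f).
(* The proof is kept in the term so that HB can attach the measurable structure to it. *)
Definition mfun_of : T1 -> T2 := let _ := mf in f.
Let measurable_mfun_of : measurable_fun [set: T1] mfun_of.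
Proof. exact: mf. Qed.
HB.instance Definition _ := isMeasurableFun.Build _ _ _ _ mfun_of measurable_mfun_of.
End mfun_of.

Section prob_kernel.
Context d1 d2 (X : measurableType d1) (Y : measurableType d2) (R : realType).
Local Open Scope ereal_scope.
Variable K : X -> probability Y R.

Definition measurable_kernel_fam :=
  forall B, measurable B -> measurable_fun [set: X] (fun x => K x B).

Definition prob_kernel (mK : measurable_kernel_fam) : X -> {measure set Y -> \bar R} := K.

Hypothesis mK : measurable_kernel_fam.

HB.instance Definition _ := @isKernel.Build _ _ X Y R (prob_kernel mK) mK.

Let prob_kernel_setT x : prob_kernel mK x [set: Y] = 1.
Proof. by rewrite /prob_kernel/= probability_setT. Qed.

HB.instance Definition _ := @Kernel_isProbability.Build _ _ X Y R (prob_kernel mK) prob_kernel_setT.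

Lemma measurable_kernel_integral (f : X * Y -> \bar R) :
  (forall z, 0 <= f z) -> measurable_fun setT f ->
  measurable_fun [set: X] (fun x => \int[K x]_y f (x, y)).
Proof.
move=> f0 mf.
exact: (@measurable_fun_integral_finite_kernel _ _ X Y R f (prob_kernel mK)).
Qed.

Variable mu : probability X R.

(** The bind of [mu] and [K] in the Giry monad. The measurability proof is an argument so that the
    measure structure can be attached to the term [mixture mK]. *)
Definition mixture (_ : measurable_kernel_fam) (B : set Y) : \bar R := \int[mu]_x K x B.

Let mixture0 : mixture mK set0 = 0.
Proof. by apply: integral0_eq => x _; rewrite measure0. Qed.

Let mixture_ge0 B : 0 <= mixture mK B.
Proof. by apply: integral_ge0 => x _. Qed.

Let mixture_sigma_additive : semi_sigma_additive (mixture mK).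
Proof.
move=> F mF tF mUF; rewrite /mixture.
rewrite [X in _ --> X](_ : _ = \int[mu]_x (\sum_(0 <= i <oo) K x (F i))); last first.
  apply: eq_integral => x _.
  exact/esym/cvg_lim/measure_semi_sigma_additive.
rewrite integral_nneseries//; last by move=> n; exact: mK.
by apply: is_cvg_ereal_nneg_natsum => n _; exact: integral_ge0.
Qed.

HB.instance Definition _ := isMeasure.Build _ _ _ (mixture mK)
  mixture0 mixture_ge0 mixture_sigma_additive.

Let mixture_setT : mixture mK [set: Y] = 1.
Proof.
rewrite /mixture; under eq_integral do rewrite probability_setT.
rewrite integral_cst// mul1e; exact: probability_setT.
Qed.

HB.instance Definition _ := Measure_isProbability.Build _ _ _ (mixture mK) mixture_setT.

(** [mixture] agrees on measurable sets with the bind of the Giry monad, whose integration formula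
    carries over. *)
Lemma ge0_integral_mixture (f : Y -> \bar R) : measurable_fun setT f ->
  (forall y, 0 <= f y) ->
  \int[mixture mK]_y f y = \int[mu]_x \int[K x]_y f y.
Proof.
move=> mf f0.
have mK' : measurable_fun setT (K : X -> giry Y R) by exact: measurable_giry_codensity.
have := giry_int_bind (mu : giry X R) mK' mf f0.
rewrite /giry_int => <-.
apply: eq_measure_integral => A mA _.
by rewrite -[RHS]/(giry_int (giry_map mK' mu) (giry_ev ^~ A))
  giry_int_map//; exact: measurable_giry_ev.
Qed.

Lemma integral_mixture (f : Y -> \bar R) : measurable_fun setT f ->
  (mixture mK).-integrable setT f ->
  \int[mixture mK]_y f y = \int[mu]_x \int[K x]_y f y.
Proof.
move=> mf fi; rewrite integralE.
have mp : measurable_fun setT f^\+ by exact: measurable_funepos.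
have mn : measurable_fun setT f^\- by exact: measurable_funeneg.
rewrite ge0_integral_mixture// ge0_integral_mixture//.
have ip : mu.-integrable setT (fun x => \int[K x]_y f^\+ y).
  apply/integrableP; split.
    apply: (@measurable_kernel_integral (f^\+ \o snd)); last exact: measurableT_comp.
    by move=> z; exact: funepos_ge0.
  under eq_integral => x _ do rewrite gee0_abs ?integral_ge0//.
  rewrite -ge0_integral_mixture//.
  have /integrableP[_] := integrable_funepos measurableT fi.
  by under eq_integral => x _ do rewrite gee0_abs//.
have i_n : mu.-integrable setT (fun x => \int[K x]_y f^\- y).
  apply/integrableP; split.
    apply: (@measurable_kernel_integral (f^\- \o snd)); last exact: measurableT_comp.
    by move=> z; exact: funeneg_ge0.
  under eq_integral => x _ do rewrite gee0_abs ?integral_ge0//.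
  rewrite -ge0_integral_mixture//.
  have /integrableP[_] := integrable_funeneg measurableT fi.
  by under eq_integral => x _ do rewrite gee0_abs//.
rewrite -integralB//.
by apply: eq_integral => x _; rewrite [RHS]integralE.
Qed.

End prob_kernel.

Section tuple_boxes.
Context d (T : measurableType d) (R : realType) (N : nat).
Local Open Scope ereal_scope.

Definition box (A : 'I_N -> set T) : set (N.-tuple T) :=
  [set z | forall i, A i (tnth z i)].

Lemma measurable_box A : (forall i, measurable (A i)) -> measurable (box A).
Proof.
move=> mA.
rewrite (_ : box A = \bigcap_(i in [set: 'I_N]) (@tnth _ T ^~ i) @^-1` A i); last first.
  by apply/seteqP; split => [v Av i _|v Av i]; exact: Av.
apply: fin_bigcap_measurable => // i _.
by rewrite -[X in measurable X]setTI; exact: measurable_tnth.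
Qed.

(** Boxes are closed under intersection and generate the sigma-algebra of tuples, so uniqueness of
    measures on a pi-system applies. *)
Lemma tuple_prob_unique (p q : probability (N.-tuple T) R) :
  (forall A, (forall i, measurable (A i)) -> p (box A) = q (box A)) ->
  forall B, measurable B -> p B = q B.
Proof.
move=> pq.
pose G := [set box A | A in [set A : 'I_N -> set T | forall i, measurable (A i)]].
apply: (measure_unique G (fun=> setT)).
- apply/seteqP; split.
    apply: smallest_sub; first exact: smallest_sigma_algebra.
    rewrite -bigcup_seq; apply: bigcup_sub => i _ _ [B mB <-].
    apply: sub_sigma_algebra; exists (fun j => if j == i then B else setT).
      by move=> j; case: ifP.
    apply/seteqP; split => z; rewrite setTI.
      by move=> /(_ i); rewrite eqxx.
    by move=> Bz j; case: ifP => // /eqP ->.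
  apply: smallest_sub; first exact: sigma_algebra_measurable.
  by move=> _ [A mA <-]; exact: measurable_box.
- move=> _ _ [A mA <-] [B mB <-]; exists (fun i => A i `&` B i).
    by move=> i; exact: measurableI.
  apply/seteqP; split => z; first by move=> H; split => i; case: (H i).
  by move=> [H1 H2] i; split.
- by move=> _; exists (fun=> setT) => //; apply/seteqP; split.
- by rewrite bigcup_const.
- by move=> _ [A mA <-]; exact: pq.
- by move=> _; apply: le_lt_trans (ltry 1); exact: probability_le1.
Qed.

Definition upd (z : N.-tuple T) (s : 'I_N) (u : T) : N.-tuple T :=
  [tuple if i == s then u else tnth z i | i < N].

Lemma tnth_upd z s u i : tnth (upd z s u) i = if i == s then u else tnth z i.
Proof. by rewrite tnth_mktuple. Qed.

Lemma measurable_upd s :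
  measurable_fun setT (fun zu : N.-tuple T * T => upd zu.1 s zu.2).
Proof.
apply/measurable_fun_tnthP => i.
rewrite (_ : _ \o _ = fun zu : N.-tuple T * T => if i == s then zu.2 else tnth zu.1 i).
  case: (i == s); first exact: measurable_snd.
  apply: (measurableT_comp (@measurable_tnth _ T N i)).
  exact: measurable_fst.
by apply/funext => zu /=; rewrite tnth_upd.
Qed.

(** Independent coordinates with marginals [mu i], tested on boxes only because
    [mutually_independent] speaks of boxes. *)
Definition box_law (mu : 'I_N -> probability T R) (rho : probability (N.-tuple T) R) :=
  forall A, (forall i, measurable (A i)) -> rho (box A) = \prod_(i < N) mu i (A i).

Variables (mu : 'I_N -> probability T R) (rho : probability (N.-tuple T) R).
Hypothesis rhoE : box_law mu rho.

(* Redrawing one coordinate of a sample leaves its law unchanged; this replaces every use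
   of independence and of Fubini on the pooled sample. *)
Lemma resample s (f : N.-tuple T -> \bar R) : measurable_fun setT f ->
  (forall z, 0 <= f z) ->
  \int[rho]_z f z = \int[rho]_z \int[mu s]_u f (upd z s u).
Proof.
move=> mf f0.
(* [K z] is the law of [z] after coordinate [s] has been redrawn. The claim amounts to invariance of
   [rho] under this kernel, and it is enough to test it on boxes. *)
pose K z : probability (N.-tuple T) R :=
  distribution (mu s) (mfun_of (measurableT_comp (measurable_upd s) (pair1_measurable z))).
have KE z B : K z B = mu s [set u | B (upd z s u)] by [].
have mK : measurable_kernel_fam K.
  move=> B mB.
  have := @measurable_kernel_integral _ _ _ _ R (fun _ : N.-tuple T => mu s)
    (fun _ _ => measurable_cst _) (fun zu => (\1_B (upd zu.1 s zu.2))%:E).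
  rewrite (_ : (fun x => _) = K ^~ B); last first.
    apply/funext => z; rewrite KE.
    rewrite (_ : (fun y => _) = (fun y => (\1_[set u | B (upd z s u)] y)%:E))//.
    rewrite integral_indic ?setIT//.
    rewrite -[X in measurable X]setTI.
    exact: (measurableT_comp (measurable_upd s) (pair1_measurable z)).
  apply; first by move=> zu; rewrite lee_fin.
  apply/measurable_EFinP.
  exact: (measurableT_comp (measurable_indic mB) (measurable_upd s)).
have E : forall B, measurable B -> rho B = mixture rho mK B.
  apply: tuple_prob_unique => A mA.
  rewrite rhoE// (bigD1 s)//= -[RHS]/(\int[rho]_z K z (box A)).
  under eq_integral => z _.
    rewrite KE.
    rewrite (_ : _ (_) = mu s (A s) * (\1_(box (fun i => if i == s then setT else A i)) z)%:E).
      over.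
    rewrite indicE; have [Bz|Bz] := pselect (box (fun i => if i == s then setT else A i) z).
      rewrite mem_set//= mule1; congr (mu s _); apply/seteqP; split => u /=.
        by move=> /(_ s); rewrite tnth_upd eqxx.
      move=> Au i; rewrite tnth_upd; case: eqP => [->//|/eqP].
      by have := Bz i; case: eqP.
    rewrite memNset//= mule0 (_ : [set u | _] = set0) ?measure0//.
    apply/seteqP; split => u //= H; apply: Bz => i.
    by have := H i; rewrite tnth_upd; case: eqP.
  have mB : measurable (box (fun i => if i == s then setT else A i)).
    by apply: measurable_box => i; case: ifP.
  rewrite ge0_integralZl//; last by apply/measurable_EFinP.
  rewrite integral_indic// setIT [X in _ = _ * X]rhoE; last by move=> i; case: ifP.
  rewrite [in RHS] (bigD1 s)//= eqxx probability_setT mul1e; congr (_ * _).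
  by apply: eq_bigr => i /negbTE ->.
rewrite (eq_measure_integral (mixture rho mK)); last by move=> A mA _; exact: E.
rewrite ge0_integral_mixture//; apply: eq_integral => z _.
rewrite ge0_integral_pushforward//.
Qed.

End tuple_boxes.

Section disintegration.
Context d1 d2 (Y : measurableType d1) (X : measurableType d2) (R : realType).
Local Open Scope ereal_scope.

(** The kernel goes from the second coordinate to the first because a unit is a pair (outcome,
    covariate). Rectangles suffice, and [regular_cond_law] gives exactly these. *)
Definition disintegration (mu : probability (Y * X)%type R) (K : X -> probability Y R) :=
  measurable_kernel_fam K /\
  forall A C, measurable A -> measurable C ->
    mu (A `*` C) = \int[mu]_u (K u.2 A * (\1_C u.2)%:E).

Variables (mu : probability (Y * X)%type R) (K : X -> probability Y R).
Hypothesis muK : disintegration mu K.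

Lemma measurable_kernel_comp d (Z : measurableType d) (xi : Z -> X) :
  measurable_fun setT xi -> measurable_kernel_fam (K \o xi).
Proof.
by move=> mxi B mB; exact: measurableT_comp (muK.1 _ mB) mxi.
Qed.

(** The analogue of [resample] inside one unit: redrawing the outcome at its own covariate preserves
    the law. Both laws agree on rectangles, a generating pi-system. *)
Lemma disintegration_integral (f : Y * X -> \bar R) : measurable_fun setT f ->
  (forall u, 0 <= f u) ->
  \int[mu]_u \int[K u.2]_v f (v, u.2) = \int[mu]_u f u.
Proof.
move=> mf f0.
pose K' (u : Y * X) : probability (Y * X)%type R :=
  distribution (K u.2) (mfun_of (pair2_measurable u.2 : measurable_fun setT (fun v : Y => (v, u.2)))).
have KE u B : K' u B = K u.2 [set v | B (v, u.2)] by [].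
have mK2 : measurable_kernel_fam (fun u : Y * X => K u.2).
  exact: (measurable_kernel_comp measurable_snd).
have mK' : measurable_kernel_fam K'.
  move=> B mB.
  have := measurable_kernel_integral mK2
    (f := fun uv : (Y * X) * Y => (\1_B (uv.2, uv.1.2))%:E).
  rewrite (_ : (fun x => \int[_]_y _) = K' ^~ B); last first.
    apply/funext => u; rewrite KE.
    rewrite (_ : (fun y => _) = (fun y => (\1_[set v | B (v, u.2)] y)%:E))//.
    rewrite integral_indic ?setIT//.
    by rewrite -[X in measurable X]setTI; exact: pair2_measurable.
  apply; first by move=> zu; rewrite lee_fin.
  apply/measurable_EFinP.
  apply: (measurableT_comp (measurable_indic mB)).
  apply/measurable_fun_pairP; split; first exact: measurable_snd.
  exact: (measurableT_comp measurable_snd measurable_fst).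
have E : forall B, measurable B -> mu B = mixture mu mK' B.
  pose G := [set B : set (Y * X) | exists A C, [/\ measurable A, measurable C & B = A `*` C]].
  apply: (measure_unique G (fun=> setT)).
  - rewrite measurable_prod_measurableType; congr (<<s _ >>).
    apply/seteqP; split=> B.
      by move=> [A mA [C mC <-]]; exists A, C.
    by move=> [A [C [mA mC ->]]]; exists A => //; exists C.
  - move=> _ _ [A [C [mA mC ->]]] [A' [C' [mA' mC' ->]]].
    exists (A `&` A'), (C `&` C'); split; [exact: measurableI|exact: measurableI|].
    by rewrite setXI.
  - by move=> _; exists setT, setT; rewrite setXTT.
  - by rewrite bigcup_const.
  - move=> _ [A [C [mA mC ->]]]; rewrite [LHS]muK.2//.
    apply: eq_integral => u _; rewrite KE indicE.
    have [Cu|Cu] := pselect (C u.2).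
      rewrite mem_set//= mule1; congr (K u.2 _); apply/seteqP; split => v //=.
      by case.
    rewrite memNset//= mule0 (_ : [set v | _] = set0) ?measure0//.
    by apply/seteqP; split => v //= [].
  - by move=> _; apply: le_lt_trans (ltry 1); exact: probability_le1.
rewrite [RHS](eq_measure_integral (mixture mu mK')); last by move=> A mA _; exact: E.
rewrite ge0_integral_mixture//; apply: eq_integral => u _.
by rewrite ge0_integral_pushforward.
Qed.

End disintegration.

Section resample_cond.
Context d1 d2 (Y : measurableType d1) (X : measurableType d2) (R : realType).
Local Open Scope ereal_scope.
Context (N : nat) (mu : 'I_N -> probability (Y * X)%type R)
  (rho : probability (N.-tuple (Y * X)%type) R).
Hypothesis rhoE : box_law mu rho.

Lemma upd_upd (z : N.-tuple (Y * X)) s u v : upd (upd z s u) s v = upd z s v.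
Proof. by apply: eq_from_tnth => i; rewrite !tnth_upd; case: eqP. Qed.

Lemma measurable_snd_tnth (s : 'I_N) :
  measurable_fun setT (fun z : N.-tuple (Y * X) => (tnth z s).2).
Proof. exact: measurableT_comp measurable_snd (@measurable_tnth _ (Y * X)%type N s). Qed.

Lemma measurable_fst_tnth (s : 'I_N) :
  measurable_fun setT (fun z : N.-tuple (Y * X) => (tnth z s).1).
Proof. exact: measurableT_comp measurable_fst (@measurable_tnth _ (Y * X)%type N s). Qed.

Lemma measurable_upd_fst s : measurable_fun setT
  (fun zv : N.-tuple (Y * X) * Y => upd zv.1 s (zv.2, (tnth zv.1 s).2)).
Proof.
apply: (measurableT_comp (measurable_upd s)
  (_ : measurable_fun setT (fun zv : N.-tuple (Y * X) * Y => (zv.1, (zv.2, (tnth zv.1 s).2))))).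
apply/measurable_fun_pairP; split; first exact: measurable_fst.
apply/measurable_fun_pairP; split; first exact: measurable_snd.
exact: measurableT_comp (measurable_snd_tnth s) measurable_fst.
Qed.

Variables (K : X -> probability Y R) (s : 'I_N).
Hypothesis muK : disintegration (mu s) K.

Lemma measurable_resample_cond (f : N.-tuple (Y * X) -> \bar R) :
  measurable_fun setT f -> (forall z, 0 <= f z) ->
  measurable_fun setT
    (fun z => \int[K (tnth z s).2]_v f (upd z s (v, (tnth z s).2))).
Proof.
move=> mf f0.
apply: (measurable_kernel_integral (measurable_kernel_comp muK (measurable_snd_tnth s))
  (f := fun zv => f (upd zv.1 s (zv.2, (tnth zv.1 s).2)))) => //.
exact: measurableT_comp mf (measurable_upd_fst s).
Qed.

(** This redraw keeps every covariate, hence every matched set. [resample] reduces both sides to a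
    single unit, where the second redraw overwrites the first and the disintegration applies. *)
Lemma resample_cond (f : N.-tuple (Y * X) -> \bar R) :
  measurable_fun setT f -> (forall z, 0 <= f z) ->
  \int[rho]_z f z =
  \int[rho]_z \int[K (tnth z s).2]_v f (upd z s (v, (tnth z s).2)).
Proof.
move=> mf f0.
rewrite [RHS](resample rhoE s); last 2 first.
- exact: measurable_resample_cond.
- by move=> z; exact: integral_ge0.
rewrite [LHS](resample rhoE s mf f0).
apply: eq_integral => z _.
have mfz : measurable_fun setT (fun u => f (upd z s u)).
  exact: measurableT_comp mf (measurableT_comp (measurable_upd s) (pair1_measurable z)).
rewrite -(disintegration_integral muK mfz); last by move=> u; exact: f0.
by apply: eq_integral => u _; rewrite tnth_upd eqxx; apply: eq_integral => v _; rewrite upd_upd.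
Qed.

End resample_cond.

Section cvl.
Context (R : realType).
Local Open Scope ereal_scope.
Implicit Types (nu : probability R R) (c a : R) (G : R -> \bar R).

(* An independent summand c * v, v ~ nu, acts on a test function G by cvl nu c, and these
   operators commute. *)
Definition cvl nu c G a : \bar R := \int[nu]_v G (a + c * v)%R.

Lemma cvl_ge0 nu c G a : (forall s, 0 <= G s) -> 0 <= cvl nu c G a.
Proof. by move=> G0; exact: integral_ge0. Qed.

Lemma measurable_affine (a c : R) : measurable_fun [set: R] (fun v => a + c * v)%R.
Proof. by apply: measurable_funD => //; exact: measurable_funM. Qed.

Lemma measurable_cvl_family d (Z : measurableType d) (K : Z -> probability R R)
    (c : Z -> R) (F : Z * R -> \bar R) :
  measurable_kernel_fam K -> measurable_fun setT c ->
  (forall z, 0 <= F z) -> measurable_fun setT F ->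
  measurable_fun setT (fun za : Z * R =>
    cvl (K za.1) (c za.1) (fun a => F (za.1, a)) za.2).
Proof.
move=> mK mc F0 mF.
have mK1 : measurable_kernel_fam (fun za : Z * R => K za.1).
  by move=> B mB; exact: measurableT_comp (mK B mB) measurable_fst.
apply: (measurable_kernel_integral mK1
  (f := fun q : (Z * R) * R => F (q.1.1, q.1.2 + c q.1.1 * q.2)%R)) => //.
apply: (measurableT_comp mF).
have m1 : measurable_fun [set: (Z * R) * R] (fun q => q.1.1).
  exact: measurableT_comp measurable_fst measurable_fst.
apply/measurable_fun_pairP; split => //=.
apply: measurable_funD; first exact: (measurableT_comp measurable_snd measurable_fst).
apply: measurable_funM; last exact: measurable_snd.
exact: (measurableT_comp mc m1).
Qed.

Lemma measurable_cvl nu c G : (forall s, 0 <= G s) -> measurable_fun setT G ->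
  measurable_fun setT (cvl nu c G).
Proof.
move=> G0 mG.
have mK : measurable_kernel_fam (fun _ : R => nu) by move=> B mB; exact: measurable_cst.
apply: (measurable_kernel_integral mK (f := fun q : R * R => G (q.1 + c * q.2)%R)) => //.
apply: (measurableT_comp mG); apply: measurable_funD; first exact: measurable_fst.
by apply: measurable_funM => //; exact: measurable_snd.
Qed.

Lemma cvl_comm nu nu' c c' G : (forall s, 0 <= G s) -> measurable_fun setT G ->
  cvl nu c (cvl nu' c' G) = cvl nu' c' (cvl nu c G).
Proof.
move=> G0 mG; apply/funext => a; rewrite /cvl.
have mH : measurable_fun setT (fun p : R * R => G (a + c * p.1 + c' * p.2)%R).
  apply: (measurableT_comp mG); apply: measurable_funD.
    apply: measurable_funD; first exact: measurable_cst.
    by apply: measurable_funM; [exact: measurable_cst|exact: measurable_fst].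
  by apply: measurable_funM; [exact: measurable_cst|exact: measurable_snd].
have /= E := @fubini_tonelli _ _ R R R nu nu' _ mH (fun p => G0 _).
rewrite E; apply: eq_integral => v _; apply: eq_integral => w _.
by rewrite addrAC.
Qed.

Lemma le_cvl nu c G G' : (forall s, 0 <= G s) -> measurable_fun setT G ->
  measurable_fun setT G' -> (forall s, G s <= G' s) ->
  forall a, cvl nu c G a <= cvl nu c G' a.
Proof.
move=> G0 mG mG' GG' a; apply: ge0_le_integral => //.
- exact: measurableT_comp mG (measurable_affine a c).
- exact: measurableT_comp mG' (measurable_affine a c).
Qed.

Lemma cvl_add nu c G (e : R) : (forall s, 0 <= G s) -> measurable_fun setT G ->
  (0 <= e)%R -> forall a, cvl nu c (fun s => G s + e%:E) a = cvl nu c G a + e%:E.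
Proof.
move=> G0 mG e0 a; rewrite /cvl ge0_integralD//; last first.
  exact: measurableT_comp mG (measurable_affine a c).
by rewrite integral_cst// [X in _ + _ * X]probability_setT mule1.
Qed.

Lemma cvl_le1 nu c G : (forall s, 0 <= G s <= 1) -> measurable_fun setT G ->
  forall a, 0 <= cvl nu c G a <= 1.
Proof.
move=> G01 mG a; rewrite cvl_ge0 /=; last by move=> s; case/andP: (G01 s).
apply: (@le_trans _ _ (\int[nu]_v 1)).
  apply: ge0_le_integral => //.
  - by move=> s _; case/andP: (G01 (a + c * s)%R).
  - exact: measurableT_comp mG (measurable_affine a c).
  - by move=> s _; case/andP: (G01 (a + c * s)%R).
by rewrite integral_cst// mul1e; apply: probability_le1.
Qed.

End cvl.

Section rV_power_probability.
Context (R : realType).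
Local Open Scope ereal_scope.

(** [rV_power] is typed as a sigma-finite measure; this synonym carries the probability
    structure. *)
Definition rV_powerP (p : probability R R) n : set 'rV[R]_n -> \bar R := rV_power p n.

HB.instance Definition _ p n := Measure.on (@rV_powerP p n).

Let rV_powerP_setT p n : @rV_powerP p n setT = 1.
Proof.
have := @rV_powerE R p n (fun=> setT) (fun=> measurableT).
rewrite (_ : [set v | _] = setT); last by apply/seteqP.
rewrite /rV_powerP => ->; rewrite big1// => i _; exact: probability_setT.
Qed.

HB.instance Definition _ p n := Measure_isProbability.Build _ _ _ (@rV_powerP p n) (@rV_powerP_setT p n).

Lemma rV_power_coord (p : probability R R) n (i : 'I_n) A : measurable A ->
  rV_powerP p ((fun v : 'rV[R]_n => v ord0 i) @^-1` A) = p A.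
Proof.
move=> mA; pose B j := if j == i then A else setT.
have mB j : measurable (B j) by rewrite /B; case: ifP.
have := rV_powerE p mB.
rewrite (_ : [set v : 'rV_n | _] = (fun v : 'rV[R]_n => v ord0 i) @^-1` A); last first.
  apply/seteqP; split => v /=; first by move=> /(_ i); rewrite /B eqxx.
  by move=> Av j; rewrite /B; case: eqP => // ->.
rewrite /rV_powerP => ->; rewrite (bigD1 i)//= /B eqxx big1 ?mule1//.
by move=> j /negbTE ->; exact: probability_setT.
Qed.

Lemma measurable_sum_coord n : measurable_fun setT (fun v : 'rV[R]_n => (\sum_i v ord0 i)%R).
Proof. by apply: measurable_sum => i; exact: measurable_coord. Qed.

(** Tonelli peels off the first coordinate, so an i.i.d. sum acts on a test function as an iterated
    convolution. The limit law enters the operator calculus through this identity. *)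
Lemma rV_power_cvl (p : probability R R) n (c : R) (G : R -> \bar R) a :
  (forall s, 0 <= G s) -> measurable_fun setT G ->
  \int[rV_powerP p (n:=n)]_v G (a + c * \sum_i v ord0 i)%R = iter n (cvl p c) G a.
Proof.
move=> G0 mG; elim: n a => [|n IH] a.
  rewrite /= (_ : (fun v => _) = (fun=> G a)); last first.
    by apply/funext => v; rewrite big_ord0 mulr0 addr0.
  by rewrite integral_dirac// diracT mul1e.
have mf k b : measurable_fun setT (fun v : 'rV[R]_k => G (b + c * \sum_i v ord0 i)%R).
  apply: (measurableT_comp mG); apply: (measurableT_comp (measurable_affine b c)).
  exact: measurable_sum_coord.
rewrite iterS -[LHS]/(\int[pushforward (p \x rV_power p n) (@rV_cons R n)]_v _).
rewrite ge0_integral_pushforward//; last exact: mf.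
rewrite preimage_setT fubini_tonelli1; last 2 first.
- exact: measurableT_comp (mf _ _) (@measurable_rV_cons R n).
- by move=> v; exact: G0.
apply: eq_integral => x _; rewrite /fubini_F -IH.
apply: eq_integral => v _ /=; congr (G _).
rewrite big_ord_recl rV_cons0/= mulrDr addrA; congr (_ + _ * _)%R.
  by apply: eq_bigr => i _; rewrite rV_consS.
exact: measurable_rV_cons.
Qed.

End rV_power_probability.

(** * Geometry of the match *)

Section measurable_sets.
Context d (Z : measurableType d) (R : realType).

Lemma measurable_set_bool (b : Z -> bool) : measurable_fun setT b ->
  measurable [set z | b z].
Proof. by move=> mb; have := mb measurableT [set true] I; rewrite setTI. Qed.

Lemma measurable_set_ler (f g : Z -> R) : measurable_fun setT f ->
  measurable_fun setT g -> measurable [set z | f z <= g z].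
Proof. by move=> mf mg; exact/measurable_set_bool/measurable_fun_ler. Qed.

Lemma measurable_set_ltr (f g : Z -> R) : measurable_fun setT f ->
  measurable_fun setT g -> measurable [set z | f z < g z].
Proof. by move=> mf mg; exact/measurable_set_bool/measurable_fun_ltr. Qed.

(** Any Boolean function of finitely many events is an event. Applied to all pairwise comparisons of
    distances, it makes the result of the sort measurable without an analysis of [sort]. *)
Lemma measurable_set_finite (I : finType) (b : Z -> I -> bool)
    (phi : {ffun I -> bool} -> bool) :
  (forall i, measurable [set z | b z i]) ->
  measurable [set z | phi [ffun i => b z i]].
Proof.
move=> mb.
rewrite (_ : [set z | _] = \bigcup_(r in [set r | phi r])
    \bigcap_(i in [set: I]) [set z | b z i = r i]); last first.
  apply/seteqP; split => z /=.
    by move=> pz; exists [ffun i => b z i] => //= i _ /=; rewrite ffunE.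
  move=> [r /= pr H]; rewrite (_ : [ffun i => b z i] = r)//.
  by apply/ffunP => i; rewrite ffunE; exact: H.
apply: fin_bigcup_measurable; first exact: finite_finset.
move=> r _; apply: fin_bigcap_measurable; first exact: finite_finset.
move=> i _; case: (r i); first exact: mb.
rewrite (_ : [set z | _] = ~` [set z | b z i]); first exact: measurableC.
by apply/seteqP; split => z /=; [move=> ->|move/negP/negbTE].
Qed.

End measurable_sets.

Section geometry.
Context (R : realType) (k : nat).
Implicit Types (x y : 'rV[R]_k) (V : 'M[R]_k).

Lemma coord_le_norm x i : `|x ord0 i| <= `|x|.
Proof.
rewrite [leRHS]/Num.norm /= mx_normrE; apply/bigmax_geP; right => /=.
by exists (ord0, i).
Qed.

Lemma norm_ltP x (e : R) : 0 < e -> (`|x| < e) <-> (forall i, `|x ord0 i| < e).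
Proof.
move=> e0; split=> [xe i|H]; first exact: le_lt_trans (coord_le_norm _ _) xe.
rewrite [ltLHS]/Num.norm /= mx_normrE; apply/bigmax_ltP; split => // -[a i] _ /=.
by rewrite ord1; exact: H.
Qed.

Lemma quadE V x : (x *m V *m x^T) ord0 ord0 =
  \sum_j (\sum_i x ord0 i * V i j) * x ord0 j.
Proof. by rewrite mxE; apply: eq_bigr => j _; rewrite !mxE. Qed.

Lemma quad_le V x : (x *m V *m x^T) ord0 ord0 <= (\sum_j \sum_i `|V i j|) * `|x| ^+ 2.
Proof.
rewrite quadE mulr_suml; apply: ler_sum => j _.
rewrite mulr_suml mulr_suml; apply: ler_sum => i _.
apply: le_trans (ler_norm _) _; rewrite !normrM mulrAC (mulrC `|V i j|) expr2.
by apply: ler_wpM2r => //; apply: ler_pM => //; exact: coord_le_norm.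
Qed.

Lemma dist_le V : exists2 C : R, 0 < C & forall x y, dist V x y <= C * `|x - y|.
Proof.
have S0 : 0 <= \sum_j \sum_i `|V i j|.
  by apply: sumr_ge0 => j _; apply: sumr_ge0.
(* The [+ 1] keeps the constant positive when [V] vanishes. *)
exists (Num.sqrt (\sum_j \sum_i `|V i j| + 1)).
  by rewrite sqrtr_gt0 ltr_wpDl.
move=> x y; rewrite /dist -[X in _ * X]normr_id -sqrtr_sqr -sqrtrM ?addr_ge0//.
apply: ler_wsqrtr; apply: le_trans (quad_le _ _) _; apply: ler_wpM2r.
  exact: sqr_ge0.
by rewrite lerDl.
Qed.

Lemma cvg_bigsum (T : Type) (FF : set_system T) {FFF : Filter FF} (I : Type)
    (r : seq I) (F : I -> T -> R) (l : I -> R) :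
  (forall i, F i x @[x --> FF] --> l i) ->
  (\sum_(i <- r) F i x) @[x --> FF] --> \sum_(i <- r) l i.
Proof.
move=> Fl; elim: r => [|i r IH].
  by under eq_fun do rewrite big_nil; rewrite big_nil; exact: cvg_cst.
by under eq_fun do rewrite big_cons; rewrite big_cons; exact: cvgD.
Qed.

Lemma quad_continuous V : continuous (fun x => (x *m V *m x^T) ord0 ord0).
Proof.
move=> x; rewrite (_ : (fun x : 'rV_k => _) =
  (fun x => \sum_j (\sum_i x ord0 i * V i j) * x ord0 j)); last first.
  by apply/funext => y; rewrite quadE.
have cc i : y ord0 i @[y --> x] --> x ord0 i by exact: coord_continuous.
apply: (cvg_bigsum (FF := nbhs x)) => j; apply: (@cvgM _ _ (nbhs x)); last exact: cc.
apply: (cvg_bigsum (FF := nbhs x)) => i; apply: (@cvgM _ _ (nbhs x)); first exact: cc.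
exact: cvg_cst.
Qed.

(** The quadratic form attains a positive minimum on the compact unit sphere of the max norm, and
    homogeneity extends the bound to all vectors. [0 < k] makes the sphere nonempty. *)
Lemma dist_ge V : (0 < k)%N -> positive_definite V ->
  exists2 c : R, 0 < c & forall x y, c * `|x - y| <= dist V x y.
Proof.
move=> k0 [_ Vpos].
pose q x := (x *m V *m x^T) ord0 ord0.
pose S := [set x : 'rV[R]_k | `|x| = 1].
have S0 : S !=set0.
  exists (const_mx 1) => /=; apply/eqP; rewrite eq_le; apply/andP; split.
    rewrite [leLHS]/Num.norm /= mx_normrE; apply/bigmax_leP; split => // i _.
    by rewrite mxE normr1.
  by rewrite (le_trans _ (coord_le_norm _ (Ordinal k0)))// mxE normr1.
have cS : compact S.
  apply: bounded_closed_compact.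
    by exists 1; split => // M M1 x /= ->; exact: ltW.
  rewrite (_ : S = (fun x : 'rV[R]_k => `|x|) @^-1` [set 1])//.
  by apply: closed_comp; [move=> x _; exact: norm_continuous|exact: closed_eq].
have [c cS' cmin] := EVT_min_rV S0 cS (continuous_subspaceT (@quad_continuous V)).
have c1 : `|c| = 1 by move: cS'; rewrite inE.
have qc : 0 < q c.
  apply: Vpos; apply/eqP => c0; move: c1; rewrite c0 normr0 => /eqP.
  by rewrite eq_sym oner_eq0.
have qZ a x : q (a *: x) = a ^+ 2 * q x.
  by rewrite /q linearZ/= -scalemxAr -!scalemxAl !mxE mulrA expr2.
exists (Num.sqrt (q c)); first by rewrite sqrtr_gt0.
move=> x y; rewrite /dist -/(q (x - y)); set z := x - y.
have [->|z0] := eqVneq z 0; first by rewrite normr0 mulr0 sqrtr_ge0.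
have nz : 0 < `|z| by rewrite normr_gt0.
have : q c <= q (`|z|^-1 *: z).
  by apply: cmin; rewrite inE /S/= normrZ normfV normr_id mulVf// gt_eqF.
rewrite qZ exprVn mulrC ler_pdivlMr ?exprn_gt0// => H.
rewrite -(ger0_norm (ltW nz)) -sqrtr_sqr -sqrtrM ?(ltW qc)//.
exact: ler_wsqrtr.
Qed.

(** The centres are kept inside [C]: for the treated support this gives their balls positive control
    mass. *)
Lemma compact_ball_cover (C : set 'rV[R]_k) (e : R) : compact C -> 0 < e ->
  exists2 s : seq 'rV[R]_k, (forall c, c \in s -> C c) &
    forall x, C x -> exists2 c, c \in s & `|c - x| < e.
Proof.
rewrite compact_cover => cC e0.
have [||D DC Dcov] := cC 'rV[R]_k C (fun c => ball c e).
- by move=> c _; exact: ball_open.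
- by move=> x Cx; exists x => //; exact: ballxx.
exists (finmap.enum_fset D).
  by move=> c cD; have := DC c cD; rewrite inE.
by move=> x /Dcov[c /= cD]; rewrite mx_norm_ball => xc; exists c.
Qed.

Lemma measurable_norm_ball c (e : R) : measurable [set x : 'rV[R]_k | `|c - x| < e].
Proof.
have [e0|e0] := ltP 0 e; last first.
  rewrite (_ : [set x | _] = set0)//; apply/seteqP; split => x //=.
  by rewrite ltNge (le_trans e0).
rewrite (_ : [set x | _] = \bigcap_(i in [set: 'I_k])
    [set x : 'rV[R]_k | `|c ord0 i - x ord0 i| < e]); last first.
  apply/seteqP; split => x /=.
    by move/(norm_ltP _ e0) => H i _ /=; have := H i; rewrite !mxE.
  by move=> H; apply/(norm_ltP _ e0) => i; rewrite !mxE; exact: H.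
apply: fin_bigcap_measurable; first exact: finite_finset.
move=> i _; apply: measurable_set_ltr => //.
apply: measurableT_comp => //; apply: measurable_funB => //.
exact: measurable_coord.
Qed.

(** The sigma-algebra is generated by coordinates, not by open sets. A compact set is the
    intersection over [m] of finite unions of balls of radius [1 / (m + 1)] centred in it, and these
    balls are products of intervals. *)
Lemma compact_measurable_rV (C : set 'rV[R]_k) : compact C -> measurable C.
Proof.
move=> cC.
have e_gt0 (m : nat) : 0 < (m.+1%:R : R)^-1 by rewrite invr_gt0 ltr0n.
have H m := compact_ball_cover cC (e_gt0 m).
pose s m := sval (cid2 (H m)).
have sC m c : c \in s m -> C c by rewrite /s; case: cid2 => //= ? + _; apply.
have scov m x : C x -> exists2 c, c \in s m & `|c - x| < m.+1%:R^-1.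
  by rewrite /s; case: cid2 => //= ? _; apply.
rewrite (_ : C = \bigcap_m \bigcup_(c in [set` s m])
    [set x : 'rV[R]_k | `|c - x| < m.+1%:R^-1]); last first.
  apply/seteqP; split => x.
    by move=> Cx m _; have [c cs cx] := scov m x Cx; exists c.
  move=> Hx; have clC : closed C by exact: compact_closed.
  apply: clC => B /nbhs_ballP[e /= e0 eB].
  have [m me] : exists m : nat, m.+1%:R^-1 < e.
    exists (Num.trunc (e^-1)).
    rewrite -[ltRHS]invrK ltf_pV2 ?posrE ?invr_gt0//.
    exact: truncnS_gt.
  have [c cs cx] := Hx m I; exists c; split; first exact: sC cs.
  apply: eB; rewrite mx_norm_ball /ball_/= distrC.
  exact: lt_trans me.
apply: bigcapT_measurable => m; apply: fin_bigcup_measurable.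
  exact: finite_seq.
by move=> c _; exact: measurable_norm_ball.
Qed.

Lemma measurable_dist V d (Z : measurableType d) (f g : Z -> 'rV[R]_k) :
  measurable_fun setT f -> measurable_fun setT g ->
  measurable_fun setT (fun z => dist V (f z) (g z)).
Proof.
move=> mf mg.
have mc i : measurable_fun setT (fun z => f z ord0 i - g z ord0 i).
  by apply: measurable_funB; exact: (measurableT_comp (measurable_coord i)).
rewrite /dist; apply: (@measurableT_comp _ _ _ _ _ _ (@Num.sqrt R)).
  by apply: continuous_measurable_fun; exact: sqrt_continuous.
under eq_fun do rewrite quadE.
apply: measurable_sum => j; apply: measurable_funM; last first.
  by under eq_fun do rewrite !mxE; exact: mc.
apply: measurable_sum => i; apply: measurable_funM => //.
by under eq_fun do rewrite !mxE; exact: mc.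
Qed.

(** The sorted list is a function of the finitely many truth values of the distance comparisons. *)
Lemma measurable_mem_nearest V (M n : nat) d (Z : measurableType d)
    (x : Z -> 'rV[R]_k) (y : Z -> 'I_n -> 'rV[R]_k) j :
  measurable_fun setT x -> (forall i, measurable_fun setT (fun z => y z i)) ->
  measurable [set z | j \in nearest_neighbors V M (x z) (y z)].
Proof.
move=> mx my.
have mb (p : 'I_n * 'I_n) :
    measurable [set z | dist V (x z) (y z p.1) <= dist V (x z) (y z p.2)].
  by apply: measurable_set_ler; exact: measurable_dist.
have := @measurable_set_finite _ Z _ _
  (fun r => j \in take M (sort (fun a b => r (a, b)) (enum 'I_n))) mb.
congr measurable; apply/seteqP; split => z /=.
  rewrite inE; congr (is_true (_ \in take _ (sort _ _))).
  by apply/funext => a; apply/funext => b; rewrite ffunE.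
rewrite inE; congr (is_true (_ \in take _ (sort _ _))).
by apply/funext => a; apply/funext => b; rewrite ffunE.
Qed.

(** If a chosen [j] were farther than [r], every index of [A] would be strictly closer and hence
    chosen as well, which makes more than [M] chosen indices. *)
Lemma nearest_neighbors_near V (M n : nat) x (y : 'I_n -> 'rV[R]_k) (r : R)
    (A : {set 'I_n}) :
  (M <= #|A|)%N -> (forall i, i \in A -> dist V x (y i) <= r) ->
  forall j, j \in nearest_neighbors V M x y -> dist V x (y j) <= r.
Proof.
move=> MA Ar j jN; rewrite leNgt; apply/negP => rj.
have sA : A \subset nearest_neighbors V M x y :\ j.
  apply/fintype.subsetP => i iA; rewrite in_setD1; apply/andP; split.
    by apply: contraTneq rj => <-; rewrite -leNgt; exact: Ar.
  apply: contraT => iN.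
  have := nearest_neighbors_closest jN iN.
  by rewrite leNgt (le_lt_trans (Ar i iA)).
have := subset_leq_card sA; have := cardsD1 j (nearest_neighbors V M x y).
rewrite jN card_nearest_neighbors => E; have : (minn M n <= M)%N by exact: geq_minl.
rewrite E add1n => H1 H2; have := leq_trans MA H2.
by rewrite leqNgt H1.
Qed.

End geometry.

Lemma integral_indicT d (T : measurableType d) (R : realType)
    (mu : {measure set T -> \bar R}) (A : set T) : measurable A ->
  (\int[mu]_x (\1_A x)%:E = mu A)%E.
Proof. by move=> mA; rewrite integral_indic// setIT. Qed.

Lemma le_measure_bigsetU d (T : measurableType d) (R : realType)
    (mu : {measure set T -> \bar R}) (I : Type) (s : seq I) (F : I -> set T) :
  (forall i, measurable (F i)) ->
  (mu (\big[setU/set0]_(i <- s) F i) <= \sum_(i <- s) mu (F i))%E.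
Proof.
move=> mF; elim: s => [|x s IH]; first by rewrite !big_nil measure0.
rewrite !big_cons; apply: (@le_trans _ _ (mu (F x) + mu (\big[setU/set0]_(i <- s) F i))%E).
  by apply: measureU2 => //; exact: bigsetU_measurable.
exact: leeD2l.
Qed.

(** * Pooled samples and the proximity of matches *)

Section box_law_facts.
Context d (T : measurableType d) (R : realType) (N : nat).
Local Open Scope ereal_scope.
Variables (mu : 'I_N -> probability T R) (rho : probability (N.-tuple T) R).
Hypothesis rhoE : box_law mu rho.

Lemma box_law_coord s (A : set T) : measurable A ->
  rho [set z | A (tnth z s)] = mu s A.
Proof.
move=> mA; pose B j := if j == s then A else setT.
have mB j : measurable (B j) by rewrite /B; case: ifP.
rewrite (_ : [set z | _] = box B); last first.
  apply/seteqP; split => z /=; last by move=> /(_ s); rewrite /B eqxx.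
  by move=> Az j; rewrite /B; case: eqP => // ->.
rewrite [LHS](rhoE mB) (bigD1 s)//= /B eqxx big1 ?mule1// => j /negbTE ->.
exact: probability_setT.
Qed.

Lemma ae_coord s (A : set T) : {ae mu s, forall u, A u} ->
  {ae rho, forall z, A (tnth z s)}.
Proof.
move=> [B [mB B0 AB]]; exists [set z | B (tnth z s)]; split.
- by rewrite -[X in measurable X]setTI; exact: measurable_tnth.
- by rewrite box_law_coord.
- by move=> z /= Az; apply: AB.
Qed.

Lemma box_law_avoid (J : {set 'I_N}) (nu : probability T R) (A : set T) :
  measurable A -> (forall s, s \in J -> mu s = nu) ->
  measurable [set z : N.-tuple T | forall s, s \in J -> A (tnth z s)] /\
  rho [set z | forall s, s \in J -> A (tnth z s)] = ((fine (nu A)) ^+ #|J|)%:E.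
Proof.
move=> mA muJ; pose B j := if j \in J then A else setT.
have mB j : measurable (B j) by rewrite /B; case: ifP.
rewrite (_ : [set z | _] = box B); last first.
  apply/seteqP; split => z /=.
    by move=> Az j; rewrite /B; case: ifP => // /Az.
  by move=> Bz s sJ; have := Bz s; rewrite /B sJ.
split; first exact: measurable_box.
rewrite [LHS](rhoE mB) (bigID [in J])/= [X in _ * X]big1 ?mule1; last first.
  by move=> j /negbTE jJ; rewrite /B jJ; exact: probability_setT.
rewrite (eq_bigr (fun=> (fine (nu A))%:E)); last first.
  move=> j jJ; rewrite /B jJ muJ// fineK//.
  exact: fin_num_measure.
by rewrite prodEFin prodr_const.
Qed.

End box_law_facts.

Section blocks.
Context (N1 M n : nat) (M0 : (0 < M)%N).
Let q := (n %/ M)%N.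

Lemma block_subproof (m : 'I_M) (t : 'I_q) : (m * q + t < n)%N.
Proof.
apply: (@leq_trans (m.+1 * q)%N); first by rewrite mulSn addnC ltn_add2r.
apply: (@leq_trans (M * q)%N); first by rewrite leq_mul2r ltn_ord orbT.
by rewrite mulnC leq_divM.
Qed.

(* A ball holds M controls as soon as each of M disjoint blocks of controls hits it, and
   the probability of missing one block decays geometrically with its size. *)
Definition block_elt m t : 'I_(N1 + n) := rshift N1 (Ordinal (block_subproof m t)).

Definition block m : {set 'I_(N1 + n)} := [set block_elt m t | t in 'I_q].

Lemma card_block m : #|block m| = q.
Proof.
rewrite card_imset ?card_ord// => t t' /(@rshift_inj N1 n)/(congr1 val)/= /eqP.
by rewrite eqn_add2l => /eqP /val_inj.
Qed.

Lemma hits_blocks (A : {set 'I_n}) :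
  (forall m, exists2 j, rshift N1 j \in block m & j \in A) -> (M <= #|A|)%N.
Proof.
move=> H; pose f m := sval (cid2 (H m)).
have fB m : rshift N1 (f m) \in block m by rewrite /f; case: cid2.
have fA m : f m \in A by rewrite /f; case: cid2.
(* Block [m] consists of the indices [m * q + t] with [t < q], so division by [q] recovers [m] and
   hits in different blocks are different controls. *)
have fq m : (f m %/ q)%N = m.
  have /imsetP[t _ /(@rshift_inj N1 n)/(congr1 val)/= ->] := fB m.
  have q0 : (0 < q)%N by exact: leq_trans (ltn_ord t).
  by rewrite divnMDl// divn_small ?addn0.
have finj : injective f by move=> m m' E; apply: val_inj; rewrite /= -(fq m) -(fq m') E.
rewrite -[leqLHS](card_ord M) -(card_imset _ finj).
by apply: subset_leq_card; apply/fintype.subsetP => _ /imsetP[m _ ->].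
Qed.

End blocks.

Section neighbors.
Context (R : realType) (k : nat).
Local Notation U := (R * 'rV[R]_k)%type.
Variables (mu1 mu0 : probability U R).

Definition unit_law N1 n (s : 'I_(N1 + n)) : probability U R :=
  match fintype.split s with inl _ => mu1 | inr _ => mu0 end.

Lemma unit_law_treated N1 n i : @unit_law N1 n (lshift n i) = mu1.
Proof. by rewrite /unit_law (unsplitK (inl i : 'I_N1 + 'I_n)). Qed.

Lemma unit_law_control N1 n j : @unit_law N1 n (rshift N1 j) = mu0.
Proof. by rewrite /unit_law (unsplitK (inr j : 'I_N1 + 'I_n)). Qed.

Definition xt N1 n (z : (N1 + n).-tuple U) i := (tnth z (lshift n i)).2.
Definition xc N1 n (z : (N1 + n).-tuple U) j := (tnth z (rshift N1 j)).2.

Lemma measurable_ball_snd (x : 'rV[R]_k) (e : R) :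
  measurable [set u : U | `|x - u.2| < e].
Proof.
have := @measurable_snd _ _ R 'rV[R]_k measurableT _ (measurable_norm_ball x e).
by rewrite setTI.
Qed.

(** Redrawing unit [i'] with unit [i] frozen turns the event into a ball with a fixed centre, whose
    mass is at most [C] wherever the centre lies. *)
Lemma pairs_far N1 n (rho : probability ((N1 + n).-tuple U) R) (C : R)
    (i i' : 'I_N1) (r : R) :
  box_law (@unit_law N1 n) rho -> i != i' ->
  (forall x : 'rV[R]_k, (mu1 [set u | (`|x - u.2| < r)%R] <= C%:E)%E) ->
  measurable [set z : (N1 + n).-tuple U | `|xt z i - xt z i'| < r] /\
  (rho [set z | (`|xt z i - xt z i'| < r)%R] <= C%:E)%E.
Proof.
move=> rhoE ii' HC.
have mA : measurable [set z : (N1 + n).-tuple U | `|xt z i - xt z i'| < r].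
  have mx s : measurable_fun setT (fun z : (N1 + n).-tuple U => (tnth z s).2).
    exact: measurable_snd_tnth.
  have md : measurable_fun setT (fun z : (N1 + n).-tuple U => xt z i - xt z i').
    apply: measurable_fun_rV => a; under eq_fun do rewrite !mxE.
    by apply: measurable_funB; exact: (measurableT_comp (measurable_coord a) (mx _)).
  have := md measurableT _ (measurable_norm_ball (0 : 'rV[R]_k) r); rewrite setTI.
  by congr measurable; apply/seteqP; split => z /=; rewrite sub0r normrN.
split => //.
rewrite -(integral_indicT rho mA).
rewrite (resample rhoE (lshift n i')); last 2 first.
- exact/measurable_EFinP/measurable_indic.
- by move=> z; rewrite lee_fin.
apply: (@le_trans _ _ (\int[rho]_z C%:E)%E); last first.
  by rewrite integral_cst// [X in (_ * X)%E]probability_setT mule1.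
have mI x := measurable_ball_snd x r.
have E z : (\int[unit_law (lshift n i')]_u
    (\1_[set z | (`|xt z i - xt z i'| < r)%R] (upd z (lshift n i') u))%:E =
    mu1 [set u | (`|xt z i - u.2| < r)%R])%E.
  rewrite unit_law_treated -(integral_indicT mu1 (mI _)); apply: eq_integral => u _.
  congr (_%:E); rewrite !indicE; congr (_%:R); congr nat_of_bool.
  apply/idP/idP; rewrite !inE /= /xt !tnth_upd eqxx (inj_eq (@lshift_inj N1 n)).
    by rewrite (negbTE ii').
  by rewrite (negbTE ii').
under eq_integral do rewrite E.
apply: ge0_le_integral => //.
- under eq_fun do rewrite -E.
  have mK : measurable_kernel_fam (fun _ : (N1 + n).-tuple U => @unit_law N1 n (lshift n i')).
    by move=> B mB; exact: measurable_cst.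
  apply: (measurable_kernel_integral mK (f := fun zu => (\1_[set z | (`|xt z i - xt z i'| < r)%R] (upd zu.1 (lshift n i') zu.2))%:E)).
    by move=> zu; rewrite lee_fin.
  apply/measurable_EFinP.
  exact: (measurableT_comp (measurable_indic mA) (measurable_upd _)).
Qed.

Variables (S1 : set 'rV[R]_k) (V : 'M[R]_k).
Hypothesis k0 : (0 < k)%N.
Hypothesis Vpos : positive_definite V.
Hypothesis cS1 : compact S1.
Hypothesis S1_supp : forall (x : 'rV[R]_k) (e : R), S1 x -> 0 < e ->
  (0 < mu0 [set u | (`|x - u.2| < e)%R])%E.

(** Finitely many small balls centred in [S1] cover [S1], each with positive control mass. The bad
    event is that one of [M] blocks of controls misses one of these balls; its probability is
    geometric in the block size, with a rate depending on neither [n] nor [rho]. *)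
Lemma neighbors_close (N1 M : nat) (delta eps : R) : (0 < M)%N -> 0 < delta -> 0 < eps ->
  exists n0 : nat, forall n (rho : probability ((N1 + n).-tuple U) R),
  (n0 <= n)%N -> box_law (@unit_law N1 n) rho ->
  (M <= n)%N /\
  exists B, [/\ measurable B, (rho B <= eps%:E)%E &
    forall z, ~ B z -> forall i, S1 (xt z i) ->
    forall j, j \in nearest_neighbors V M (xt z i) (xc z) -> `|xt z i - xc z j| < delta].
Proof.
move=> M0 delta0 eps0.
have [C C0 HC] := dist_le V.
have [c c0 Hc] := dist_ge k0 Vpos.
(* A treated unit and the controls in the same ball of radius [e] are at [dist V] at most
   [2 * e * C]. Passing back to the norm divides by [c], which gives [delta / 2]. *)
pose e := delta * c / (C * 4).
have e0 : 0 < e by rewrite /e divr_gt0 ?mulr_gt0.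
have [s sS scov] := compact_ball_cover cS1 e0.
pose r x := fine (mu0 (~` [set u | `|x - u.2| < e])).
have mb x := measurable_ball_snd x e.
have r01 x : x \in s -> 0 <= r x < 1.
  move=> xs; rewrite /r fine_ge0//= probability_setC//.
  have := S1_supp (sS x xs) e0.
  have : mu0 [set u | `|x - u.2| < e] \is a fin_num by exact: fin_num_measure.
  by case: (mu0 _) => // a _; rewrite lte_fin/= => a0; rewrite ltrBlDr ltrDl.
(* The union bound over balls and blocks, for blocks of size [q]. The guard is there because
   [r x < 1] is known for centres in [s] only. *)
pose w (q : nat) := \sum_(x <- s) (if x \in s then M%:R * r x ^+ q else 0).
have w0 : w q @[q --> \oo] --> 0.
  have -> : 0 = \sum_(x <- s) 0 :> R by rewrite big1.
  have H x : (if x \in s then M%:R * r x ^+ q else 0) @[q --> \oo] --> (0 : R).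
    have [xs|xs] := boolP (x \in s); last exact: cvg_cst.
    rewrite -[X in _ --> X](mulr0 M%:R); apply: cvgMr.
    by apply: cvg_expr; have /andP[a b] := r01 x xs; rewrite ger0_norm.
  exact: (cvg_bigsum (FF := \oo) (r := s) H).
have /cvgrPdist_lt /(_ _ eps0) [q0 _ Hq0] := w0.
(* [q0 * M <= n] makes every block at least [q0] long, and [M <= n] gives every treated unit exactly
   [M] matches. *)
exists (maxn M (q0 * M)%N) => n rho; rewrite geq_max => /andP[Mn qn] rhoE.
split => //.
have qq : (q0 <= n %/ M)%N by rewrite leq_divRL.
pose Bx (x : 'rV[R]_k) (m : 'I_M) := [set z : (N1 + n).-tuple U |
  forall t, t \in @block N1 M n m -> (~` [set u | `|x - u.2| < e]) (tnth z t)].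
have HB x m : measurable (Bx x m) /\ rho (Bx x m) = (r x ^+ (n %/ M))%:E.
  have := box_law_avoid (J := @block N1 M n m) (nu := mu0) (A := ~` [set u | `|x - u.2| < e])
    rhoE (measurableC (mb x)).
  rewrite card_block; apply.
  by move=> t /imsetP[t' _ ->]; exact: unit_law_control.
exists (\big[setU/set0]_(x <- s) \big[setU/set0]_(m < M) Bx x m); split.
- by apply: bigsetU_measurable => x _; apply: bigsetU_measurable => m _; case: (HB x m).
- apply: (@le_trans _ _ (w (n %/ M)%N)%:E); last first.
    rewrite lee_fin; apply: ltW; apply: le_lt_trans (Hq0 _ qq).
    by rewrite sub0r normrN ler_norm.
  rewrite /w -sumEFin.
  have mBm x : measurable (\big[setU/set0]_(m < M) Bx x m).
    by apply: bigsetU_measurable => m _; case: (HB x m).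
  have HBm x : (rho (\big[setU/set0]_(m < M) Bx x m) <= (M%:R * r x ^+ (n %/ M))%:E)%E.
    apply: (@le_trans _ _ (\sum_(m < M) rho (Bx x m))%E).
      by apply: le_measure_bigsetU => m; case: (HB x m).
    under eq_bigr do rewrite (HB _ _).2.
    by rewrite sumEFin sumr_const card_ord mulr_natl.
  rewrite big_seq [in leRHS]big_seq.
  under [in leRHS]eq_bigr => x xs do rewrite xs.
  rewrite -big_seq -[in leRHS]big_seq.
  apply: le_trans (le_measure_bigsetU rho s mBm) _.
  by apply: lee_sum => x _; exact: HBm.
- move=> z zB i Si j.
  have [x xs xi] := scov _ Si.
  pose A := [set a : 'I_n | `|x - xc z a| < e]%SET.
  have AM : (M <= #|A|)%N.
    apply: (@hits_blocks N1 M n) => m.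
    have : ~ Bx x m z.
      move=> Bz; apply: zB; rewrite -bigcup_seq; exists x => //.
      by rewrite -bigcup_seq; exists m => //=; rewrite mem_index_enum.
    move=> /existsNP[t /not_implyP[tb /contrapT /= tx]].
    have /imsetP[t' _ E] := tb.
    exists (Ordinal (block_subproof m t')); first by rewrite -/(@block_elt N1 M n m t') -E.
    by rewrite inE /xc -/(@block_elt N1 M n m t') -E.
  have near a : a \in A -> dist V (xt z i) (xc z a) <= C * (2 * e).
    rewrite inE => xa; apply: le_trans (HC _ _) _; rewrite ler_pM2l//.
    apply: ltW; rewrite mulr_natl mulr2n.
    rewrite (_ : xt z i - xc z a = - (x - xt z i) + (x - xc z a)); last first.
      by rewrite opprB addrA subrK.
    apply: le_lt_trans (ler_normD _ _) _; rewrite normrN.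
    exact: ltrD.
  move=> jN; have := nearest_neighbors_near AM near jN.
  move=> /(le_trans (Hc _ _)); rewrite -ler_pdivlMl// => /le_lt_trans; apply.
  have C4 : C != 0 by rewrite gt_eqF.
  have c4 : c != 0 by rewrite gt_eqF.
  rewrite (_ : c^-1 * (C * (2 * e)) = delta / 2); last by rewrite /e; field; rewrite C4 c4.
  by rewrite ltr_pdivrMr// ltr_pMr// ltr1n.
Qed.

End neighbors.

Lemma ae_forall_fin d (T : measurableType d) (R : realType)
    (mu : {measure set T -> \bar R}) (I : finType) (P : I -> T -> Prop) :
  (forall i, {ae mu, forall x, P i x}) -> {ae mu, forall x, forall i, P i x}.
Proof.
move=> H.
have : {ae mu, forall x, forall i, i \in enum I -> P i x}.
  elim: (enum I) => [|i s IH]; first exact: aeW.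
  apply: filterS2 (H i) IH => x Px Hx j; rewrite inE => /orP[/eqP -> //|].
  exact: Hx.
by apply: filterS => x Hx i; apply: Hx; rewrite mem_enum.
Qed.

Section integral_resample.
Context d (T : measurableType d) (R : realType) (N : nat).
Local Open Scope ereal_scope.
Variables (mu : 'I_N -> probability T R) (rho : probability (N.-tuple T) R).
Hypothesis rhoE : box_law mu rho.

Lemma measurable_resample s (f : N.-tuple T -> \bar R) : measurable_fun setT f ->
  (forall z, 0 <= f z) -> measurable_fun setT (fun z => \int[mu s]_u f (upd z s u)).
Proof.
move=> mf f0.
have mK : measurable_kernel_fam (fun _ : N.-tuple T => mu s).
  by move=> B mB; exact: measurable_cst.
apply: (measurable_kernel_integral mK (f := fun zu => f (upd zu.1 s zu.2))).
  by move=> zu; exact: f0.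
exact: (measurableT_comp mf (measurable_upd _)).
Qed.

Lemma integral_resample s (f : N.-tuple T -> \bar R) : rho.-integrable setT f ->
  \int[rho]_z f z = \int[rho]_z \int[mu s]_u f (upd z s u).
Proof.
move=> fi; have mf := measurable_int rho fi.
have mp : measurable_fun setT f^\+ by exact: measurable_funepos.
have mn : measurable_fun setT f^\- by exact: measurable_funeneg.
have fin (g : N.-tuple T -> \bar R) : (forall z, 0 <= g z) -> rho.-integrable setT g ->
    rho.-integrable setT (fun z => \int[mu s]_u g (upd z s u)).
  move=> g0 gi; have mg := measurable_int rho gi; apply/integrableP; split.
    exact: measurable_resample.
  under eq_integral => x _ do rewrite gee0_abs ?integral_ge0//.
  rewrite -(resample rhoE s mg g0).
  have /integrableP[_] := gi.
  by under eq_integral => x _ do rewrite gee0_abs//.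
have p0 z : 0 <= f^\+ z by exact: funepos_ge0.
have n0 z : 0 <= f^\- z by exact: funeneg_ge0.
rewrite integralE (resample rhoE s mp p0) (resample rhoE s mn n0).
rewrite -integralB//; last 2 first.
- by apply: fin => //; exact: integrable_funepos.
- by apply: fin => //; exact: integrable_funeneg.
apply: eq_integral => x _; rewrite [RHS]integralE.
by congr (_ - _); apply: eq_integral => u _; rewrite ?funeposE ?funenegE.
Qed.

Lemma integrable_coord s (f : T -> \bar R) : (mu s).-integrable setT f ->
  rho.-integrable setT (fun z => f (tnth z s)).
Proof.
move=> fi; have mf := measurable_int (mu s) fi.
have mft : measurable_fun setT (fun z : N.-tuple T => f (tnth z s)).
  by apply: (measurableT_comp mf); exact: measurable_tnth.
apply/integrableP; split => //.
rewrite (resample rhoE s); last 2 first.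
- exact: measurableT_comp.
- by move=> z; exact: abse_ge0.
under eq_integral => z _.
  under eq_integral => u _ do rewrite tnth_upd eqxx.
  over.
rewrite integral_cst// [X in _ * X]probability_setT mule1.
by have /integrableP[] := fi.
Qed.

Lemma integral_coord s (f : T -> \bar R) : (mu s).-integrable setT f ->
  \int[rho]_z f (tnth z s) = \int[mu s]_u f u.
Proof.
move=> fi; rewrite (integral_resample s (integrable_coord fi)).
under eq_integral => z _.
  under eq_integral => u _ do rewrite tnth_upd eqxx.
  over.
by rewrite integral_cst// [X in _ * X]probability_setT mule1.
Qed.

End integral_resample.

(** Heine-Cantor with continuity tested within [S] only, since the regression functions are
    controlled on the supports alone. *)
Lemma compact_unif_continuous (R : realType) (k : nat) (S : set 'rV[R]_k)
    (f : 'rV[R]_k -> R) : compact S -> {within S, continuous f} ->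
  forall e : R, 0 < e -> exists2 delta : R, 0 < delta &
    forall x y, S x -> S y -> `|x - y| < delta -> `|f x - f y| < e.
Proof.
move=> cS /subspace_continuousP cf e e0.
have e20 : 0 < e / 2 by rewrite divr_gt0.
have H (x : 'rV[R]_k) : exists r : R, 0 < r /\ (S x ->
    forall y, S y -> `|x - y| < r -> `|f x - f y| < e / 2).
  have [Sx|nSx] := pselect (S x); last by exists 1; split.
  have /cvgrPdist_lt /(_ _ e20) := cf x Sx.
  rewrite near_withinE => /nbhs_ballP[r /= r0 rP]; exists r; split => // _ y Sy xy.
  by apply: rP => //; rewrite mx_norm_ball.
have {H} [r Hr] := choice H.
have r0 x : 0 < r x by case: (Hr x).
have {}Hr x y : S x -> S y -> `|x - y| < r x -> `|f x - f y| < e / 2.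
  by move=> Sx; case: (Hr x) => _; apply.
(* The covering balls have half radius: a point within [r c / 2] of such a ball's member is still in
   the full ball around [c]. *)
move: (cS); rewrite compact_cover => /(_ _ S (fun c => ball c (r c / 2))) [||D DS Dcov].
- by move=> c _; exact: ball_open.
- by move=> x Sx; exists x => //; apply: ballxx; rewrite divr_gt0.
pose s := finmap.enum_fset D.
have : exists2 delta : R, 0 < delta & forall c, c \in s -> delta <= r c / 2.
  elim: s => [|c s [delta d0 Hd]]; first by exists 1.
  exists (Num.min delta (r c / 2)); first by rewrite lt_min d0 divr_gt0.
  move=> c'; rewrite inE => /orP[/eqP ->|/Hd H]; first by rewrite ge_min lexx orbT.
  by rewrite ge_min H.
move=> [delta d0 Hd]; exists delta => // x y Sx Sy xy.
have [c /= cD] := Dcov _ Sx; rewrite mx_norm_ball /ball_/= => cx.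
have Sc : S c by have := DS c cD; rewrite inE.
have fx : `|f c - f x| < e / 2.
  by apply: Hr => //; apply: lt_le_trans cx _; rewrite ler_pdivrMr// ler_peMr ?ltW// ltr1n.
have fy : `|f c - f y| < e / 2.
  apply: Hr => //; rewrite -(subrKA x) (splitr (r c)).
  apply: le_lt_trans (ler_normD _ _) _; apply: ltrD => //.
  exact: lt_le_trans xy (Hd _ cD).
rewrite -(subrKA (f c)) (splitr e).
by apply: le_lt_trans (ler_normD _ _) _; apply: ltrD => //; rewrite distrC.
Qed.

Section sample_estimator.
Context (R : realType) (k : nat).
Local Notation U := (R * 'rV[R]_k)%type.
Variables (V : 'M[R]_k) (M : nat).

Definition nn N1 n (z : (N1 + n).-tuple U) i : {set 'I_n} :=
  nearest_neighbors V M (xt z i) (xc z).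

Definition yt N1 n (z : (N1 + n).-tuple U) i := (tnth z (lshift n i)).1.
Definition yc N1 n (z : (N1 + n).-tuple U) j := (tnth z (rshift N1 j)).1.

Definition sample_estimator N1 n (z : (N1 + n).-tuple U) : R :=
  matching_estimator V M (fun i : 'I_N1 => tnth z (lshift n i))
    (fun j : 'I_n => tnth z (rshift N1 j)).

Lemma measurable_nn N1 n i j :
  measurable [set z : (N1 + n).-tuple U | j \in nn z i].
Proof.
apply: measurable_mem_nearest; first exact: measurable_snd_tnth.
by move=> a; exact: measurable_snd_tnth.
Qed.

Lemma sample_estimatorE N1 n (z : (N1 + n).-tuple U) :
  sample_estimator z = N1%:R^-1 * \sum_(i < N1)
    (yt z i - M%:R^-1 * \sum_(j < n) (j \in nn z i)%:R * yc z j).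
Proof.
rewrite /sample_estimator /matching_estimator; congr (_ * _).
apply: eq_bigr => i _; congr (_ - _ * _); rewrite big_mkcond/=.
by apply: eq_bigr => j _; rewrite /nn; case: ifP; rewrite ?mul1r ?mul0r.
Qed.

(** Matches see covariates only. This is what allows outcomes to be integrated out with the matched
    sets fixed. *)
Lemma nn_upd N1 n (z : (N1 + n).-tuple U) s u i :
  (tnth z s).2 = u.2 -> nn (upd z s u) i = nn z i.
Proof.
move=> E.
have H t : (tnth (upd z s u) t).2 = (tnth z t).2.
  by rewrite tnth_upd; case: eqP => // ->.
rewrite /nn /xt H; congr nearest_neighbors.
by apply/funext => j; rewrite /xc H.
Qed.

Lemma measurable_yt N1 n i : measurable_fun setT (fun z : (N1 + n).-tuple U => yt z i).
Proof. exact: measurable_fst_tnth. Qed.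

Lemma measurable_yc N1 n j : measurable_fun setT (fun z : (N1 + n).-tuple U => yc z j).
Proof. exact: measurable_fst_tnth. Qed.

Lemma measurable_nn_indic N1 n i j :
  measurable_fun setT (fun z : (N1 + n).-tuple U => (j \in nn z i)%:R : R).
Proof.
rewrite (_ : (fun z => _) = \1_[set z : (N1 + n).-tuple U | j \in nn z i]).
  exact: measurable_indic (measurable_nn _ _).
by apply/funext => z; rewrite indicE; congr (nat_of_bool _)%:R; apply/idP/idP; rewrite inE.
Qed.

Lemma measurable_sample_estimator N1 n :
  measurable_fun setT (@sample_estimator N1 n).
Proof.
rewrite (_ : @sample_estimator N1 n = fun z => N1%:R^-1 * \sum_(i < N1)
    (yt z i - M%:R^-1 * \sum_(j < n) (j \in nn z i)%:R * yc z j)); last first.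
  by apply/funext => z; exact: sample_estimatorE.
apply: measurable_funM => //; apply: measurable_sum => i.
apply: measurable_funB; first exact: measurable_yt.
apply: measurable_funM => //; apply: measurable_sum => j.
apply: measurable_funM; first exact: measurable_nn_indic.
exact: measurable_yc.
Qed.

End sample_estimator.

(** * Convergence of the mean *)

Section asymptotically_unbiased.
Context (R : realType) (k : nat).
Local Notation U := (R * 'rV[R]_k)%type.
Variables (mu1 mu0 : probability U R) (S1 S0 : set 'rV[R]_k) (V : 'M[R]_k) (N1 M : nat).
Hypothesis k0 : (0 < k)%N.
Hypothesis N10 : (0 < N1)%N.
Hypothesis M0 : (0 < M)%N.
Hypothesis Vpos : positive_definite V.
Hypothesis cS1 : compact S1.
Hypothesis cS0 : compact S0.
Hypothesis S10 : S1 `<=` S0.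
Hypothesis S1_supp : forall (x : 'rV[R]_k) (e : R), S1 x -> 0 < e ->
  (0 < mu0 [set u | (`|x - u.2| < e)%R])%E.
Hypothesis mu1S1 : {ae mu1, forall u, S1 u.2}.
Hypothesis mu0S0 : {ae mu0, forall u, S0 u.2}.
Variables (m0 : 'rV[R]_k -> R) (tau : R).
Hypothesis mm0 : measurable_fun setT m0.
Hypothesis m0c : {within S0, continuous m0}.
Hypothesis iY1 : mu1.-integrable setT (fun u => (u.1)%:E).
Hypothesis iY0 : mu0.-integrable setT (fun u => (u.1)%:E).
Hypothesis im0 : mu0.-integrable setT (fun u => (m0 u.2)%:E).
Hypothesis im1 : mu1.-integrable setT (fun u => (m0 u.2)%:E).
Hypothesis m0E : forall B, measurable B ->
  (\int[mu0]_(u in snd @^-1` B) (u.1)%:E = \int[mu0]_(u in snd @^-1` B) (m0 u.2)%:E)%E.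
Hypothesis tauE : (\int[mu1]_u (u.1 - m0 u.2)%:E = tau%:E)%E.

Section fixed_n.
Variables (n : nat) (rho : probability ((N1 + n).-tuple U) R).
Hypothesis rhoE : box_law (@unit_law _ _ mu1 mu0 N1 n) rho.

Let iYt i : rho.-integrable setT (fun z => (yt z i - m0 (xt z i))%:E).
Proof.
apply: (integrable_coord rhoE (s := lshift n i) (f := fun u : U => (u.1 - m0 u.2)%:E)).
by rewrite unit_law_treated; under eq_fun do rewrite EFinB; exact: integrableB.
Qed.

Let iYc j : rho.-integrable setT (fun z => (yc z j - m0 (xc z j))%:E).
Proof.
apply: (integrable_coord rhoE (s := rshift N1 j) (f := fun u : U => (u.1 - m0 u.2)%:E)).
by rewrite unit_law_control; under eq_fun do rewrite EFinB; exact: integrableB.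
Qed.

Let imc j : rho.-integrable setT (fun z => (m0 (xc z j))%:E).
Proof.
apply: (integrable_coord rhoE (s := rshift N1 j) (f := fun u : U => (m0 u.2)%:E)).
by rewrite unit_law_control.
Qed.

Let imt i : rho.-integrable setT (fun z => (m0 (xt z i))%:E).
Proof.
apply: (integrable_coord rhoE (s := lshift n i) (f := fun u : U => (m0 u.2)%:E)).
by rewrite unit_law_treated.
Qed.

Let integrable_nn (f : (N1 + n).-tuple U -> R) i j : rho.-integrable setT (EFin \o f) ->
  rho.-integrable setT (fun z => ((j \in nn V M z i)%:R * f z)%:E).
Proof.
move=> fi; have mf := measurable_int rho fi; apply: le_integrable fi => //.
  apply/measurable_EFinP; apply: measurable_funM; first exact: measurable_nn_indic.
  exact/measurable_EFinP.
by move=> z _ /=; rewrite lee_fin normrM; case: (_ \in _); rewrite ?normr1 ?mul1r// normr0 mul0r.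
Qed.

(** Once control [j] is redrawn with all other units frozen, whether it is matched to [i] depends on
    its covariate alone. Over such an event, outcome and [m0] have the same integral by [m0E]. *)
Let residual0 i j :
  (\int[rho]_z ((j \in nn V M z i)%:R * (yc z j - m0 (xc z j)))%:E = 0)%E.
Proof.
rewrite (integral_resample rhoE (rshift N1 j)); last first.
  by apply: integrable_nn; exact: iYc.
rewrite unit_law_control; apply: integral0_eq => z _.
pose B := [set x : 'rV[R]_k | j \in nearest_neighbors V M (xt z i)
  (fun a => if a == j then x else xc z a)].
have mB : measurable B.
  apply: measurable_mem_nearest => // a; case: (a == j) => //.
have mB2 : measurable [set u : U | B u.2].
  by rewrite -[X in measurable X]setTI; exact: measurable_snd.
transitivity (\int[mu0]_(u in snd @^-1` B) (u.1 - m0 u.2)%:E)%E.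
  rewrite [RHS]integral_mkcond; apply: eq_integral => u _.
  have E : nn V M (upd z (rshift N1 j) u) i =
      nearest_neighbors V M (xt z i) (fun a => if a == j then u.2 else xc z a).
    rewrite /nn /xt tnth_upd eq_lrshift; congr nearest_neighbors.
    apply/funext => a; rewrite /xc tnth_upd (inj_eq (@rshift_inj N1 n)).
    by case: ifP.
  rewrite E patchE /yc /xc tnth_upd eqxx.
  have [Bu|Bu] := pselect (B u.2).
    by rewrite mem_set// (Bu : _ \in _) mul1r.
  by rewrite memNset// (negbTE (_ : _ \notin _)) ?mul0r//; apply/negP.
under eq_integral do rewrite EFinB.
rewrite integralB//; last 2 first.
- exact: integrableS iY0.
- exact: integrableS im0.
rewrite m0E// subee//; apply: integrable_fin_num => //.
exact: integrableS im0.
Qed.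

Lemma integral_sample_estimator :
  rho.-integrable setT (EFin \o @sample_estimator R k V M N1 n) /\
  ((M <= n)%N -> (\int[rho]_z (sample_estimator V M z)%:E = tau%:E +
    \int[rho]_z (N1%:R^-1 * \sum_(i < N1) M%:R^-1 *
       \sum_(j < n) (j \in nn V M z i)%:R * (m0 (xt z i) - m0 (xc z j)))%:E)%E).
Proof.
(* The estimator is [D - E + F]: treated residuals of mean [tau], control residuals of mean zero,
   and the covariate mismatch [F], which is the whole bias. *)
pose D (z : (N1 + n).-tuple U) := N1%:R^-1 * \sum_(i < N1) (yt z i - m0 (xt z i)).
pose E (z : (N1 + n).-tuple U) := N1%:R^-1 * \sum_(i < N1) M%:R^-1 *
  \sum_(j < n) (j \in nn V M z i)%:R * (yc z j - m0 (xc z j)).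
pose F (z : (N1 + n).-tuple U) := N1%:R^-1 * \sum_(i < N1) M%:R^-1 *
  \sum_(j < n) (j \in nn V M z i)%:R * (m0 (xt z i) - m0 (xc z j)).
have iZ (c : R) (f : (N1 + n).-tuple U -> R) : rho.-integrable setT (EFin \o f) ->
    rho.-integrable setT (fun z => (c * f z)%:E).
  by move=> fi; under eq_fun do rewrite EFinM; exact: integrableZl.
have iS (I : finType) (f : I -> (N1 + n).-tuple U -> R) :
    (forall i, rho.-integrable setT (EFin \o f i)) ->
    rho.-integrable setT (fun z => (\sum_i f i z)%:E).
  move=> fi; under eq_fun do rewrite -sumEFin.
  by apply: (integrable_sum measurableT (index_enum I) (h := fun i z => (f i z)%:E)) => i _; exact: fi.
have iD : rho.-integrable setT (EFin \o D) by apply: (iZ); apply: (iS).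
have iE : rho.-integrable setT (EFin \o E).
  apply: (iZ); apply: (iS) => i; apply: (iZ); apply: (iS) => j.
  apply: integrable_nn; exact: iYc.
have iF : rho.-integrable setT (EFin \o F).
  apply: (iZ); apply: (iS) => i; apply: (iZ); apply: (iS) => j; apply: integrable_nn.
  by rewrite /comp; under eq_fun do rewrite EFinB; exact: integrableB.
have ZS (c : R) (I : finType) (f : I -> (N1 + n).-tuple U -> R) (l : I -> R) :
    (forall i, rho.-integrable setT (EFin \o f i)) ->
    (forall i, \int[rho]_z (f i z)%:E = (l i)%:E)%E ->
    (\int[rho]_z (c * \sum_i f i z)%:E = (c * \sum_i l i)%:E)%E.
  move=> fi fl; under eq_integral do rewrite EFinM.
  rewrite integralZl//; last exact: iS.
  under eq_integral do rewrite -sumEFin.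
  rewrite integral_sum//; under eq_bigr do rewrite fl.
  by rewrite sumEFin EFinM.
split.
  have G0 i j : rho.-integrable setT (fun z => ((j \in nn V M z i)%:R * yc z j)%:E).
    apply: integrable_nn.
    apply: (integrable_coord rhoE (s := rshift N1 j) (f := fun u : U => (u.1)%:E)).
    by rewrite unit_law_control.
  rewrite (_ : EFin \o _ = fun z => (N1%:R^-1 * \sum_(i < N1)
    (yt z i - M%:R^-1 * \sum_(j < n) (j \in nn V M z i)%:R * yc z j))%:E); last first.
    by apply/funext => z; rewrite /= sample_estimatorE.
  apply: (iZ); apply: (iS) => i; rewrite /comp; under eq_fun do rewrite EFinB.
  apply: integrableB => //; last by apply: (iZ); apply: (iS) => j; exact: G0.
  apply: (integrable_coord rhoE (s := lshift n i) (f := fun u : U => (u.1)%:E)).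
  by rewrite unit_law_treated.
move=> Mn.
have Mneq : M%:R != 0 :> R by rewrite pnatr_eq0 -lt0n.
have N1neq : N1%:R != 0 :> R by rewrite pnatr_eq0 -lt0n.
have TE z : sample_estimator V M z = (D z - E z) + F z.
  rewrite sample_estimatorE /D /E /F -mulrBr -mulrDr; congr (_ * _).
  rewrite -sumrB -big_split/=; apply: eq_bigr => i _.
  (* Here [M <= n] matters: with fewer controls the weights [M^-1] would not add up to one and
     [m0 (xt z i)] would not cancel. *)
  have S : \sum_(j < n) (j \in nn V M z i)%:R = M%:R :> R.
    rewrite -[in RHS](minn_idPl Mn) -(card_nearest_neighbors V M (xt z i) (xc z)).
    rewrite -sum1_card natr_sum [RHS]big_mkcond; apply: eq_bigr => j _.
    by rewrite /nn; case: ifP.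
  pose s := \sum_(j < n) (j \in nn V M z i)%:R * m0 (xc z j).
  have -> : \sum_(j < n) (j \in nn V M z i)%:R * (yc z j - m0 (xc z j)) =
      \sum_(j < n) (j \in nn V M z i)%:R * yc z j - s.
    by rewrite -sumrB; apply: eq_bigr => j _; rewrite mulrBr.
  have -> : \sum_(j < n) (j \in nn V M z i)%:R * (m0 (xt z i) - m0 (xc z j)) =
      M%:R * m0 (xt z i) - s.
    by rewrite -S mulr_suml -sumrB; apply: eq_bigr => j _; rewrite mulrBr.
  by field.
under eq_integral do rewrite TE.
under eq_integral do rewrite EFinD.
rewrite integralD//; last first.
  by rewrite /comp; under eq_fun do rewrite EFinB; exact: integrableB.
congr (_ + _)%E.
under eq_integral do rewrite EFinB.
rewrite integralB//.
rewrite (ZS _ _ _ (fun=> tau)) => //; last first.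
  move=> i.
  rewrite (integral_coord rhoE (s := lshift n i) (f := fun u : U => (u.1 - m0 u.2)%:E)).
    by rewrite unit_law_treated.
  by rewrite unit_law_treated; under eq_fun do rewrite EFinB; exact: integrableB.
rewrite (ZS _ _ _ (fun=> 0)); last 2 first.
- move=> i; apply: (iZ); apply: (iS) => j; apply: integrable_nn; exact: iYc.
- move=> i; rewrite (ZS _ _ _ (fun=> 0)); first by rewrite big1 ?mulr0.
    by move=> j; apply: integrable_nn; exact: iYc.
  by move=> j; exact: residual0.
by rewrite [X in (_ - (_ * X)%:E)%E]big1// mulr0 sube0 sumr_const card_ord -[tau *+ _]mulr_natl mulrA mulVf ?mul1r.
Qed.

End fixed_n.

Lemma estimator_mean_cvg (eps : R) : 0 < eps -> exists n0 : nat, forall n rho,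
  (n0 <= n)%N -> box_law (@unit_law _ _ mu1 mu0 N1 n) rho ->
  (`| \int[rho]_z (sample_estimator V M z)%:E - tau%:E | <= eps%:E)%E.
Proof.
move=> eps0.
have [delta d0 Hd] := compact_unif_continuous cS0 m0c (divr_gt0 eps0 (ltr0n R 2)).
have [A [A0 HA]] : exists A : R, 0 < A /\ forall x, S0 x -> `|m0 x| <= A.
  have [A [_ HA]] := compact_bounded (continuous_compact m0c cS0).
  exists (`|A| + 1); split; first by rewrite ltr_wpDl.
  by move=> x Sx; apply: (HA (`|A| + 1)); [rewrite (le_lt_trans (ler_norm _))// ltrDl|exists x].
(* Off the bad event uniform continuity bounds the mismatch by [eps / 2]; on it the crude bound
   [2 * A], times the probability [eps / (4 * A)], gives the other [eps / 2]. *)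
have eA : 0 < eps / (4 * A) by rewrite divr_gt0// mulr_gt0.
have [n0 Hn] := neighbors_close mu1 k0 Vpos cS1 S1_supp N1 M0 d0 eA.
exists n0 => n rho n0n rhoE.
have [Mn [B [mB Be HB]]] := Hn n rho n0n rhoE.
have [Ti TE] := integral_sample_estimator rhoE.
rewrite (TE Mn) addeAC subee// add0e.
set F := (X in (\int[rho]_z (X z)%:E)%E).
have F_bound z : (forall i, S1 (xt z i)) -> (forall j, S0 (xc z j)) ->
    `|F z| <= eps / 2 + 2 * A * \1_B z.
  move=> z1 z0.
  have Fi i : `|M%:R^-1 * \sum_(j < n) (j \in nn V M z i)%:R * (m0 (xt z i) - m0 (xc z j))|
      <= eps / 2 + 2 * A * \1_B z.
    rewrite normrM ger0_norm ?invr_ge0// ler_pdivrMl ?ltr0n//.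
    apply: le_trans (ler_norm_sum _ _ _) _.
    have cM : #|nn V M z i| = M by rewrite card_nearest_neighbors (minn_idPl Mn).
    rewrite -[X in _ <= X%:R * _]cM mulr_natl -sumr_const [leRHS]big_mkcond/=; apply: ler_sum => j _.
    rewrite normrM; case: ifPn => [jN|jN]; last by rewrite normr0 mul0r.
    rewrite normr1 mul1r indicE; have [Bz|Bz] := pselect (B z).
      rewrite mem_set// mulr1 mulr_natl mulr2n.
      apply: le_trans (ler_normB _ _) _.
      apply: le_trans (lerD (HA _ (S10 (z1 i))) (HA _ (z0 j))) _.
      by rewrite lerDr ltW// divr_gt0.
    rewrite memNset// mulr0 addr0; apply/ltW/Hd => //; first exact: S10.
    exact: HB.
  rewrite normrM ger0_norm ?invr_ge0// ler_pdivrMl ?ltr0n//.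
  apply: le_trans (ler_norm_sum _ _ _) _.
  apply: le_trans (ler_sum _ (fun i _ => Fi i)) _.
  by rewrite sumr_const card_ord [leRHS]mulr_natl.
have mF : measurable_fun setT F.
  apply: measurable_funM => //; apply: measurable_sum => i; apply: measurable_funM => //.
  apply: measurable_sum => j; apply: measurable_funM; first exact: measurable_nn_indic.
  apply: measurable_funB; apply: (measurableT_comp mm0); exact: measurable_snd_tnth.
have aez : {ae rho, forall z, (forall i, S1 (xt z i)) /\ (forall j, S0 (xc z j))}.
  apply: filterI; apply: ae_forall_fin => s.
    apply: (ae_coord rhoE (s := lshift n s) (A := [set u | S1 u.2])).
    by rewrite unit_law_treated.
  apply: (ae_coord rhoE (s := rshift N1 s) (A := [set u | S0 u.2])).
  by rewrite unit_law_control.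
have e20 : 0 <= eps / 2 by rewrite divr_ge0// ltW.
have A20 : 0 <= 2 * A by rewrite mulr_ge0// ltW.
apply: le_trans (le_abse_integral _ _ _) _ => //; first exact/measurable_EFinP.
apply: (@le_trans _ _ (\int[rho]_z (eps / 2 + 2 * A * \1_B z)%:E)%E).
  apply: ae_ge0_le_integral => //.
  - by apply: measurableT_comp => //; exact/measurable_EFinP.
  - by move=> z _; rewrite lee_fin addr_ge0// mulr_ge0.
  - apply/measurable_EFinP; apply: measurable_funD => //; exact: measurable_funM.
  - by apply: filterS aez => z [z1 z0] _; rewrite lee_fin; exact: F_bound.
have -> : (\int[rho]_z (eps / 2 + 2 * A * \1_B z)%:E =
    \int[rho]_z ((eps / 2)%:E + (2 * A)%:E * (\1_B z)%:E))%E.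
  by apply: eq_integral => z _; rewrite -EFinM -EFinD.
have mI : measurable_fun setT (fun z => (\1_B z)%:E : \bar R).
  by apply/measurable_EFinP; exact: measurable_indic.
have I0 z : setT z -> (0 <= (\1_B z)%:E :> \bar R)%E by rewrite lee_fin.
rewrite ge0_integralD//; last 2 first.
- by move=> z _; rewrite mule_ge0 ?lee_fin.
- exact: measurable_funeM.
rewrite integral_cst// [X in (_ * X)%E]probability_setT mule1.
rewrite (ge0_integralZl _ measurableT mI I0)//.
rewrite integral_indicT//.
apply: (@le_trans _ _ ((eps / 2)%:E + (2 * A)%:E * (eps / (4 * A))%:E)%E).
  by rewrite leeD2l// lee_pmul2l// lte_fin mulr_gt0.
rewrite -EFinM -EFinD lee_fin.
rewrite (_ : _ + _ = eps)//; field; by rewrite gt_eqF.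
Qed.

End asymptotically_unbiased.

(** * Convolutions along the matched controls *)

Section conv_lists.
Context (R : realType) (X : Type) (K : X -> probability R R) (c : R).
Local Open Scope ereal_scope.
Implicit Types (G : R -> \bar R) (x : X) (s : seq X).

Definition nice G := (forall a, 0 <= G a) /\ measurable_fun setT G.

Lemma nice_cvl nu d G : nice G -> nice (cvl nu d G).
Proof.
by move=> [G0 mG]; split; [move=> a; exact: cvl_ge0|exact: measurable_cvl].
Qed.

Definition convs G s := foldl (fun G x => cvl (K x) c G) G s.

Lemma convs_cvl nu d G s : nice G -> convs (cvl nu d G) s = cvl nu d (convs G s).
Proof.
elim: s G => //= x s IH G nG; rewrite -IH; last exact: nice_cvl.
by case: (nG) => G0 mG; rewrite cvl_comm.
Qed.

(** Commuting operators may be applied in any order. The lists are images under [f] because control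
    indices have decidable equality and are what gets permuted. *)
Lemma convs_perm (Y : eqType) (f : Y -> X) G (s t : seq Y) : nice G -> perm_eq s t ->
  convs G (map f s) = convs G (map f t).
Proof.
elim: s t G => [|y s IH] t G nG st.
  by have := perm_size st; case: t st.
have yt : y \in t by rewrite -(perm_mem st) mem_head.
case/splitPr: yt st => t1 t2 st.
have {}st : perm_eq s (t1 ++ t2).
  by rewrite -(perm_cons y) (perm_trans st)// perm_catC/= perm_cons perm_catC.
rewrite /= [LHS](IH (t1 ++ t2))//; last exact: nice_cvl.
rewrite !map_cat /convs !foldl_cat /= -/(convs _ _) -/(convs _ _).
by rewrite [in LHS]/convs -/(convs (cvl _ _ _) _) convs_cvl.
Qed.

(** Links the flat list, convenient for comparison with the matches, to the nested form in which
    treated units are integrated out one at a time. The reversal turns [foldl] into [foldr]. *)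
Lemma convs_flatten_nseq M G (s : seq X) :
  convs G (flatten [seq nseq M x | x <- rev s]) =
  foldr (fun x G => iter M (cvl (K x) c) G) G s.
Proof.
rewrite -[s in RHS]revK -[RHS]foldl_rev revK; elim: (rev s) G => //= x t IH G.
rewrite /convs foldl_cat -/(convs _ _) IH; congr foldl.
by elim: M G {IH} => //= M IH G; rewrite IH -iterSr.
Qed.

(** The bound is one-sided and uniform in the shift [a]: in this form it survives further
    convolutions and composes by transitivity. *)
Definition cvl_near (eta : R) x x' G :=
  forall a, cvl (K x) c G a <= cvl (K x') c G a + eta%:E.

(** Commutation lets the exchanged operator act on [G] first, where the assumption applies;
    averaging over [nu] then preserves the inequality. *)
Lemma cvl_near_cvl eta x x' nu d G : (0 <= eta)%R -> nice G -> cvl_near eta x x' G ->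
  cvl_near eta x x' (cvl nu d G).
Proof.
move=> eta0 nG xx' a; case: (nG) => G0 mG.
rewrite (cvl_comm (K x) nu)// (cvl_comm (K x') nu)//.
have [n1 m1] := nice_cvl (K x') c nG.
have [n2 m2] := nice_cvl (K x) c nG.
rewrite -cvl_add//; apply: le_cvl => //.
exact: emeasurable_funD.
Qed.

Lemma convs_le G G' s : nice G -> nice G' -> (forall a, G a <= G' a) ->
  forall a, convs G s a <= convs G' s a.
Proof.
elim: s G G' => //= x s IH G G' nG nG' GG'; apply: IH; [exact: nice_cvl|exact: nice_cvl|].
by apply: le_cvl => //; [case: nG|case: nG|case: nG'].
Qed.

Lemma convs_add G s (eta : R) : (0 <= eta)%R -> nice G ->
  convs (fun a => G a + eta%:E) s = fun a => convs G s a + eta%:E.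
Proof.
move=> eta0; elim: s G => //= x s IH G nG; rewrite -IH; last exact: nice_cvl.
by congr convs; apply/funext => a; case: nG => G0 mG; rewrite cvl_add.
Qed.

Fixpoint cvls_near (eta : R) G s s' : Prop :=
  match s, s' with
  | x :: s, x' :: s' => cvl_near eta x x' G /\ cvls_near eta G s s'
  | [::], [::] => True
  | _, _ => False
  end.

Lemma cvls_near_cvl eta nu d G s s' : (0 <= eta)%R -> nice G -> cvls_near eta G s s' ->
  cvls_near eta (cvl nu d G) s s'.
Proof.
move=> eta0 nG; elim: s s' => [|x s IH] [|x' s']//= [xx' ss'].
by split; [exact: cvl_near_cvl|exact: IH].
Qed.

Lemma cvls_near_cat eta G s1 s1' s2 s2' : cvls_near eta G s1 s1' -> cvls_near eta G s2 s2' ->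
  cvls_near eta G (s1 ++ s2) (s1' ++ s2').
Proof.
by elim: s1 s1' => [|x s IH] [|x' s']//= [xx' ss'] H2; split => //; exact: IH.
Qed.

(** One entry is replaced at a time. Each replacement costs [eta], and the remaining convolutions,
    being averages, do not enlarge it. *)
Lemma convs_near (eta : R) G s s' : (0 <= eta)%R -> nice G -> cvls_near eta G s s' ->
  forall a, convs G s a <= convs G s' a + ((size s)%:R * eta)%:E.
Proof.
move=> eta0; elim: s s' G => [|x s IH] [|x' s'] G nG //=; first by move=> _ a; rewrite leeDl// lee_fin mulr_ge0.
move=> [xx' ss'] a.
have nx := nice_cvl (K x) c nG; have nx' := nice_cvl (K x') c nG.
have ne : nice (fun a => cvl (K x') c G a + eta%:E).
  split; last by apply: emeasurable_funD => //; case: nx'.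
  by move=> b; rewrite adde_ge0//; case: nx'.
apply: (le_trans (convs_le s nx ne xx' a)).
rewrite convs_add//.
rewrite -[((size s).+1)%:R]natr1 mulrDl mul1r EFinD addeA leeD2r//.
by apply: IH => //; exact: cvls_near_cvl.
Qed.

End conv_lists.

Section foldl_weights.
Context (R : realType) (Y : Type) (K : Y -> probability R R) (c : R).
Local Open Scope ereal_scope.

(** A convolution with weight zero is the identity, so controls that serve nobody drop out of the
    composition. *)
Lemma foldl_cvl_weights (w : Y -> R) (p : pred Y) (G : R -> \bar R) (s : seq Y) :
  (forall a, 0 <= G a) -> (forall y, w y = (p y)%:R) ->
  foldl (fun G y => cvl (K y) (c * w y) G) G s = convs K c G [seq y <- s | p y].
Proof.
move=> G0 wp; elim: s G G0 => //= y s IH G G0; rewrite wp.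
case: ifP => py /=; rewrite ?mulr1 ?mulr0 IH//.
- by move=> a; exact: cvl_ge0.
- congr convs; apply/funext => a; rewrite /cvl.
  under eq_integral do rewrite mul0r addr0.
  by rewrite integral_cst// [X in _ * X]probability_setT mule1.
- by move=> a; exact: cvl_ge0.
Qed.

End foldl_weights.

Section sample_integrals.
Context (R : realType) (k : nat).
Local Notation U := (R * 'rV[R]_k)%type.
Local Open Scope ereal_scope.
Variables (mu1 mu0 : probability U R) (K0 : 'rV[R]_k -> probability R R).
Hypothesis disint0 : disintegration mu0 K0.
Variables (V : 'M[R]_k) (M N1 : nat) (tau : R).

Section fixed_n.
Variables (n : nat) (rho : probability ((N1 + n).-tuple U) R).
Hypothesis rhoE : box_law (@unit_law _ _ mu1 mu0 N1 n) rho.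
Local Notation Z := ((N1 + n).-tuple U).

(* With replacement a control may serve several treated units, so it enters the estimator
   with a multiplicity. *)
Definition times_used (z : Z) (j : 'I_n) : R := (\sum_(i < N1) (j \in nn V M z i)%:R)%R.

Lemma measurable_times_used j : measurable_fun setT (times_used ^~ j).
Proof. by apply: measurable_sum => i; exact: measurable_nn_indic. Qed.

Definition reset (z : Z) (j : 'I_n) (v : R) := upd z (rshift N1 j) (v, xc z j).

Lemma xc_reset z j v j' : xc (reset z j v) j' = xc z j'.
Proof.
by rewrite /xc /reset tnth_upd; case: eqP => //= /(@rshift_inj N1 n) ->.
Qed.

Lemma yc_reset z j v j' : yc (reset z j v) j' = if j' == j then v else yc z j'.
Proof. by rewrite /yc /reset tnth_upd (inj_eq (@rshift_inj N1 n)); case: ifP. Qed.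

Lemma times_used_reset z j v j' : times_used (reset z j v) j' = times_used z j'.
Proof. by apply: eq_bigr => i _; rewrite nn_upd. Qed.

Lemma yt_reset z j v i : yt (reset z j v) i = yt z i.
Proof. by rewrite /yt /reset tnth_upd eq_lrshift. Qed.

Lemma measurable_K0 s : measurable_kernel_fam (fun z : Z => K0 (tnth z s).2).
Proof. exact: (measurable_kernel_comp disint0 (measurable_snd_tnth s)). Qed.

Lemma measurable_control_convs (c : R) (js : seq 'I_n) (F : Z * R -> \bar R) :
  measurable_fun setT F -> (forall p, 0 <= F p) ->
  measurable_fun setT (fun z => foldl
    (fun G j => cvl (K0 (xc z j)) (c * times_used z j) G) (fun a => F (z, a)) js 0%R).
Proof.
elim: js F => [|j js IH] F mF F0 /=.
  by apply: (measurableT_comp mF); exact: pair2_measurable.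
apply: (IH (fun p => cvl (K0 (xc p.1 j)) (c * times_used p.1 j) (fun a => F (p.1, a)) p.2)).
  apply: (@measurable_cvl_family _ _ Z (fun z => K0 (xc z j)) (fun z => c * times_used z j)%R F) => //.
    exact: measurable_K0.
  by apply: measurable_funM => //; exact: measurable_times_used.
by move=> p; exact: cvl_ge0.
Qed.

(** The second argument of [F] stands for the weighted sum of the outcomes still to be integrated.
    Each step redraws one control outcome at its covariate and absorbs the result into a new [F];
    covariates and multiplicities are unchanged by the redraw, so the invariance under [reset]
    persists. *)
Lemma control_integral (c : R) (js : seq 'I_n) (F : Z * R -> \bar R) : uniq js ->
  measurable_fun setT F -> (forall p, 0 <= F p) ->
  (forall z j v a, F (reset z j v, a) = F (z, a)) ->
  \int[rho]_z F (z, c * \sum_(j <- js) times_used z j * yc z j)%R =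
  \int[rho]_z foldl (fun G j => cvl (K0 (xc z j)) (c * times_used z j) G)
    (fun a => F (z, a)) js 0%R.
Proof.
elim: js F => [|j js IH] F /=.
  move=> _ _ _ _; apply: eq_integral => z _.
  by rewrite big_nil mulr0.
move=> /andP[jjs ujs] mF F0 Freset.
pose F' (p : Z * R) := cvl (K0 (xc p.1 j)) (c * times_used p.1 j) (fun a => F (p.1, a)) p.2.
have mF' : measurable_fun setT F'.
  apply: (@measurable_cvl_family _ _ Z (fun z => K0 (xc z j)) (fun z => c * times_used z j)%R F) => //.
    exact: measurable_K0.
  by apply: measurable_funM => //; exact: measurable_times_used.
rewrite -(IH F')//; last 2 first.
- by move=> p; exact: cvl_ge0.
- move=> z j' v a; rewrite /F' /= xc_reset times_used_reset.
  by congr cvl; apply/funext => b; rewrite Freset.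
have mD : disintegration (@unit_law _ _ mu1 mu0 N1 n (rshift N1 j)) K0.
  by rewrite unit_law_control.
rewrite (resample_cond rhoE mD); last 2 first.
- apply: (@measurableT_comp _ _ _ _ _ _ F) => //; apply/measurable_fun_pairP; split; [exact: measurable_id|rewrite /comp/=].
  apply: measurable_funM => //.
  under eq_fun do rewrite big_cons.
  apply: measurable_funD.
    by apply: measurable_funM; [exact: measurable_times_used|exact: measurable_yc].
  apply: measurable_sum => j'.
  by apply: measurable_funM; [exact: measurable_times_used|exact: measurable_yc].
- by move=> z; exact: F0.
apply: eq_integral => z _; apply: eq_integral => v _.
rewrite -/(xc z j) -/(reset z j v) Freset; congr (F (_, _)).
rewrite big_cons yc_reset eqxx times_used_reset addrC mulrDr mulrA; congr (_ + _)%R.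
congr (_ * _)%R; rewrite big_seq [RHS]big_seq; apply: eq_bigr => j' j's.
by rewrite times_used_reset yc_reset; case: eqP j's => // ->; rewrite (negbTE jjs).
Qed.

End fixed_n.

Let mK2 : measurable_kernel_fam (fun u : U => K0 u.2).
Proof. exact: (measurable_kernel_comp disint0 measurable_snd). Qed.

Lemma measurable_iter_cvl d (Z : measurableType d) (K : Z -> probability R R) (c : R) m
    (F : Z * R -> \bar R) : measurable_kernel_fam K ->
  measurable_fun setT F -> (forall p, 0 <= F p) ->
  measurable_fun setT (fun p : Z * R => iter m (cvl (K p.1) c) (fun a => F (p.1, a)) p.2) /\
  (forall p : Z * R, 0 <= iter m (cvl (K p.1) c) (fun a => F (p.1, a)) p.2).
Proof.
move=> mK mF F0; elim: m => [|m [IH1 IH2]].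
  split; last by move=> p; exact: F0.
  by rewrite (_ : (fun p => _) = F)//; apply/funext => -[].
split.
  exact: (@measurable_cvl_family _ _ Z K (fun=> c) _ mK (measurable_cst _) IH2 IH1).
by move=> p; apply: cvl_ge0 => a; exact: (IH2 (p.1, a)).
Qed.

Lemma nice_iter_cvl nu c m (G : R -> \bar R) : nice G -> nice (iter m (cvl nu c) G).
Proof. by move=> nG; elim: m => //= m IH; exact: nice_cvl. Qed.

Let shift_pred (u : U) (v : 'rV[R]_M) := ((u.1 - tau) + - M%:R^-1 * \sum_i v ord0 i)%R.

Let mshift u : measurable_fun setT (shift_pred u).
Proof.
exact: measurableT_comp (measurable_affine _ _) (@measurable_sum_coord R M).
Qed.

(** The conditional law of one kappa given the treated pair [u], in the form where the regression
    functions have cancelled. Averaging it over [mu1] gives [match_law]. *)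
Definition match_kernel (u : U) : probability R R :=
  distribution (rV_powerP (K0 u.2) (n := M)) (mfun_of (mshift u)).

Lemma match_kernelE u B : match_kernel u B = rV_powerP (K0 u.2) [set v | B (shift_pred u v)].
Proof. by []. Qed.

Lemma match_kernel_integral u (G : R -> \bar R) : nice G ->
  \int[match_kernel u]_s G s = iter M (cvl (K0 u.2) (- M%:R^-1)%R) G (u.1 - tau)%R.
Proof.
move=> [G0 mG]; by rewrite -rV_power_cvl// ge0_integral_pushforward.
Qed.

(** Measurability in [u] is read off the iterated convolution, since each layer preserves joint
    measurability in the parameter and the shift. *)
Lemma measurable_match_kernel : measurable_kernel_fam match_kernel.
Proof.
move=> B mB.
have mI : measurable_fun setT (fun p : U * R => (\1_B p.2)%:E : \bar R).
  by apply/measurable_EFinP; exact: measurableT_comp (measurable_indic mB) measurable_snd.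
have I0 (p : U * R) : 0 <= (\1_B p.2)%:E :> \bar R by rewrite lee_fin.
have [m1 _] := measurable_iter_cvl (- M%:R^-1)%R M mK2 mI I0.
have mp : measurable_fun setT (fun u : U => (u, u.1 - tau)%R).
  apply/measurable_fun_pairP; split; [exact: measurable_id|rewrite /comp/=].
  by apply: measurable_funB => //; exact: measurable_fst.
rewrite (_ : (fun u => _) = (fun p : U * R =>
    iter M (cvl (K0 p.1.2) (- M%:R^-1)%R) (fun a => (\1_B a)%:E) p.2) \o
    (fun u : U => (u, u.1 - tau)%R)); first exact: measurableT_comp m1 mp.
apply/funext => u; rewrite /= -match_kernel_integral; last first.
  split; first by move=> a; rewrite lee_fin.
  by apply/measurable_EFinP; exact: measurable_indic.
by rewrite integral_indicT.
Qed.

Definition match_law : probability R R := mixture mu1 measurable_match_kernel.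

(** One convolution by the limit law is a treated unit followed by [M] draws at its own covariate;
    the scale [N1^-1] turns their weight [- M^-1] into [- (N1 * M)^-1], the weight of a match in the
    estimator. *)
Lemma cvl_match_law (G : R -> \bar R) a : nice G ->
  cvl match_law N1%:R^-1 G a =
  \int[mu1]_u iter M (cvl (K0 u.2) (- (N1%:R * M%:R)^-1)%R) G (a + N1%:R^-1 * (u.1 - tau))%R.
Proof.
move=> [G0 mG]; rewrite /cvl ge0_integral_mixture//; last first.
  exact: measurableT_comp mG (measurable_affine _ _).
apply: eq_integral => u _; rewrite ge0_integral_pushforward//; last first.
  exact: measurableT_comp mG (measurable_affine _ _).
rewrite preimage_setT -rV_power_cvl//; apply: eq_integral => v _ /=.
by congr G; rewrite /mfun_of /shift_pred mulrDr addrA mulrA mulrN invfM.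
Qed.

Section fixed_n'.
Variables (n : nat) (rho : probability ((N1 + n).-tuple U) R).
Hypothesis rhoE : box_law (@unit_law _ _ mu1 mu0 N1 n) rho.
Local Notation Z := ((N1 + n).-tuple U).
Let c : R := (- (N1%:R * M%:R)^-1)%R.

(** The idealized sample: each treated unit in [ss] receives [M] fresh control draws at exactly its
    own covariate. *)
Definition matched_convs (z : Z) (G : R -> \bar R) (ss : seq 'I_N1) :=
  foldr (fun x G => iter M (cvl (K0 x) c) G) G [seq xt z i | i <- ss].

Lemma nice_matched_convs z G ss : nice G -> nice (matched_convs z G ss).
Proof. by move=> nG; elim: ss => //= i ss IH; exact: nice_iter_cvl. Qed.

Lemma measurable_matched_convs G ss : nice G ->
  measurable_fun setT (fun p : Z * R => matched_convs p.1 G ss p.2).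
Proof.
move=> nG; elim: ss => [|i ss IH] /=.
  by case: nG => _ mG; exact: measurableT_comp mG measurable_snd.
have H0 (p : Z * R) : 0 <= matched_convs p.1 G ss p.2.
  by have [H _] := nice_matched_convs p.1 ss nG; exact: H.
have [H _] := @measurable_iter_cvl _ Z (fun z => K0 (xt z i)) c M
  (fun p => matched_convs p.1 G ss p.2) (@measurable_K0 n (lshift n i)) IH H0.
exact: H.
Qed.

Lemma matched_convs_cvl z nu d G ss : nice G ->
  matched_convs z (cvl nu d G) ss = cvl nu d (matched_convs z G ss).
Proof.
move=> nG; elim: ss => //= i ss IH; rewrite /matched_convs/= -/(matched_convs _ _ _) IH.
have nI := nice_matched_convs z ss nG.
rewrite -/(matched_convs z G ss).
move: (matched_convs z G ss) nI {IH} => H nH.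
elim: (M) => //= m ->; have [H0 mH] := nice_iter_cvl (K0 (xt z i)) c m nH.
by rewrite cvl_comm.
Qed.

Lemma matched_convs_upd z i u G ss : i \notin ss ->
  matched_convs (upd z (lshift n i) u) G ss = matched_convs z G ss.
Proof.
move=> iis; rewrite /matched_convs; congr foldr; apply/eq_in_map => i' i's.
rewrite /xt tnth_upd (inj_eq (@lshift_inj N1 n)); case: eqP i's => // ->.
by rewrite (negbTE iis).
Qed.

(** Redrawing unit [i] integrates its outcome together with its [M] ideal controls, which is one
    convolution by [match_law]. The factors of the other units do not see unit [i], so induction
    continues. *)
Lemma treated_integral (ss : seq 'I_N1) (G : R -> \bar R) (b : R) : uniq ss -> nice G ->
  \int[rho]_z matched_convs z G ss (b + \sum_(i <- ss) N1%:R^-1 * (yt z i - tau))%R =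
  iter (size ss) (cvl match_law N1%:R^-1) G b.
Proof.
elim: ss G => [|i ss IH] G /=.
  move=> _ nG; under eq_integral do rewrite big_nil addr0.
  by rewrite integral_cst// [X in _ * X]probability_setT mule1.
move=> /andP[iis uis] nG; rewrite -iterS iterSr -IH//; last exact: nice_cvl.
rewrite (resample rhoE (lshift n i)); last 2 first.
- apply: (measurableT_comp (measurable_matched_convs (i :: ss) nG)
    (_ : measurable_fun setT (fun z : Z => (z, _)))).
  apply/measurable_fun_pairP; split; [exact: measurable_id|rewrite /comp/=].
  apply: measurable_funD => //.
  apply: measurable_sum => i'; apply: measurable_funM => //.
  by apply: measurable_funB => //; exact: measurable_yt.
- by move=> z; case: (nice_matched_convs z (i :: ss) nG).
apply: eq_integral => z _; rewrite unit_law_treated matched_convs_cvl//.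
rewrite cvl_match_law; last exact: nice_matched_convs.
apply: eq_integral => u _.
rewrite /matched_convs/= -!/(matched_convs _ _ _) matched_convs_upd//.
rewrite {1}/xt tnth_upd eqxx; congr (iter M _ _ _).
rewrite big_cons {1}/yt tnth_upd eqxx addrCA addrC; congr (_ + _ + _)%R.
rewrite big_seq [RHS]big_seq; apply: eq_bigr => i' i's.
rewrite /yt tnth_upd (inj_eq (@lshift_inj N1 n)); case: eqP i's => // ->.
by rewrite (negbTE iis).
Qed.

End fixed_n'.

End sample_integrals.

(** * Ramps and smoothed distribution functions *)

Section ramp.
Context (R : realType).
Implicit Types (t e s a c : R).

(* A Lipschitz nonincreasing function with 1_(s <= t) <= ramp t e s <= 1_(s <= t + e). *)
Definition ramp t e s := Num.max 0 (Num.min 1 (1 - (s - t) / e)).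

Lemma ramp01 t e s : 0 <= ramp t e s <= 1.
Proof. by rewrite /ramp le_max lexx ge_max ler01 ge_min lexx. Qed.

Variables (t e : R).
Hypothesis e0 : 0 < e.

Lemma ramp1 s : s <= t -> ramp t e s = 1.
Proof.
move=> st; rewrite /ramp min_l ?max_r//.
by rewrite lerBrDr gerDl mulr_le0_ge0 ?subr_le0 ?invr_ge0// ltW.
Qed.

Lemma ramp0 s : t + e <= s -> ramp t e s = 0.
Proof.
move=> st; rewrite /ramp max_l//.
by rewrite ge_min subr_le0 ler_pdivlMr// mul1r lerBrDr addrC st orbT.
Qed.

Lemma ramp_noninc s s' : s <= s' -> ramp t e s' <= ramp t e s.
Proof.
move=> ss'; rewrite /ramp ge_max !le_max lexx /=; apply/orP; right.
rewrite le_min !ge_min lexx/=; apply/orP; right.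
by rewrite lerD2l lerN2 ler_pM2r ?invr_gt0// lerB.
Qed.

Lemma ramp_lip s s' : s <= s' -> ramp t e s <= ramp t e s' + (s' - s) / e.
Proof.
move=> ss'.
have d0 : 0 <= (s' - s) / e by apply: divr_ge0; [rewrite subr_ge0|exact: ltW].
have H : (s - t) / e = (s' - t) / e - (s' - s) / e by field; rewrite gt_eqF.
rewrite /ramp H; set d := (s' - s) / e in d0 *; set q := (s' - t) / e.
rewrite /Order.max /Order.min; case: ifP; case: ifP; case: ifP; case: ifP; lra.
Qed.

Lemma ramp_continuous : continuous (ramp t e).
Proof.
move=> s; apply: (@continuous_max _ _ (fun=> 0) (fun s => Num.min 1 (1 - (s - t) / e))).
  exact: cvg_cst.
apply: (@continuous_min _ _ (fun=> 1) (fun s => 1 - (s - t) / e)); first exact: cvg_cst.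
apply: cvgB; first exact: cvg_cst.
apply: cvgMl; apply: cvgB; [exact: cvg_id|exact: cvg_cst].
Qed.

Lemma measurable_ramp : measurable_fun setT (ramp t e).
Proof. by apply: continuous_measurable_fun; exact: ramp_continuous. Qed.

Local Open Scope ereal_scope.

Definition eramp s : \bar R := (ramp t e s)%:E.

Lemma nice_eramp : nice eramp.
Proof.
split; first by move=> a; rewrite lee_fin; case/andP: (ramp01 t e a).
by apply/measurable_EFinP; exact: measurable_ramp.
Qed.

Variable c : R.

Lemma measurable_eramp_affine a : measurable_fun setT (fun v => eramp (a + c * v)%R).
Proof. exact: measurableT_comp nice_eramp.2 (measurable_affine a c). Qed.

Implicit Type nu : probability R R.

(** A smoothed version of the probability that [c * v <= t - a], hence nonincreasing in the shift
    [a]. *)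
Definition smooth_cdf nu a : R := fine (cvl nu c eramp a).

Lemma smooth_cdfE nu a : cvl nu c eramp a = (smooth_cdf nu a)%:E.
Proof.
rewrite /smooth_cdf fineK// fin_numElt.
have G01 s : 0 <= eramp s <= 1 by rewrite !lee_fin ramp01.
have /andP[H1 H2] := cvl_le1 nu c G01 nice_eramp.2 a.
by rewrite (lt_le_trans (ltNyr 0) H1) (le_lt_trans H2 (ltry 1)).
Qed.

Lemma smooth_cdf01 nu a : (0 <= smooth_cdf nu a <= 1)%R.
Proof.
rewrite -!lee_fin -smooth_cdfE; apply: cvl_le1; last exact: nice_eramp.2.
by move=> s; rewrite !lee_fin ramp01.
Qed.

Lemma smooth_cdf_noninc nu a a' : (a <= a')%R -> (smooth_cdf nu a' <= smooth_cdf nu a)%R.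
Proof.
move=> aa'; rewrite -lee_fin -!smooth_cdfE; apply: ge0_le_integral => //.
- by move=> v _; case: nice_eramp => H _; exact: H.
- exact: measurable_eramp_affine.
- exact: measurable_eramp_affine.
- by move=> v _; rewrite lee_fin ramp_noninc// lerD2r.
Qed.

Lemma smooth_cdf_lip nu a a' : (a <= a')%R ->
  (smooth_cdf nu a <= smooth_cdf nu a' + (a' - a) / e)%R.
Proof.
move=> aa'; rewrite -lee_fin EFinD -!smooth_cdfE.
have d0 : (0 <= (a' - a) / e)%R by apply: divr_ge0; [rewrite subr_ge0|exact: ltW].
have [G0 mG] := nice_eramp.
rewrite -cvl_add//; apply: ge0_le_integral => //.
- exact: measurable_eramp_affine.
- by apply: emeasurable_funD => //; exact: measurable_eramp_affine.
- move=> v _; rewrite -EFinD lee_fin.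
  apply: le_trans (ramp_lip (_ : (a + c * v <= a' + c * v)%R)) _; first by rewrite lerD2r.
  by rewrite opprD addrACA subrr addr0.
Qed.

(** Markov's inequality: [|c * v|] exceeds [D] with probability at most [|c| * B / D]. Otherwise the
    ramp is already 0 from the shift [t + e + D], and still 1 from [t - D]. *)
Lemma smooth_cdf_tight nu (B D : R) : \int[nu]_v (`|v|)%:E <= B%:E -> (0 < D)%R ->
  (smooth_cdf nu (t + e + D) <= `|c| * B / D)%R /\
  (1 <= smooth_cdf nu (t - D) + `|c| * B / D)%R.
Proof.
move=> nuB D0.
have [G0 mG] := nice_eramp.
have cD0 : (0 <= `|c| / D)%R by apply: divr_ge0; [|exact: ltW].
have ma : measurable_fun [set: R] (fun v : R => (`|v|)%:E).
  by apply/measurable_EFinP; exact: normr_measurable.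
have H : \int[nu]_v ((`|c| / D)%:E * (`|v|)%:E) <= (`|c| * B / D)%:E.
  rewrite ge0_integralZl//.
  have -> : (`|c| * B / D = `|c| / D * B)%R by rewrite mulrAC.
  by rewrite [leRHS]EFinM; apply: lee_wpmul2l; rewrite ?lee_fin.
have big (v : R) : (D < `|c * v| -> 1 <= `|c| / D * `|v|)%R.
  by rewrite normrM mulrAC ler_pdivlMr// mul1r => /ltW.
split; rewrite -lee_fin ?EFinD -?smooth_cdfE.
  apply: le_trans H; apply: ge0_le_integral => //.
  - exact: measurable_eramp_affine.
  - exact: measurable_funeM.
  - move=> v _; rewrite -EFinM lee_fin.
    have [cv|cv] := lerP (- D) (c * v).
      rewrite ramp0; last by lra.
      exact: mulr_ge0.
    apply: le_trans (big v _); first by case/andP: (ramp01 t e (t + e + D + c * v)).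
    by rewrite ler0_norm; lra.
apply: (@le_trans _ _ (cvl nu c eramp (t - D)%R + \int[nu]_v ((`|c| / D)%:E * (`|v|)%:E))); last first.
  by rewrite leeD2l.
rewrite /cvl -ge0_integralD//; last 3 first.
- exact: measurable_eramp_affine.
- by move=> v _; rewrite -EFinM lee_fin mulr_ge0.
- exact: measurable_funeM.
apply: (@le_trans _ _ (\int[nu]_v 1)).
  by rewrite integral_cst// [X in _ <= _ * X]probability_setT mule1.
apply: ge0_le_integral => //.
- by apply: emeasurable_funD; [exact: measurable_eramp_affine|exact: measurable_funeM].
- move=> v _; rewrite -EFinM -EFinD lee_fin.
  have [cv|cv] := lerP (c * v) D.
    rewrite ramp1; last by lra.
    by rewrite lerDl mulr_ge0.
  apply: (@le_trans _ _ (`|c| / D * `|v|)%R); last by rewrite lerDr; case/andP: (ramp01 t e (t - D + c * v)).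
  by apply: big; rewrite ger0_norm; lra.
Qed.

Definition grid (D eta : R) (i : nat) : R := (t - D + i%:R * (eta * e))%R.

(* Monotone, Lipschitz and nearly constant far from t: finitely many grid points control
   the uniform distance, so weak continuity of K0 becomes uniform in the shift. *)
Lemma smooth_cdf_grid nu nu' (B D eta : R) (n : nat) :
  \int[nu]_v (`|v|)%:E <= B%:E -> (0 < D)%R -> (0 < eta)%R ->
  (`|c| * B / D <= eta)%R -> (t + e + D <= grid D eta n)%R ->
  (forall i, (i <= n)%N ->
    `|smooth_cdf nu (grid D eta i) - smooth_cdf nu' (grid D eta i)| <= eta)%R ->
  forall a, (`|smooth_cdf nu a - smooth_cdf nu' a| <= 3 * eta)%R.
Proof.
move=> nuB D0 eta0 BD gn near a.
have [T1 T2] := smooth_cdf_tight nuB D0.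
have g0 : grid D eta 0 = (t - D)%R by rewrite /grid mul0r addr0.
have /andP[f0 f1] := smooth_cdf01 nu a; have /andP[f0' f1'] := smooth_cdf01 nu' a.
(* The mesh [eta * e] times the Lipschitz constant [1 / e] is [eta]. *)
have step i : (smooth_cdf nu (grid D eta i) <= smooth_cdf nu (grid D eta i.+1) + eta)%R.
  have gi : (grid D eta i.+1 - grid D eta i = eta * e)%R by rewrite /grid -natr1; ring.
  have ge0 : (0 <= eta * e)%R by rewrite mulr_ge0 ?ltW.
  apply: le_trans (smooth_cdf_lip nu (_ : (grid D eta i <= grid D eta i.+1)%R)) _.
    by rewrite -subr_ge0 gi.
  by rewrite gi mulfK ?gt_eqF.
(* Beyond either end of the grid, the moment bound pins down [nu]; [nu'] has no such bound and
   inherits it from the closeness at the end point. *)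
have [a0|a0] := ltP a (grid D eta 0).
  have := near 0%N (leq0n _); rewrite ler_norml => /andP[n1 n2].
  have := smooth_cdf_noninc nu' (ltW a0); have := smooth_cdf_noninc nu (ltW a0).
  by rewrite ler_norml g0 in n1 n2 *; lra.
have [an|an] := leP (grid D eta n) a.
  have := near n (leqnn _); rewrite ler_norml => /andP[n1 n2].
  have := smooth_cdf_noninc nu' an; have := smooth_cdf_noninc nu an.
  have := smooth_cdf_noninc nu gn.
  by rewrite ler_norml; lra.
(* Inside the grid, [a] lies in cell [i], and monotonicity sandwiches both functions between their
   values at its two ends. *)
pose q := ((a - (t - D)) / (eta * e))%R.
have ee0 : (0 < eta * e)%R by rewrite mulr_gt0.
have q0 : (0 <= q)%R by apply: divr_ge0; [rewrite subr_ge0 -g0|exact: ltW].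
pose i := Num.trunc q.
have /andP[i1 i2] := truncn_itv q0.
have gi1 : (grid D eta i <= a)%R.
  by move: i1; rewrite /q ler_pdivlMr// /grid -/i; lra.
have gi2 : (a < grid D eta i.+1)%R.
  by move: i2; rewrite /q ltr_pdivrMr// /grid -/i; lra.
have lin : (i < n)%N.
  have : (grid D eta i < grid D eta n)%R by exact: le_lt_trans an.
  by rewrite /grid ltrD2l ltr_pM2r// ltr_nat.
have := near _ lin; rewrite ler_norml => /andP[n1 n2].
have := near _ (ltnW lin); rewrite ler_norml => /andP[n3 n4].
have := smooth_cdf_noninc nu' gi1; have := smooth_cdf_noninc nu gi1.
have := smooth_cdf_noninc nu' (ltW gi2); have := smooth_cdf_noninc nu (ltW gi2).
by have := step i; rewrite ler_norml; lra.
Qed.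

End ramp.

(** * Convergence in distribution *)

Section disjoint_matches.
Context (R : realType) (k : nat).
Local Notation U := (R * 'rV[R]_k)%type.
Local Open Scope ereal_scope.
Variables (K0 : 'rV[R]_k -> probability R R) (V : 'M[R]_k) (M N1 n : nat).
Hypothesis Mn : (M <= n)%N.
Variable z : (N1 + n).-tuple U.
Hypothesis disj : forall i i' j, j \in nn V M z i -> j \in nn V M z i' -> i = i'.

Let used j := [exists i, j \in nn V M z i].

Lemma times_used_bool j : times_used V M z j = (used j)%:R :> R.
Proof.
rewrite /times_used /used; case: existsP => [[i ji]|H].
  rewrite (bigD1 i)//= ji big1 ?addr0// => i' i'i.
  rewrite (_ : (j \in nn V M z i') = false)//.
  by apply/negP => ji'; move: i'i; rewrite (disj ji' ji) eqxx.
by rewrite big1// => i _; case: (boolP (_ \in _)) => // ji; case: H; exists i.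
Qed.

Definition matches (s : seq 'I_N1) : seq 'I_n := flatten [seq enum (nn V M z i) | i <- s].

Lemma size_matches s : size (matches s) = (size s * M)%N.
Proof.
elim: s => //= i s IH; rewrite /matches/= size_cat -/(matches s) IH mulSn.
by rewrite -cardE card_nearest_neighbors (minn_idPl Mn).
Qed.

Lemma mem_matches s j : (j \in matches s) = has (fun i => j \in nn V M z i) s.
Proof.
by elim: s => //= i s IH; rewrite /matches/= mem_cat -/(matches s) IH mem_enum.
Qed.

Lemma uniq_matches s : uniq s -> uniq (matches s).
Proof.
elim: s => //= i s IH /andP[iss us]; rewrite /matches/= cat_uniq enum_uniq -/(matches s) IH// andbT.
apply/hasPn => j; rewrite mem_matches mem_enum => /hasP[i' i's ji'].
by apply/negP => ji; move: iss; rewrite (disj ji ji') i's.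
Qed.

(** Stated for any ordering [s] of the treated units because the comparison runs over the reversed
    enumeration. *)
Lemma used_matches s : perm_eq s (enum 'I_N1) ->
  perm_eq [seq j <- enum 'I_n | used j] (matches s).
Proof.
move=> sE; apply: uniq_perm.
- by rewrite filter_uniq// enum_uniq.
- by apply: uniq_matches; rewrite (perm_uniq sE) enum_uniq.
- move=> j; rewrite mem_filter mem_enum andbT mem_matches.
  apply/existsP/hasP => [[i ji]|[i _ ji]]; exists i => //.
  by rewrite (perm_mem sE) mem_enum.
Qed.

Variables (c eta : R) (G : R -> \bar R).
Hypothesis nG : nice G.
Hypothesis eta0 : (0 <= eta)%R.
Hypothesis near : forall i j, j \in nn V M z i ->
  cvl_near K0 c eta (xc z j) (xt z i) G /\ cvl_near K0 c eta (xt z i) (xc z j) G.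

Lemma matches_near s :
  cvls_near K0 c eta G [seq xc z j | j <- matches s] (flatten [seq nseq M (xt z i) | i <- s]) /\
  cvls_near K0 c eta G (flatten [seq nseq M (xt z i) | i <- s]) [seq xc z j | j <- matches s].
Proof.
elim: s => //= i s [IH1 IH2]; rewrite /matches/= map_cat -/(matches s).
have [H1 H2] : cvls_near K0 c eta G [seq xc z j | j <- enum (nn V M z i)] (nseq M (xt z i)) /\
    cvls_near K0 c eta G (nseq M (xt z i)) [seq xc z j | j <- enum (nn V M z i)].
  have tm : size (enum (nn V M z i)) = M by rewrite -cardE card_nearest_neighbors (minn_idPl Mn).
  have : forall j, j \in enum (nn V M z i) -> j \in nn V M z i by move=> j; rewrite mem_enum.
  rewrite -[in nseq M]tm; move: (enum (nn V M z i)) => t; elim: t {tm} => // j t IH H /=.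
  have [N1' N2'] := near (H j (mem_head _ _)).
  have [|H1 H2] := IH; last by split.
  by move=> j' j't; apply: H; rewrite inE j't orbT.
by split; apply: cvls_near_cat.
Qed.

Lemma foldl_shift (b : R) (js : seq 'I_n) (w : 'I_n -> R) (H : R -> \bar R) :
  foldl (fun G j => cvl (K0 (xc z j)) (w j) G) (fun a => H (b + a)%R) js =
  fun a => foldl (fun G j => cvl (K0 (xc z j)) (w j) G) H js (b + a)%R.
Proof.
elim: js H => //= j js IH H; rewrite -IH; congr foldl.
by apply/funext => a; apply: eq_integral => v _; rewrite addrA.
Qed.

Lemma convs_map (Y : Type) (f : Y -> 'rV[R]_k) (H : R -> \bar R) (s : seq Y) :
  convs (fun y => K0 (f y)) c H s = convs K0 c H (map f s).
Proof. by elim: s H => //= y s IH H; rewrite IH. Qed.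

(** Disjointness makes every multiplicity 0 or 1, so integrating out the controls is a convolution
    along the flat list of matches. It is compared entry by entry with [M] copies of each treated
    covariate, hence [N1 * M] exchanges. *)
Lemma matched_close b :
  let H := foldl (fun G j => cvl (K0 (xc z j)) (c * times_used V M z j) G)
    (fun a => G (b + a)%R) (enum 'I_n) 0%R in
  let G' := foldr (fun x G => iter M (cvl (K0 x) c) G) G [seq xt z i | i <- enum 'I_N1] b in
  let err := ((N1 * M)%:R * eta)%:E in
  H <= G' + err /\ G' <= H + err.
Proof.
move=> H G' err.
pose s := rev (enum 'I_N1).
have HE : H = convs K0 c G [seq xc z j | j <- matches s] b.
  rewrite /H foldl_shift addr0.
  rewrite (foldl_cvl_weights (fun j => K0 (xc z j)) c (w := times_used V M z) (p := used)); last 2 first.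
  - by case: nG.
  - exact: times_used_bool.
  rewrite convs_map; congr (_ b); apply: convs_perm => //.
  by apply: used_matches; rewrite perm_rev.
have GE : G' = convs K0 c G (flatten [seq nseq M (xt z i) | i <- s]) b.
  by rewrite /G' -convs_flatten_nseq /s -map_rev -map_comp.
have sz : size s = N1 by rewrite size_rev size_enum_ord.
have [n1 n2] := matches_near s.
rewrite HE GE; split.
  apply: le_trans (convs_near eta0 nG n1 b) _.
  by rewrite size_map size_matches sz.
apply: le_trans (convs_near eta0 nG n2 b) _.
have -> : size (flatten [seq nseq M (xt z i) | i <- s]) = (size s * M)%N.
  by elim: (s) => //= i t IH; rewrite size_cat size_nseq IH mulSn.
by rewrite sz.
Qed.

End disjoint_matches.

Section unit_interval_convs.
Context (R : realType).
Local Open Scope ereal_scope.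

(** The upper bound 1 is what limits the cost of a bad event to its probability. *)
Definition nice01 (G : R -> \bar R) := (forall a, 0 <= G a <= 1) /\ measurable_fun setT G.

Lemma nice01_nice G : nice01 G -> nice G.
Proof. by move=> [H mG]; split => // a; case/andP: (H a). Qed.

Lemma nice01_cvl nu c G : nice01 G -> nice01 (cvl nu c G).
Proof.
move=> nG; have [G0 mG] := nice01_nice nG; split.
  by apply: cvl_le1; case: nG.
exact: measurable_cvl.
Qed.

Lemma nice01_foldl (Y : Type) (K : Y -> probability R R) (w : Y -> R) G s : nice01 G ->
  nice01 (foldl (fun G y => cvl (K y) (w y) G) G s).
Proof. by elim: s G => //= y s IH G nG; apply: IH; exact: nice01_cvl. Qed.

Lemma nice01_foldr_iter (Y : Type) (K : Y -> probability R R) (c : R) m G s : nice01 G ->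
  nice01 (foldr (fun y G => iter m (cvl (K y) c) G) G s).
Proof.
move=> nG; elim: s => //= y s IH.
move: (foldr _ G s) IH => H nH; elim: (m) => //= m' IH; exact: nice01_cvl.
Qed.

End unit_interval_convs.

Section ramp_cvg.
Context (R : realType) (k : nat).
Local Notation U := (R * 'rV[R]_k)%type.
Variables (mu1 mu0 : probability U R) (K0 : 'rV[R]_k -> probability R R).
Variables (S1 S0 : set 'rV[R]_k) (V : 'M[R]_k) (N1 M : nat) (tau : R).
Hypothesis k0 : (0 < k)%N.
Hypothesis N10 : (0 < N1)%N.
Hypothesis M0 : (0 < M)%N.
Hypothesis Vpos : positive_definite V.
Hypothesis cS1 : compact S1.
Hypothesis cS0 : compact S0.
Hypothesis S10 : S1 `<=` S0.
Hypothesis S1_supp : forall (x : 'rV[R]_k) (e : R), S1 x -> 0 < e ->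
  (0 < mu0 [set u | (`|x - u.2| < e)%R])%E.
Hypothesis mu1S1 : {ae mu1, forall u, S1 u.2}.
Hypothesis mu0S0 : {ae mu0, forall u, S0 u.2}.
Hypothesis disint0 : disintegration mu0 K0.
Variable C : R.
Hypothesis C0 : 0 < C.
Hypothesis small_balls : forall (x : 'rV[R]_k) (r : R), 0 < r -> r <= 2^-1 ->
  (mu1 [set u | (`|x - u.2| < r)%R] <= (C * r)%:E)%E.
Hypothesis first_moment : (\int[mu1]_u \int[K0 u.2]_v (`|v|)%:E < +oo)%E.
Hypothesis K0_cont : forall h : R -> R, continuous h -> bounded_fun h ->
  exists h' : 'rV[R]_k -> R, [/\ {within S0, continuous h'},
    {ae mu0, forall u, (\int[K0 u.2]_v (h v)%:E = (h' u.2)%:E)%E} &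
    {ae mu1, forall u, (\int[K0 u.2]_v (h v)%:E = (h' u.2)%:E)%E}].

Let c : R := - (N1%:R * M%:R)^-1.

(** Markov's inequality for the conditional first moment, which is integrable but possibly unbounded
    in the covariate: a common tightness constant [B] holds off a small event. *)
Lemma first_moment_tail (e : R) : 0 < e -> exists B : R, 0 < B /\
  measurable [set u : U | (B%:E < \int[K0 u.2]_v (`|v|)%:E)%E] /\
  (mu1 [set u | (B%:E < \int[K0 u.2]_v (`|v|)%:E)%E] <= e%:E)%E.
Proof.
move=> e0.
have mK2 : measurable_kernel_fam (fun u : U => K0 u.2).
  exact: (measurable_kernel_comp disint0 measurable_snd).
have mk : measurable_fun setT (fun u : U => \int[K0 u.2]_v (`|v|)%:E)%E.
  apply: (measurable_kernel_integral mK2 (f := fun p : U * R => (`|p.2|)%:E)).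
    by move=> p; rewrite lee_fin.
  apply/measurable_EFinP.
  exact: (measurableT_comp (@normr_measurable R setT) measurable_snd).
pose I := (\int[mu1]_u \int[K0 u.2]_v (`|v|)%:E)%E.
have I0 : (0 <= I)%E by apply: integral_ge0 => u _; apply: integral_ge0.
have If : I = (fine I)%:E by rewrite fineK// ge0_fin_numE.
(* The [+ 1] keeps [B] positive when the moment is zero. *)
pose B := (fine I + 1) / e.
have B0 : 0 < B by rewrite divr_gt0// ltr_wpDl// fine_ge0.
exists B; split => //.
have mA : measurable [set u : U | (B%:E < \int[K0 u.2]_v (`|v|)%:E)%E].
  rewrite -[X in measurable X]setTI.
  have -> : [set u : U | (B%:E < \int[K0 u.2]_v (`|v|)%:E)%E] =
      (fun u : U => \int[K0 u.2]_v (`|v|)%:E)%E @^-1` `]B%:E, +oo[%classic.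
    by apply/seteqP; split => u /=; rewrite in_itv/= andbT.
  by apply: mk => //; exact: emeasurable_itv.
split => //; set A := [set u | _] in mA *.
have BA : (B%:E * mu1 A <= I)%E.
  have mI : measurable_fun setT (fun u : U => (\1_A u)%:E : \bar R).
    by apply/measurable_EFinP; exact: measurable_indic.
  have I1 (u : U) : setT u -> (0 <= (\1_A u)%:E :> \bar R)%E by rewrite lee_fin.
  have B1 : (0 <= B%:E)%E by rewrite lee_fin ltW.
  rewrite -(integral_indicT mu1 mA) -(ge0_integralZl _ measurableT mI I1 B1).
  apply: ge0_le_integral => //.
  - by move=> u _; rewrite mule_ge0 ?lee_fin// ltW.
  - by apply: measurable_funeM; apply/measurable_EFinP; exact: measurable_indic.
  - move=> u _; rewrite indicE; have [Au|Au] := pselect (A u).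
      by rewrite mem_set// mule1 ltW.
    by rewrite memNset// mule0 integral_ge0.
have mAf : mu1 A = (fine (mu1 A))%:E by rewrite fineK// fin_num_measure.
move: BA; rewrite mAf If -EFinM !lee_fin => BA.
rewrite -(ler_pM2l B0); apply: (le_trans BA).
by rewrite /B divfK ?gt_eqF// lerDl.
Qed.

(** [K0] is only a version: its integrals coincide with continuous functions off null sets that
    depend on the test function. Since the grid is finite, one set [W] of full measure in both arms
    serves all its points. *)
Lemma uniform_grid (t e : R) (e0 : 0 < e) (D eta : R) (m : nat) : 0 < eta ->
  exists2 delta : R, 0 < delta & exists W : set 'rV[R]_k,
    [/\ {ae mu0, forall u, W u.2}, {ae mu1, forall u, W u.2} &
     forall x y, W x -> W y -> S0 x -> S0 y -> `|x - y| < delta ->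
     forall i, (i <= m)%N ->
     `|smooth_cdf t e c (K0 x) (grid t e D eta i) -
       smooth_cdf t e c (K0 y) (grid t e D eta i)| <= eta].
Proof.
move=> eta0.
have H (i : nat) : exists2 delta : R, 0 < delta & exists W : set 'rV[R]_k,
    [/\ {ae mu0, forall u, W u.2}, {ae mu1, forall u, W u.2} &
     forall x y, W x -> W y -> S0 x -> S0 y -> `|x - y| < delta ->
     `|smooth_cdf t e c (K0 x) (grid t e D eta i) -
       smooth_cdf t e c (K0 y) (grid t e D eta i)| <= eta].
  pose a := grid t e D eta i.
  have hc : continuous (fun v => ramp t e (a + c * v)).
    move=> v; apply: (@continuous_comp _ _ _ (fun v => a + c * v) (ramp t e)); last exact: ramp_continuous.
    by apply: cvgD; [exact: cvg_cst|apply: cvgMr; exact: cvg_id].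
  have hb : bounded_fun (fun v => ramp t e (a + c * v)).
    exists 1; split => // r r1 v _; apply: le_trans (ltW r1).
    by have /andP[r0 r2] := ramp01 t e (a + c * v); rewrite ger0_norm.
  have [h' [h'c h'0 h'1]] := K0_cont hc hb.
  have [delta d0 Hd] := compact_unif_continuous cS0 h'c eta0.
  exists delta => //.
  exists [set x | (\int[K0 x]_v (ramp t e (a + c * v))%:E = (h' x)%:E)%E]; split => //.
  move=> x y /= Wx Wy Sx Sy xy.
  by rewrite /smooth_cdf /cvl /eramp Wx Wy /=; apply/ltW/Hd.
elim: m => [|m [d1 d10 [W1 [W10 W11 HW1]]]].
  have [d d0 [W [W0 W1 HW]]] := H 0%N; exists d => //; exists W; split => //.
  by move=> x y Wx Wy Sx Sy xy i; rewrite leqn0 => /eqP ->; exact: HW.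
have [d2 d20 [W2 [W20 W21 HW2]]] := H m.+1.
exists (Num.min d1 d2); first by rewrite lt_min d10.
exists (W1 `&` W2); split.
- by apply: filterS2 W10 W20.
- by apply: filterS2 W11 W21.
- move=> x y [Wx1 Wx2] [Wy1 Wy2] Sx Sy; rewrite lt_min => /andP[xy1 xy2] i.
  by rewrite leq_eqVlt => /orP[/eqP ->|]; [exact: HW2|exact: HW1].
Qed.

Let Law : probability R R := match_law mu1 disint0 M tau.

Lemma ramp_cvg (t e eps : R) : 0 < e -> 0 < eps -> exists n0 : nat, forall n rho,
  (n0 <= n)%N -> box_law (@unit_law _ _ mu1 mu0 N1 n) rho ->
  (\int[rho]_z (ramp t e (sample_estimator V M z))%:E <=
    iter N1 (cvl Law N1%:R^-1) (eramp t e) tau + eps%:E)%E /\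
  (iter N1 (cvl Law N1%:R^-1) (eramp t e) tau <=
    \int[rho]_z (ramp t e (sample_estimator V M z))%:E + eps%:E)%E.
Proof.
move=> e0 eps0.
have N1p : 0 < N1%:R :> R by rewrite ltr0n.
have Mp : 0 < M%:R :> R by rewrite ltr0n.
(* There will be [N1 * M] exchanges, each costing [3 * eta]; together they cost [eps / 2]. *)
pose eta : R := eps / (6 * (N1 * M)%:R).
have eta0 : 0 < eta by rewrite divr_gt0// mulr_gt0// ltr0n muln_gt0 N10.
(* The bad event is a union of one event for distant matches, at most [N1 * N1] for close treated
   pairs and [N1] for large conditional moments. Each gets [e1], in total [eps / 2]. *)
pose e1 : R := eps / (2 * (1 + N1%:R * N1%:R + N1%:R)).
have e1d : 0 < 1 + N1%:R * N1%:R + N1%:R :> R.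
  by rewrite !addr_gt0 ?mulr_gt0.
have e10 : 0 < e1 by rewrite divr_gt0// mulr_gt0.
have [B [B0 [mT HT]]] := first_moment_tail e10.
have c0 : 0 < `|c| by rewrite normr_gt0 oppr_eq0 invr_neq0// mulf_neq0 ?gt_eqF.
(* Chosen so that the Markov tail [|c| * B / D] equals [eta]. *)
pose D := `|c| * B / eta.
have D0 : 0 < D by rewrite divr_gt0// mulr_gt0.
have DE : `|c| * B / D = eta by rewrite /D invf_div mulrC divfK// gt_eqF// mulr_gt0.
have DE' : `|c| * B / D <= eta by rewrite DE.
have ee0 : 0 < eta * e by rewrite mulr_gt0.
(* The number of mesh steps that carry the grid from [t - D] past [t + e + D]. *)
pose m := (Num.trunc ((e + 2 * D) / (eta * e))).+1.
have gm : t + e + D <= grid t e D eta m.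
  have : (e + 2 * D) / (eta * e) < m%:R by exact: truncnS_gt.
  by rewrite ltr_pdivrMr// /grid => H; lra.
have [d1 d10 [W [W0 W1 HW]]] := uniform_grid t e0 D m eta0.
(* Below [d1] the grid comparison applies; [1 / 4] makes the radius [2 * delta] admissible in
   [small_balls]; the last bound gives balls of that radius mass at most [e1]. *)
pose delta := Num.min d1 (Num.min 4^-1 (e1 / (2 * C))).
have delta0 : 0 < delta by rewrite !lt_min d10 invr_gt0 ltr0n divr_gt0// mulr_gt0.
have delta1 : delta <= d1 by rewrite ge_min lexx.
have delta2 : 2 * delta <= 2^-1.
  have : delta <= 4^-1 by rewrite !ge_min lexx orbT.
  lra.
have delta3 : C * (2 * delta) <= e1.
  have : delta <= e1 / (2 * C) by rewrite !ge_min lexx !orbT.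
  by rewrite ler_pdivlMr ?mulr_gt0//; lra.
have [n0 Hn] := neighbors_close mu1 k0 Vpos cS1 S1_supp N1 M0 delta0 e10.
exists n0 => n rho n0n rhoE.
have [Mn [Bn [mBn HBn HB]]] := Hn n rho n0n rhoE.
pose Z := ((N1 + n).-tuple U)%type.
pose T i := [set z : Z | (B%:E < \int[K0 (xt z i)]_v (`|v|)%:E)%E].
have T_le i : measurable (T i) /\ (rho (T i) <= e1%:E)%E.
  split.
    rewrite -[X in measurable X]setTI.
    exact: (@measurable_tnth _ _ _ (lshift n i) measurableT _ mT).
  by rewrite (box_law_coord rhoE (lshift n i) mT) unit_law_treated.
pose F i i' := if i == i' then set0 else [set z : Z | (`|xt z i - xt z i'| < 2 * delta)%R].
have F_le i i' : measurable (F i i') /\ (rho (F i i') <= e1%:E)%E.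
  rewrite /F; case: eqP => [_|/eqP ii'].
    by rewrite measure0; split => //; rewrite lee_fin ltW.
  apply: (pairs_far rhoE ii' (C := e1)) => x.
  apply: le_trans (small_balls x _ delta2) _; first by rewrite mulr_gt0.
  by rewrite lee_fin.
pose bad := Bn `|` (\big[setU/set0]_(p : 'I_N1 * 'I_N1) F p.1 p.2 `|`
  \big[setU/set0]_(i < N1) T i).
have mF : measurable (\big[setU/set0]_(p : 'I_N1 * 'I_N1) F p.1 p.2).
  by apply: bigsetU_measurable => p _; case: (F_le p.1 p.2).
have mTT : measurable (\big[setU/set0]_(i < N1) T i).
  by apply: bigsetU_measurable => p _; case: (T_le p).
have mbad : measurable bad by do 2 apply: measurableU => //.
have bad_le : (rho bad <= (eps / 2)%:E)%E.
  apply: (@le_trans _ _ (e1%:E + ((N1%:R * N1%:R * e1)%:E + (N1%:R * e1)%:E))%E); last first.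
    rewrite -!EFinD lee_fin (_ : _ + _ = eps / 2)// /e1; field.
    by rewrite gt_eqF// gt_eqF.
  apply: le_trans (measureU2 _ _ _) _ => //; first exact: measurableU.
  apply: leeD => //; apply: le_trans (measureU2 _ _ _) _ => //; apply: leeD.
    apply: le_trans (le_measure_bigsetU _ _ _) _; first by move=> p; case: (F_le p.1 p.2).
    apply: (@le_trans _ _ (\sum_(p : 'I_N1 * 'I_N1) e1%:E)%E).
      by apply: lee_sum => p _; case: (F_le p.1 p.2).
    by rewrite sumEFin sumr_const card_prod card_ord lee_fin -natrM mulr_natl.
  apply: le_trans (le_measure_bigsetU _ _ _) _; first by move=> i; case: (T_le i).
  apply: (@le_trans _ _ (\sum_(i < N1) e1%:E)%E).
    by apply: lee_sum => i _; case: (T_le i).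
  by rewrite sumEFin sumr_const card_ord lee_fin mulr_natl.
have nG := nice_eramp t e.
(* This is the mean treated outcome, with [tau] subtracted in each term and added once to match the
   centring of [match_kernel]. *)
pose alpha (z : Z) := tau + \sum_(i <- enum 'I_N1) N1%:R^-1 * (yt z i - tau).
(* [H] integrates out the control outcomes given all covariates; [G'] uses instead [M] draws at the
   covariate of each treated unit. The integral of [H] is that of the ramp of the estimator, the
   integral of [G'] is exactly the limit value, and only their difference needs estimating. *)
pose H (z : Z) := foldl (fun G j => cvl (K0 (xc z j)) (c * times_used V M z j) G)
  (fun a => eramp t e (alpha z + a)) (enum 'I_n) 0.
pose G' (z : Z) := matched_convs K0 M z (eramp t e) (enum 'I_N1) (alpha z).
have malpha : measurable_fun setT alpha.
  apply: measurable_funD => //; apply: measurable_sum => i; apply: measurable_funM => //.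
  by apply: measurable_funB => //; exact: measurable_yt.
have IH : (\int[rho]_z (ramp t e (sample_estimator V M z))%:E = \int[rho]_z H z)%E.
  pose F0 (p : Z * R) := eramp t e (alpha p.1 + p.2).
  have mF0 : measurable_fun setT F0.
    apply: (measurableT_comp nG.2); apply: measurable_funD; last exact: measurable_snd.
    exact: (measurableT_comp malpha measurable_fst).
  have := control_integral disint0 V M rhoE c (enum_uniq 'I_n) mF0.
  rewrite /F0/= => <-.
  - apply: eq_integral => z _; rewrite /eramp; congr ((ramp t e _)%:E).
    rewrite sample_estimatorE /alpha !big_enum/=.
    have -> : \sum_(j < n) times_used V M z j * yc z j =
        \sum_(i < N1) \sum_(j < n) (j \in nn V M z i)%:R * yc z j.
      by rewrite exchange_big/=; apply: eq_bigr => j _; rewrite /times_used mulr_suml.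
    rewrite sumrB -!mulr_sumr sumrB sumr_const card_ord -mulr_natl /c.
    by field; rewrite !gt_eqF.
  - by move=> p; case: nG => G0 _; exact: G0.
  - move=> z j v a; congr (eramp t e (_ + _)); congr (_ + _).
    by apply: eq_bigr => i _; rewrite yt_reset.
have IG : (\int[rho]_z G' z = iter N1 (cvl Law N1%:R^-1) (eramp t e) tau)%E.
  have := treated_integral disint0 M tau rhoE tau (enum_uniq 'I_N1) nG.
  by rewrite size_enum_ord.
have n01 : nice01 (eramp t e).
  by split; [move=> a; rewrite !lee_fin; exact: ramp01|exact: nG.2].
have mH : measurable_fun setT H.
  apply: (measurable_control_convs disint0 V M c (enum 'I_n)
    (F := fun p : Z * R => eramp t e (alpha p.1 + p.2))); last first.
    by move=> p; case: nG => G0 _; exact: G0.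
  apply: (measurableT_comp nG.2); apply: measurable_funD; last exact: measurable_snd.
  exact: (measurableT_comp malpha measurable_fst).
have mG : measurable_fun setT G'.
  apply: (measurableT_comp (measurable_matched_convs disint0 M (enum 'I_N1) nG)
    (_ : measurable_fun setT (fun z : Z => (z, alpha z)))).
  by apply/measurable_fun_pairP; split; [exact: measurable_id|exact: malpha].
have H01 z : (0 <= H z <= 1)%E.
  have [|+ _] := @nice01_foldl R _ (fun j => K0 (xc z j)) (fun j => c * times_used V M z j)
    (fun a => eramp t e (alpha z + a)) (enum 'I_n).
    split; first by move=> a; exact: n01.1.
    by apply: (measurableT_comp n01.2); exact: measurable_funD.
  exact.
have G01 z : (0 <= G' z <= 1)%E.
  by have [+ _] := nice01_foldr_iter K0 c M [seq xt z i | i <- enum 'I_N1] n01; apply.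
have aez : {ae rho, forall z, [/\ forall i, S1 (xt z i) /\ W (xt z i) &
    forall j, S0 (xc z j) /\ W (xc z j)]}.
  have a1 : {ae rho, forall z, forall i, S1 (xt z i) /\ W (xt z i)}.
    apply: ae_forall_fin => i.
    apply: (ae_coord rhoE (s := lshift n i) (A := [set u | S1 u.2 /\ W u.2])).
    by rewrite unit_law_treated; apply: filterS2 mu1S1 W1.
  have a2 : {ae rho, forall z, forall j, S0 (xc z j) /\ W (xc z j)}.
    apply: ae_forall_fin => j.
    apply: (ae_coord rhoE (s := rshift N1 j) (A := [set u | S0 u.2 /\ W u.2])).
    by rewrite unit_law_control; apply: filterS2 mu0S0 W0.
  by apply: filterS2 a1 a2.
have close_good z : (forall i, S1 (xt z i) /\ W (xt z i)) ->
    (forall j, S0 (xc z j) /\ W (xc z j)) -> ~ bad z ->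
    (H z <= G' z + (eps / 2)%:E)%E /\ (G' z <= H z + (eps / 2)%:E)%E.
  move=> z1 z0 zbad.
  have zBn : ~ Bn z by move=> zB; apply: zbad; left.
  have nzd i j : j \in nn V M z i -> `|xt z i - xc z j| < delta.
    by apply: HB => //; case: (z1 i).
  (* A shared match would put two treated covariates within [2 * delta] of each other. *)
  have disj i i' j : j \in nn V M z i -> j \in nn V M z i' -> i = i'.
    move=> ji ji'; apply/eqP/negP => ii'.
    have : ~ F i i' z.
      move=> zF; apply: zbad; right; left; rewrite -bigcup_seq; exists (i, i') => //=.
      by rewrite mem_index_enum.
    rewrite /F (negbTE (_ : i != i'))//=; last exact/negP.
    apply; rewrite -(subrKA (xc z j)) mulr_natl mulr2n.
    apply: le_lt_trans (ler_normD _ _) _; apply: ltrD; first exact: nzd.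
    by rewrite distrC; exact: nzd.
  have near i j : j \in nn V M z i ->
      cvl_near K0 c (3 * eta) (xc z j) (xt z i) (eramp t e) /\
      cvl_near K0 c (3 * eta) (xt z i) (xc z j) (eramp t e).
    move=> ji.
    have nt : (\int[K0 (xt z i)]_v (`|v|)%:E <= B%:E)%E.
      rewrite leNgt; apply/negP => zT; apply: zbad; right; right.
      by rewrite -bigcup_seq; exists i => //=; rewrite mem_index_enum.
    have [z11 z12] := z1 i; have [z01 z02] := z0 j.
    have Hg a := smooth_cdf_grid e0 nt D0 eta0 DE' gm
      (HW _ _ z12 z02 (S10 z11) z01 (lt_le_trans (nzd _ _ ji) delta1)) a.
    split => a; rewrite !smooth_cdfE// -EFinD lee_fin; have := Hg a;
      rewrite ler_norml => /andP[]; lra.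
  have nG3 : (0 <= 3 * eta)%R by rewrite mulr_ge0// ltW.
  have [h1 h2] := matched_close Mn disj nG nG3 near (alpha z).
  have E : (N1 * M)%:R * (3 * eta) = eps / 2.
    by rewrite /eta natrM; field; rewrite !gt_eqF.
  by rewrite E in h1 h2; split.
(* On [bad] the bound [f <= 1] costs at most [rho bad <= eps / 2]; elsewhere the pointwise error is
   [eps / 2]. *)
have fin (f g : Z -> \bar R) : (forall z, 0 <= f z <= 1)%E -> (forall z, 0 <= g z <= 1)%E ->
    measurable_fun setT f -> measurable_fun setT g ->
    {ae rho, forall z, ~ bad z -> (f z <= g z + (eps / 2)%:E)%E} ->
    (\int[rho]_z f z <= \int[rho]_z g z + eps%:E)%E.
  move=> f01 g01 mf mg fg.
  have f0 z : (0 <= f z)%E by case/andP: (f01 z).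
  have g0 z : (0 <= g z)%E by case/andP: (g01 z).
  have mI : measurable_fun setT (fun z => (\1_bad z)%:E : \bar R).
    by apply/measurable_EFinP; exact: measurable_indic.
  have e20 : (0 <= (eps / 2)%:E)%E by rewrite lee_fin divr_ge0// ltW.
  apply: (@le_trans _ _ (\int[rho]_z (g z + ((eps / 2)%:E + (\1_bad z)%:E)))%E).
    apply: ae_ge0_le_integral => //.
    - by move=> z _; rewrite !adde_ge0// lee_fin.
    - by apply: emeasurable_funD => //; exact: emeasurable_funD.
    - apply: filterS fg => z fgz _; rewrite indicE; have [zb|zb] := pselect (bad z).
        rewrite mem_set// addeA addeC; apply: (@le_trans _ _ 1%E); first by case/andP: (f01 z).
        by rewrite leeDl// adde_ge0.
      by rewrite memNset// adde0; exact: fgz.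
  rewrite ge0_integralD//; last 2 first.
  - by move=> z _; rewrite adde_ge0// lee_fin.
  - exact: emeasurable_funD.
  rewrite leeD2l// ge0_integralD//.
  rewrite integral_cst// [X in (_ * X)%E]probability_setT mule1 integral_indicT//.
  apply: le_trans (leeD2l _ bad_le) _.
  by rewrite -EFinD -splitr.
rewrite IH -IG; split; apply: fin => //; apply: filterS aez => z [z1 z0] zb;
  by case: (close_good z z1 z0 zb).
Qed.

End ramp_cvg.

Lemma patch_preimage V W (R : realType) (phi : V -> W) (C : set W) (f : V -> \bar R) v :
  (f \_ (phi @^-1` C)) v = (f v * (\1_C (phi v))%:E)%E.
Proof.
rewrite patchE indicE (_ : (v \in phi @^-1` C) = (phi v \in C)).
  by case: ifPn; rewrite ?mule1 ?mule0.
by apply/idP/idP; rewrite !inE.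
Qed.

(** * From the model to the laws of the pooled sample *)

Section density.
Context d (T : measurableType d) (R : realType).
Local Open Scope ereal_scope.
Variables (mu : {sigma_finite_measure set T -> \bar R}) (nu : probability T R) (q : T -> \bar R).
Hypothesis iq : mu.-integrable setT q.
Hypothesis nuE : forall A, measurable A -> nu A = \int[mu]_(x in A) q x.

(** By uniqueness [q] is almost everywhere the Radon-Nikodym derivative, whose change of variables
    formula applies. *)
Lemma ge0_integral_density f : measurable_fun setT f -> (forall x, 0 <= f x) ->
  \int[nu]_x f x = \int[mu]_x (f x * q x).
Proof.
move=> mf f0.
have dom : nu `<< mu.
  apply/null_content_dominatesP => A mA A0; rewrite nuE//.
  by apply: null_set_integral => //; exact/measurable_funTS/(measurable_int _ iq).
pose g := Radon_Nikodym_SigmaFinite.f nu mu.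
have gi : mu.-integrable setT g by exact: Radon_Nikodym_SigmaFinite.f_integrable.
have gE : ae_eq mu setT g q.
  apply: integral_ae_eq => //; first exact: measurable_int iq.
  by move=> A _ mA; rewrite -Radon_Nikodym_SigmaFinite.f_integral//; exact: nuE.
rewrite -(Radon_Nikodym_SigmaFinite.change_of_variables dom f0 measurableT mf).
apply: ae_eq_integral => //.
- by apply: emeasurable_funM => //; exact: measurable_int gi.
- by apply: emeasurable_funM => //; exact: measurable_int iq.
- by apply: filterS gE => x /(_ I) gq _; rewrite /= -gq.
Qed.

End density.

Section conditional_law.
Context d (T : measurableType d) (R : realType) (P : probability T R).
Context d' (U : measurableType d') (X : {mfun T >-> U}) (Z : {mfun T >-> R}).
Variable K : U -> probability R R.
Hypothesis PK : regular_cond_law P X Z K.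
Local Open Scope ereal_scope.

Lemma measurable_joint : measurable_fun setT (fun w => (Z w, X w)).
Proof. by apply/measurable_fun_pairP; split. Qed.

Definition joint_law : probability (R * U)%type R := distribution P (mfun_of measurable_joint).

Lemma ge0_integral_joint_law (f : R * U -> \bar R) : measurable_fun setT f ->
  (forall u, 0 <= f u) -> \int[joint_law]_u f u = \int[P]_w f (Z w, X w).
Proof. by move=> mf f0; rewrite ge0_integral_pushforward. Qed.

Lemma joint_law_disintegration : disintegration joint_law K.
Proof.
split; first exact: PK.1.
move=> A C mA mC; rewrite ge0_integral_joint_law; last 2 first.
- apply: emeasurable_funM.
    exact: measurableT_comp (PK.1 _ mA) measurable_snd.
  apply/measurable_EFinP.
  exact: measurableT_comp (measurable_indic mC) measurable_snd.
- by move=> u; rewrite mule_ge0// lee_fin.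
have := PK.2 _ _ mC mA; rewrite (_ : joint_law _ = P (X @^-1` C `&` Z @^-1` A)).
  move=> ->; rewrite integral_mkcond; apply: eq_integral => w _ /=.
  exact: patch_preimage.
by congr (P _); apply/seteqP; split=> w [].
Qed.

Lemma measurable_kernel_integral_point (h : R -> \bar R) : measurable_fun setT h ->
  (forall v, 0 <= h v) -> measurable_fun setT (fun x => \int[K x]_v h v).
Proof.
move=> mh h0; apply: (@measurable_kernel_integral _ _ _ _ _ K PK.1 (fun p : U * R => h p.2)) => //.
exact: measurableT_comp mh measurable_snd.
Qed.

Lemma ge0_integral_conditional_law (h : R -> \bar R) A : measurable A ->
  measurable_fun setT h -> (forall v, 0 <= h v) ->
  \int[P]_(w in X @^-1` A) h (Z w) = \int[distribution P X]_(x in A) \int[K x]_v h v.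
Proof.
move=> mA mh h0.
pose f (u : R * U) := h u.1 * (\1_A u.2)%:E.
have mI : measurable_fun setT (fun x => (\1_A x)%:E : \bar R).
  exact/measurable_EFinP/measurable_indic.
have mf : measurable_fun setT f.
  apply: emeasurable_funM; first exact: measurableT_comp mh measurable_fst.
  exact: measurableT_comp mI measurable_snd.
have f0 u : 0 <= f u by rewrite mule_ge0// lee_fin.
have mk := measurable_kernel_integral_point mh h0.
have g0 x : 0 <= \int[K x]_v h v by exact: integral_ge0.
have := disintegration_integral joint_law_disintegration mf f0.
rewrite [RHS]ge0_integral_joint_law// => H.
transitivity (\int[P]_w f (Z w, X w)).
  rewrite integral_mkcond; apply: eq_integral => w _.
  exact: patch_preimage.
rewrite -H; transitivity (\int[joint_law]_u ((\int[K u.2]_v h v) * (\1_A u.2)%:E)).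
  apply: eq_integral => u _; rewrite /f /=.
  rewrite ge0_integralZr//.
rewrite ge0_integral_joint_law//; last 2 first.
- apply: emeasurable_funM.
    exact: measurableT_comp mk measurable_snd.
  exact: measurableT_comp mI measurable_snd.
- by move=> u; rewrite mule_ge0// lee_fin.
rewrite [RHS]ge0_integral_pushforward//; last exact: measurable_funTS.
rewrite [RHS]integral_mkcond; apply: eq_integral => w _ /=.
exact/esym/patch_preimage.
Qed.

Variable h : R -> R.
Hypothesis mh : measurable_fun setT h.
Hypothesis ih : P.-integrable setT (EFin \o (h \o Z)).

Let H : R -> \bar R := EFin \o h.
Let mH : measurable_fun setT H. Proof. exact/measurable_EFinP. Qed.
Let kp x := \int[K x]_v H^\+ v.
Let kn x := \int[K x]_v H^\- v.

Let integrable_part (F : R -> \bar R) : measurable_fun setT F -> (forall v, 0 <= F v) ->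
  P.-integrable setT (F \o Z) ->
  (distribution P X).-integrable setT (fun x => \int[K x]_v F v).
Proof.
move=> mF F0 /integrableP[_]; under eq_integral => w _ do rewrite gee0_abs//=.
rewrite -(preimage_setT X) ge0_integral_conditional_law// => fin.
apply/integrableP; split; first exact: measurable_kernel_integral_point.
by under eq_integral => x _ do rewrite gee0_abs ?integral_ge0//.
Qed.

Let ikp : (distribution P X).-integrable setT kp.
Proof.
apply: integrable_part => //; first exact: measurable_funepos.
by have := integrable_funepos measurableT ih; rewrite -funepos_comp.
Qed.

Let ikn : (distribution P X).-integrable setT kn.
Proof.
apply: integrable_part => //; first exact: measurable_funeneg.
by have := integrable_funeneg measurableT ih; rewrite -funeneg_comp.
Qed.

Let kE x : \int[K x]_v (h v)%:E = kp x - kn x.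
Proof. by rewrite integralE. Qed.

Lemma measurable_conditional_mean : measurable_fun setT (fun x => \int[K x]_v (h v)%:E).
Proof.
rewrite (_ : (fun x => _) = kp \- kn); last by apply/funext => x; exact: kE.
by apply: emeasurable_funB; [exact: measurable_int ikp|exact: measurable_int ikn].
Qed.

Lemma integral_conditional_law A : measurable A ->
  \int[P]_(w in X @^-1` A) (h (Z w))%:E =
  \int[distribution P X]_(x in A) \int[K x]_v (h v)%:E.
Proof.
move=> mA; rewrite integralE.
under [RHS]eq_integral => x _ do rewrite kE.
rewrite integralB//; [|exact: (integrableS measurableT)..].
have Ep := @ge0_integral_conditional_law H^\+ A mA (measurable_funepos mH) (@funepos_ge0 _ _ H).
have En := @ge0_integral_conditional_law H^\- A mA (measurable_funeneg mH) (@funeneg_ge0 _ _ H).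
congr (_ - _); [rewrite -[RHS]Ep|rewrite -[RHS]En]; apply: eq_integral => w _.
  by rewrite funeposE funeposE.
by rewrite funenegE funenegE.
Qed.

(** Connects the arbitrary versions in the hypotheses, such as the regression function or the
    function attached to a bounded test function, to means of the kernel: both have the same
    integral over every measurable set of covariates. *)
Lemma cond_expectation_conditional_law m : cond_expectation P X (h \o Z) m ->
  {ae distribution P X, forall x, \int[K x]_v (h v)%:E = (m x)%:E}.
Proof.
move=> [mm im mE].
suff : ae_eq (distribution P X) setT (EFin \o m) (fun x => \int[K x]_v (h v)%:E).
  by apply: filterS => x /(_ I).
have im' : (distribution P X).-integrable setT (EFin \o m).
  by apply: integrable_pushforward => //; exact/measurable_EFinP.
apply: integral_ae_eq => //; first exact: measurable_conditional_mean.
move=> A _ mA.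
transitivity (\int[P]_(w in X @^-1` A) (h (Z w))%:E); last exact: integral_conditional_law.
rewrite [RHS]mE// integral_pushforward//; first exact/measurable_EFinP.
by apply: (integrableS measurableT) => //; rewrite -[X in measurable X]setTI; exact: measurable_funP.
Qed.

End conditional_law.

Section treatment.
Context d (T : measurableType d) (R : realType) (P : probability T R).
Variable W : {mfun T >-> bool}.
Local Open Scope ereal_scope.
Hypothesis hW : 0 < P (W @^-1` [set true]) < 1.

Definition arm b : set T := W @^-1` [set b].

Lemma measurable_arm b : measurable (arm b).
Proof. exact: (measurable_funPTI W). Qed.

Definition weight b : R := fine (P (arm b)).

Lemma weightE b : P (arm b) = (weight b)%:E.
Proof. by rewrite fineK// fin_num_measure//; exact: measurable_arm. Qed.

Lemma armF : arm false = ~` arm true.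
Proof. by apply/seteqP; split=> w; rewrite /arm /=; case: (W w). Qed.

Lemma weight_gt0 b : (0 < weight b)%R.
Proof.
rewrite -lte_fin -weightE; move/andP: hW => [h0 h1]; case: b => //.
rewrite armF probability_setC ?sube_gt0//; exact: measurable_arm.
Qed.

Lemma cond_probE b A : measurable A ->
  (weight b)%:E * cond_prob P W b A = P (A `&` arm b).
Proof.
move=> mA; rewrite /cond_prob /= /mnormalize /= /mrestr setTI -/(arm b) weightE.
have w0 := weight_gt0 b.
rewrite eqe gt_eqF//= muleC -muleA -EFinM mulVf ?mule1//.
by rewrite gt_eqF.
Qed.

Lemma total_probability A : measurable A ->
  P A = (weight true)%:E * cond_prob P W true A + (weight false)%:E * cond_prob P W false A.
Proof.
move=> mA; rewrite !cond_probE// armF -measureU.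
- by rewrite -setIUr setUv setIT.
- by apply: measurableI => //; exact: measurable_arm.
- by apply: measurableI => //; apply: measurableC; exact: measurable_arm.
- by rewrite setIACA setICr setI0.
Qed.

Lemma cond_prob_null b A : measurable A -> P A = 0 -> cond_prob P W b A = 0.
Proof.
move=> mA PA; have : P (A `&` arm b) = 0.
  apply/eqP; rewrite eq_le measure_ge0 andbT -PA le_measure ?inE//.
  by apply: measurableI => //; exact: measurable_arm.
rewrite -cond_probE// => /eqP.
by rewrite mule_eq0 eqe gt_eqF ?weight_gt0//= => /eqP.
Qed.

Lemma ge0_total_expectation f : measurable_fun setT f -> (forall w, 0 <= f w) ->
  \int[P]_w f w = (weight true)%:E * \int[cond_prob P W true]_w f w +
                  (weight false)%:E * \int[cond_prob P W false]_w f w.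
Proof.
move=> mf f0.
pose k b : {nonneg R} := NngNum (ltW (weight_gt0 b)).
transitivity (\int[measure_add (mscale (k true) (cond_prob P W true))
                               (mscale (k false) (cond_prob P W false))]_w f w).
  apply: eq_measure_integral => A mA _; rewrite [RHS]measure_addE /mscale /=.
  exact: total_probability.
by rewrite ge0_integral_measure_add// !ge0_integral_mscale.
Qed.

Lemma integrable_cond_prob b f : P.-integrable setT f -> (cond_prob P W b).-integrable setT f.
Proof.
move=> /integrableP[mf]; have ma : measurable_fun setT (abse \o f) by exact: measurableT_comp.
rewrite ge0_total_expectation//.
move=> fin; apply/integrableP; split => //.
suff : (weight b)%:E * \int[cond_prob P W b]_x `|f x| < +oo.
  case: (\int[cond_prob P W b]_x `|f x|) => [r||]; rewrite ?ltry ?ltNyr//.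
  by rewrite gt0_muley ?lte_fin ?weight_gt0.
apply: le_lt_trans fin; case: b; [rewrite leeDl//|rewrite leeDr//];
  by rewrite mule_ge0 ?integral_ge0// lee_fin ltW// weight_gt0.
Qed.

Section conditional_independence.
Context d' (U : measurableType d') (X : {mfun T >-> U}) (Y0 : {mfun T >-> R}).
Variable K0 : U -> probability R R.
Let P1 := cond_prob P W true.
Let P0 := cond_prob P W false.
Let PX : probability U R := distribution P X.
Hypothesis hK0 : regular_cond_law P0 X Y0 K0.
Hypothesis hCIA : cond_independent P X Y0 W.
Hypothesis dom : distribution P1 X `<< distribution P0 X.

Lemma cond_probabilityE E m : measurable E -> cond_probability P X E m ->
  PX.-integrable setT (EFin \o m) /\
  forall A, measurable A -> P (E `&` X @^-1` A) = \int[PX]_(x in A) (m x)%:E.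
Proof.
move=> mE [mm im mint]; split=> [|A mA].
  by apply: integrable_pushforward => //; exact/measurable_EFinP.
have mXA : measurable (X @^-1` A) by rewrite -[X in measurable X]setTI; exact: measurable_funP.
have := mint A mA; rewrite integral_indic// => ->.
rewrite integral_pushforward//; first exact/measurable_EFinP.
exact: (integrableS measurableT).
Qed.

Lemma integral_arm_law A B : measurable A -> measurable B ->
  P0 (X @^-1` A `&` Y0 @^-1` B) = \int[distribution P0 X]_x (K0 x B * (\1_A x)%:E).
Proof.
move=> mA mB; have [mK ->//] := hK0.
rewrite ge0_integral_pushforward//; last 2 first.
- apply: emeasurable_funM; first exact: mK.
  exact/measurable_EFinP/measurable_indic.
- by move=> x _; rewrite mule_ge0// lee_fin.
rewrite preimage_setT [LHS]integral_mkcond.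
by apply: eq_integral => w _; exact: patch_preimage.
Qed.

(* On {W = 0} both p and K0 are versions of P(Y0 in B | X), so they agree almost surely for
   X | W = 0; by domination also for X | W = 1, hence for X. *)
Lemma cond_independent_version B : measurable B -> exists p : U -> R,
  cond_probability P X (Y0 @^-1` B) p /\ {ae PX, forall x, (p x)%:E = K0 x B}.
Proof.
move=> mB.
have mY : measurable (Y0 @^-1` B) by rewrite -[X in measurable X]setTI; exact: measurable_funP.
have [p [q [pP qP pqP]]] := hCIA mB (I : measurable [set false]).
exists p; split=> //.
have [ip _] := cond_probabilityE mY pP.
have [iq qE] := cond_probabilityE (measurable_arm false) qP.
have [ipq pqE] := cond_probabilityE (measurableI _ _ mY (measurable_arm false)) pqP.
have w0 := weight_gt0 false.
have mK := hK0.1 _ mB.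
pose c := (weight false)^-1%R.
(* By Bayes' rule [r] is the density of the law of X given W = 0 with respect to the law of X. *)
pose r x : \bar R := c%:E * (q x)%:E.
have ir : PX.-integrable setT r by exact: integrableZl.
have mr := measurable_int _ ir.
have PX0E A : measurable A -> distribution P0 X A = \int[PX]_(x in A) r x.
  move=> mA; have mXA : measurable (X @^-1` A).
    by rewrite -[X in measurable X]setTI; exact: measurable_funP.
  rewrite integralZl//; last exact: (integrableS measurableT).
  rewrite -qE// setIC -cond_probE// muleA -EFinM mulVf ?mul1e//.
  by rewrite gt_eqF.
(* Conditional independence factors the joint conditional probability as [p * q]; integrating over
   covariate sets compares it with [K0] weighted by the control density. *)
have prE : ae_eq PX setT (fun x => c%:E * (p x * q x)%:E) (fun x => K0 x B * r x).
  apply: integral_ae_eq => //.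
  - exact: integrableZl.
  - exact: emeasurable_funM.
  move=> A _ mA; have mXA : measurable (X @^-1` A).
    by rewrite -[X in measurable X]setTI; exact: measurable_funP.
  rewrite integralZl//; last exact: (integrableS measurableT).
  rewrite -pqE// (_ : _ `&` _ = (X @^-1` A `&` Y0 @^-1` B) `&` arm false); last first.
    by rewrite -[RHS]setIA [RHS]setIC.
  rewrite -cond_probE//; last exact: measurableI.
  rewrite muleA -EFinM mulVf ?gt_eqF// mul1e integral_arm_law//.
  rewrite (ge0_integral_density ir PX0E); last 2 first.
  - apply: emeasurable_funM => //.
    exact/measurable_EFinP/measurable_indic.
  - by move=> x; rewrite mule_ge0// lee_fin.
  rewrite [RHS]integral_mkcond; apply: eq_integral => x _.
  by rewrite [RHS](@patch_preimage _ _ R id) muleAC.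
(* Where [p] and [K0] differ, the identity just proved forces [q] to vanish, so [N] carries no
   control mass. *)
pose N := [set x | (p x)%:E != K0 x B].
have mN : measurable N.
  rewrite -[N]setTI; apply: measurable_neqe => //; exact: measurable_int ip.
have N0 : distribution P0 X N = 0.
  rewrite PX0E// -(integral0 PX N); apply: ae_eq_integral => //; first exact: measurable_funTS.
  apply: filterS prE => x /(_ I) + Nx; rewrite /r.
  have Kfin : K0 x B \is a fin_num by exact: fin_num_measure.
  move: Nx; rewrite /N /= -(fineK Kfin) -!EFinM eqe => pK [] /eqP.
  rewrite mulrA mulrCA mulrA -subr_eq0 -mulrBl mulf_eq0 subr_eq0 => /orP[/eqP e|/eqP ->]; last by rewrite mulr0.
  have cx : c != 0%R by rewrite invr_eq0 gt_eqF.
  by move: pK; rewrite (mulfI cx e) eqxx.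
exists N; split => //; last by move=> x /= /eqP.
rewrite [LHS]total_probability; last by rewrite -[X in measurable X]setTI; exact: measurable_funP.
rewrite -[cond_prob P W true _]/(distribution P1 X N) -[cond_prob P W false _]/(distribution P0 X N) N0.
move/null_content_dominatesP : dom => /(_ _ mN N0) ->.
by rewrite !mule0 adde0.
Qed.

Lemma cond_independent_regular : regular_cond_law P X Y0 K0.
Proof.
split; first exact: hK0.1.
move=> A B mA mB; have mK := hK0.1 _ mB.
have mY : measurable (Y0 @^-1` B) by rewrite -[X in measurable X]setTI; exact: measurable_funP.
have [p [pP pK]] := cond_independent_version mB.
have [ip pE] := cond_probabilityE mY pP.
rewrite setIC pE//.
transitivity (\int[PX]_(x in A) K0 x B).
  apply: ae_eq_integral => //; first exact/measurable_funTS/(measurable_int _ ip).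
    exact: measurable_funTS.
  by apply: filterS pK => x.
by rewrite ge0_integral_pushforward//; exact: measurable_funTS.
Qed.

(** The identity holds in the whole population and in the control arm; subtracting the second from
    the first in the law of total probability leaves the treated arm, whose weight is positive. *)
Lemma cond_independent_regular_treated : regular_cond_law P1 X Y0 K0.
Proof.
split; first exact: hK0.1.
move=> A B mA mB; have mK := hK0.1 _ mB.
have mY : measurable (Y0 @^-1` B) by rewrite -[X in measurable X]setTI; exact: measurable_funP.
have mXA : measurable (X @^-1` A) by rewrite -[X in measurable X]setTI; exact: measurable_funP.
have mKX : measurable_fun setT (fun w => K0 (X w) B) by exact: measurableT_comp mK _.
have H := cond_independent_regular.2 _ _ mA mB.
have := H; rewrite total_probability; last exact: measurableI.
rewrite integral_mkcond ge0_total_expectation; last 2 first.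
- by apply/(measurable_restrictT _ mXA); exact: measurable_funTS.
- by move=> w; rewrite patchE; case: ifPn.
rewrite -!integral_mkcond (hK0.2 _ _ mA mB).
have I0fin : \int[P0]_(w in X @^-1` A) K0 (X w) B \is a fin_num.
  by rewrite -(hK0.2 _ _ mA mB) fin_num_measure//; exact: measurableI.
have zfin : (weight false)%:E * \int[P0]_(w in X @^-1` A) K0 (X w) B \is a fin_num.
  by rewrite fin_numM.
move=> /(congr1 (fun y => y - (weight false)%:E * \int[P0]_(w in X @^-1` A) K0 (X w) B)).
rewrite !addeK// => /(congr1 (fun y => (weight true)^-1%:E * y)).
rewrite !muleA -!EFinM mulVf ?mul1e// gt_eqF//; exact: weight_gt0.
Qed.

End conditional_independence.

End treatment.

(** * The pooled sample and the covariate densities *)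

Section pooled_sample.
Context (R : realType) (k : nat) d (Omega : measurableType d) (Q : probability Omega R).
Local Notation U := (R * 'rV[R]_k)%type.
Context (N1 n : nat).
Variables (treated : 'I_N1 -> {mfun Omega >-> U}) (control : 'I_n -> {mfun Omega >-> U}).

Definition pooled (w : Omega) : (N1 + n).-tuple U :=
  [tuple match fintype.split s with inl i => treated i w | inr j => control j w end | s < N1 + n].

Lemma measurable_pooled : measurable_fun setT pooled.
Proof.
apply/measurable_fun_tnthP => s.
case E : (fintype.split s) => [i|j].
  rewrite (_ : _ \o _ = treated i); first exact: measurable_funP.
  by apply/funext => w /=; rewrite tnth_mktuple E.
rewrite (_ : _ \o _ = control j); first exact: measurable_funP.
by apply/funext => w /=; rewrite tnth_mktuple E.
Qed.

Definition pooled_law : probability ((N1 + n).-tuple U) R :=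
  distribution Q (mfun_of measurable_pooled).

Lemma pooled_treated w i : tnth (pooled w) (lshift n i) = treated i w.
Proof. by rewrite tnth_mktuple (unsplitK (inl i : 'I_N1 + 'I_n)). Qed.

Lemma pooled_control w j : tnth (pooled w) (rshift N1 j) = control j w.
Proof. by rewrite tnth_mktuple (unsplitK (inr j : 'I_N1 + 'I_n)). Qed.

Lemma sample_estimator_pooled V M w :
  sample_estimator V M (pooled w) = matching_estimator V M (treated ^~ w) (control ^~ w).
Proof.
rewrite /sample_estimator; congr matching_estimator; apply/funext => s.
  exact: pooled_treated.
exact: pooled_control.
Qed.

Variables (mu1 mu0 : probability U R).
Hypothesis treatedE : forall i A, measurable A -> Q (treated i @^-1` A) = mu1 A.
Hypothesis controlE : forall j A, measurable A -> Q (control j @^-1` A) = mu0 A.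
Hypothesis indep : mutually_independent Q
  (fun s : 'I_N1 + 'I_n => match s with inl i => treated i | inr j => control j end).

Lemma pooled_box_law : box_law (@unit_law _ _ mu1 mu0 N1 n) pooled_law.
Proof.
move=> A mA; pose B (s : 'I_N1 + 'I_n) := A (unsplit s).
have := indep (A := B) (fun s => mA _).
rewrite big_sumType/= big_split_ord/=.
rewrite [X in _ -> _ = (X * _)%E](eq_bigr (fun i => Q (treated i @^-1` B (inl i)))); last first.
  by move=> i _; rewrite unit_law_treated -(treatedE i (mA _)).
rewrite [X in _ -> _ = (_ * X)%E](eq_bigr (fun j => Q (control j @^-1` B (inr j)))); last first.
  by move=> j _; rewrite unit_law_control -(controlE j (mA _)).
move=> <-; congr (Q _); apply/seteqP; split=> w /= H.
  by move=> [i|j]; [rewrite -pooled_treated|rewrite -pooled_control]; exact: H.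
move=> s; rewrite -[s]splitK; case: (fintype.split s) => [i|j] /=.
  by rewrite pooled_treated; exact: (H (inl i)).
by rewrite pooled_control; exact: (H (inr j)).
Qed.

End pooled_sample.

Section covariate_densities.
Context (R : realType) (k : nat) d (T : measurableType d) (P : probability T R).
Variable X : {mfun T >-> 'rV[R]_k}.
Variables (S : set 'rV[R]_k) (f : 'rV[R]_k -> R).
Hypothesis mS : measurable S.
Hypothesis hf : density_on P X S f.
Local Open Scope ereal_scope.

Lemma density_on_ae : {ae distribution P X, forall x, S x}.
Proof.
exists (~` S); split => //; first exact: measurableC.
have [_ _ fE] := hf; rewrite /distribution /pushforward fE; last exact: measurableC.
by rewrite setICl integral_set0.
Qed.

Lemma integral_density_on (g : 'rV[R]_k -> \bar R) : measurable_fun setT g ->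
  (forall x, 0 <= g x) ->
  \int[distribution P X]_x g x = \int[lebesgue_rV R k]_(x in S) (g x * (f x)%:E).
Proof.
move=> mg g0; have [mf f0 fE] := hf.
pose q := (EFin \o f) \_ S.
have mq : measurable_fun setT q by apply/(measurable_restrictT _ mS); exact/measurable_EFinP.
have q0 x : 0 <= q x by rewrite /q patchE; case: ifPn => //; rewrite inE lee_fin; exact: f0.
have qE A : measurable A -> distribution P X A = \int[lebesgue_rV R k]_(x in A) q x.
  by move=> mA; rewrite -integral_mkcondr -fE.
have iq : (lebesgue_rV R k).-integrable setT q.
  apply/integrableP; split => //.
  under eq_integral => x _ do rewrite gee0_abs//.
  by rewrite -qE// [X in X < _]probability_setT ltry.
rewrite (ge0_integral_density iq qE mg g0) [RHS]integral_mkcond.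
by apply: eq_integral => x _; rewrite /q !patchE; case: ifPn; rewrite ?mule0.
Qed.

(** The ball lies in a cube of side [2 * r]. As the side is at most 1 and there is at least one
    coordinate, the volume is at most the side, a bound linear in [r] in every dimension. *)
Lemma lebesgue_rV_norm_ball (x : 'rV[R]_k) (r : R) : (0 < k)%N -> (0 < r)%R -> (r <= 2^-1)%R ->
  lebesgue_rV R k [set y | (`|x - y| < r)%R] <= (2 * r)%:E.
Proof.
move=> k0 r0 r2.
pose A (i : 'I_k) : set R := `[(x ord0 i - r)%R, (x ord0 i + r)%R]%classic.
have mA i : measurable (A i) by exact: measurable_itv.
apply: (@le_trans _ _ (lebesgue_rV R k [set v : 'rV[R]_k | forall i, A i (v ord0 i)])).
  apply: le_measure; rewrite ?inE.
  - exact: measurable_norm_ball.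
  - rewrite (_ : [set v | _] = \bigcap_(i in [set: 'I_k]) (fun v : 'rV[R]_k => v ord0 i) @^-1` A i).
      apply: fin_bigcap_measurable => // i _.
      by rewrite -[X in measurable X]setTI; exact: measurable_coord.
    by apply/seteqP; split => [v Av i _|v Av i]; exact: Av.
  - move=> y /= /(norm_ltP _ r0) yr i; have := yr i; rewrite !mxE /A /= in_itv /=.
    by rewrite ltr_norml => /andP[h1 h2]; apply/andP; split; lra.
rewrite rV_powerE//.
have E i : (@lebesgue_R R) (A i) = (2 * r)%:E.
  rewrite /lebesgue_R /A [LHS]lebesgue_measure_itv/= lte_fin.
  rewrite ifT; last by lra.
  by rewrite -EFinB; congr EFin; lra.
rewrite (eq_bigr (fun=> (2 * r)%:E)); last by move=> i _; exact: E.
rewrite prodEFin lee_fin prodr_const card_ord.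
case: k k0 => // m _; rewrite exprS ler_piMr//; first by lra.
by rewrite exprn_ile1//; lra.
Qed.

Lemma density_on_small_balls (C : R) : (0 < k)%N -> (0 < C)%R -> (forall x, S x -> f x <= C)%R ->
  forall (x : 'rV[R]_k) (r : R), (0 < r)%R -> (r <= 2^-1)%R ->
  distribution P X [set y | (`|x - y| < r)%R] <= (C * 2 * r)%:E.
Proof.
move=> k0 C0 fC x r r0 r2; have [mf f0 fE] := hf.
have mB := measurable_norm_ball x r.
rewrite /distribution /pushforward fE//.
apply: (@le_trans _ _ (\int[lebesgue_rV R k]_(y in [set y | (`|x - y| < r)%R] `&` S) C%:E)).
  apply: ge0_le_integral => //; first exact: measurableI.
  - by move=> y [_ /f0]; rewrite lee_fin.
  - by apply: (measurable_funS mS) => [y []//|]; exact/measurable_EFinP.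
  - by move=> y [_ Sy]; rewrite lee_fin; exact: fC.
rewrite integral_cst//; last exact: measurableI.
rewrite -mulrA EFinM lee_pmul2l//.
apply: le_trans (lebesgue_rV_norm_ball x k0 r0 r2).
by apply: le_measure; rewrite ?inE//; exact: measurableI.
Qed.

End covariate_densities.

(** The lower bound on [f0] makes a set that is null for the controls Lebesgue null within [S1], and
    the treated law has a density there. *)
Lemma density_on_dominates (R : realType) (k : nat) d (T : measurableType d)
  (P1 P0 : probability T R) (X : {mfun T >-> 'rV[R]_k}) S1 S0 (f1 f0 : 'rV[R]_k -> R) (c : R) :
  measurable S1 -> measurable S0 -> S1 `<=` S0 ->
  density_on P1 X S1 f1 -> density_on P0 X S0 f0 ->
  0 < c -> (forall x, S1 x -> c <= f0 x) ->
  distribution P1 X `<< distribution P0 X.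
Proof.
move=> mS1 mS0 S10 [mf1 f10 f1E] [mf0 f00 f0E] c0 cf.
apply/null_content_dominatesP => A mA.
change (P0 (X @^-1` A) = 0%E -> P1 (X @^-1` A) = 0%E).
rewrite f0E// f1E// => A0.
have mAS : measurable (A `&` S1) by exact: measurableI.
apply: null_set_integral => //.
  by apply: (measurable_funS mS1) => [y []//|]; exact/measurable_EFinP.
apply/eqP; rewrite eq_le measure_ge0 andbT.
have mf0' B : measurable B -> B `<=` S0 -> measurable_fun B (fun x => (f0 x)%:E).
  by move=> mB BS; apply: (measurable_funS mS0) => //; exact/measurable_EFinP.
have : (c%:E * lebesgue_rV R k (A `&` S1) <= 0)%E.
  rewrite -A0 -integral_cst//.
  apply: (@le_trans _ _ (\int[lebesgue_rV R k]_(x in A `&` S1) (f0 x)%:E)%E).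
    apply: ge0_le_integral => //.
    - by move=> y _; rewrite lee_fin ltW.
    - by apply: mf0' => // y [_ /S10].
    - by move=> y [_ Sy]; rewrite lee_fin; exact: cf.
  apply: ge0_subset_integral => //; first exact: measurableI.
  - by apply: mf0'; [exact: measurableI|move=> y []].
  - by move=> y [_ /f00]; rewrite lee_fin.
  - by move=> y [Ay /S10].
by rewrite pmule_rle0// lte_fin.
Qed.

Lemma law_support_ball (R : realType) (k : nat) (mu : set 'rV[R]_k -> \bar R)
  (x : 'rV[R]_k) (e : R) : law_support mu x -> 0 < e -> (0 < mu [set y | (`|x - y| < e)%R])%E.
Proof.
move=> Sx e0; rewrite (_ : [set y | _] = ball x e); last first.
  by apply/seteqP; split=> y /=; rewrite mx_norm_ball.
by apply: Sx; [exact: ball_open|exact: ballxx].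
Qed.

(** * The limit law, its distribution function and its mean *)

Lemma measurable_kernel_mean d1 d2 (X : measurableType d1) (Y : measurableType d2)
  (R : realType) (K : X -> probability Y R) (f : Y -> \bar R) :
  measurable_kernel_fam K -> measurable_fun setT f ->
  measurable_fun setT (fun x => \int[K x]_y f y)%E.
Proof.
move=> mK mf.
rewrite (_ : (fun x => _) = (fun x => \int[K x]_y f^\+ y) \- (fun x => \int[K x]_y f^\- y))%E; last first.
  by apply/funext => x; rewrite [LHS]integralE.
apply: emeasurable_funB.
  apply: (measurable_kernel_integral mK (f := f^\+%E \o snd)) => [z|]; first exact: funepos_ge0.
  exact: measurableT_comp (measurable_funepos mf) measurable_snd.
apply: (measurable_kernel_integral mK (f := f^\-%E \o snd)) => [z|]; first exact: funeneg_ge0.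
exact: measurableT_comp (measurable_funeneg mf) measurable_snd.
Qed.

Section rV_power_mean.
Context (R : realType) (p : probability R R) (n : nat).
Local Open Scope ereal_scope.

Lemma ge0_integral_rV_power_coord (i : 'I_n) (h : R -> \bar R) : measurable_fun setT h ->
  (forall s, 0 <= h s) -> \int[rV_powerP p (n:=n)]_v h (v ord0 i) = \int[p]_s h s.
Proof.
move=> mh h0.
rewrite -[LHS](ge0_integral_pushforward (@measurable_coord R n i) _ measurableT)//.
rewrite (eq_measure_integral p)//; first exact: measurable_coord.
by move=> mf A mA _; exact: rV_power_coord.
Qed.

Hypothesis ip : p.-integrable setT EFin.

Lemma integrable_rV_power_coord (i : 'I_n) :
  (rV_powerP p (n:=n)).-integrable setT (fun v => (v ord0 i)%:E).
Proof.
apply/integrableP; split; first by apply/measurable_EFinP; exact: measurable_coord.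
rewrite (ge0_integral_rV_power_coord i (h := fun s => `|s%:E|))//; last exact: measurableT_comp.
by case/integrableP: ip.
Qed.

Lemma integral_rV_power_coord (i : 'I_n) :
  \int[rV_powerP p (n:=n)]_v (v ord0 i)%:E = \int[p]_s s%:E.
Proof.
rewrite -[LHS](integral_pushforward (@measurable_coord R n i) _ _ measurableT)//.
  rewrite (eq_measure_integral p)//; first exact: measurable_coord.
by move=> mf A mA _; exact: rV_power_coord.
exact: integrable_rV_power_coord.
Qed.

Lemma integrable_rV_power_sum (a c : R) :
  (rV_powerP p (n:=n)).-integrable setT (fun v => (a + c * \sum_i v ord0 i)%:E).
Proof.
under eq_fun => v do rewrite EFinD EFinM -sumEFin.
apply: integrableD => //; first exact: finite_measure_integrable_cst.
apply: integrableZl => //.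
by apply: integrable_sum => // i _; exact: integrable_rV_power_coord.
Qed.

Lemma integral_rV_power_sum (a c : R) : 
  \int[rV_powerP p (n:=n)]_v (a + c * \sum_i v ord0 i)%:E = a%:E + (c * n%:R)%:E * \int[p]_s s%:E.
Proof.
have is_ : (rV_powerP p (n:=n)).-integrable setT (fun v : 'rV[R]_n => \sum_i (v ord0 i)%:E).
  by apply: integrable_sum => // i _; exact: integrable_rV_power_coord.
have ic : (rV_powerP p (n:=n)).-integrable setT (fun v : 'rV[R]_n => c%:E * \sum_i (v ord0 i)%:E).
  exact: integrableZl.
under eq_integral => v _ do rewrite EFinD EFinM -sumEFin.
rewrite integralD//; last exact: finite_measure_integrable_cst.
rewrite integral_cst// [X in _ * X + _]probability_setT mule1 integralZl//.
rewrite integral_sum//; last by move=> i; exact: integrable_rV_power_coord.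
under eq_bigr => i _ do rewrite integral_rV_power_coord.
have pf : \int[p]_s s%:E \is a fin_num by exact: integrable_fin_num.
rewrite -(fineK pf) sumEFin big_const_ord iter_addr_0 -!EFinM.
by congr (_ + EFin _); rewrite -[LHS]/(c * _)%R -mulr_natr; ring.
Qed.

End rV_power_mean.

Section match_law_facts.
Context (R : realType) (k : nat).
Local Notation U := (R * 'rV[R]_k)%type.
Variables (mu1 mu0 : probability U R) (K1 K0 : 'rV[R]_k -> probability R R).
Hypothesis disint0 : disintegration mu0 K0.
Variables (M : nat) (tau : R).
Local Open Scope ereal_scope.
Let Law : probability R R := match_law mu1 disint0 M tau.

Section cdf.
Hypothesis M0 : (0 < M)%N.
Hypothesis mK1 : measurable_kernel_fam K1.
Variables m1 m0 : 'rV[R]_k -> R.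

Lemma match_cdf_kernel t x : match_cdf M K1 K0 m1 m0 tau t x =
  \int[K1 x]_y match_kernel K0 M tau (y, x) `]-oo, t]%classic.
Proof.
rewrite /match_cdf /product_measure1; apply: eq_integral => y _.
rewrite match_kernelE /=; congr (rV_power _ _ _).
(* [m1 x] cancels at once; the average of [M] copies of [m0 x] cancels the other mean because [M] is
   nonzero. *)
have E (v : 'rV[R]_M) : (m1 x - m0 x - tau + (y - m1 x) -
    M%:R^-1 * \sum_(m < M) (v ord0 m - m0 x) = (y - tau) + - M%:R^-1 * \sum_i v ord0 i)%R.
  have Mn0 : (M%:R != 0 :> R)%R by rewrite pnatr_eq0 -lt0n.
  by rewrite sumrB sumr_const card_ord -mulr_natr; field.
by apply/seteqP; split=> v; rewrite /xsection /= inE /= in_itv/= E.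
Qed.

Let mmatch t : measurable_fun setT (fun p : 'rV[R]_k * R =>
  match_kernel K0 M tau (p.2, p.1) `]-oo, t]%classic).
Proof.
have mB : measurable (`]-oo, t]%classic : set R) by exact: measurable_itv.
apply: (measurableT_comp (measurable_match_kernel disint0 M tau mB)).
by apply/measurable_fun_pairP; split; [exact: measurable_snd|exact: measurable_fst].
Qed.

Lemma measurable_match_cdf t : measurable_fun setT (match_cdf M K1 K0 m1 m0 tau t).
Proof.
rewrite (_ : match_cdf _ _ _ _ _ _ _ = fun x => \int[K1 x]_y match_kernel K0 M tau (y, x) `]-oo, t]%classic).
  exact: (measurable_kernel_integral mK1 (f := fun p => match_kernel K0 M tau (p.2, p.1) `]-oo, t]%classic)).
by apply/funext => x; exact: match_cdf_kernel.
Qed.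

(** Redrawing the treated outcome from [K1] at its covariate preserves [mu1], and the inner integral
    becomes [match_cdf]. *)
Lemma match_law_cdf t : disintegration mu1 K1 ->
  Law `]-oo, t]%classic = \int[mu1]_u match_cdf M K1 K0 m1 m0 tau t u.2.
Proof.
move=> disint1; have mB : measurable (`]-oo, t]%classic : set R) by exact: measurable_itv.
have H := disintegration_integral disint1 (measurable_match_kernel disint0 M tau mB)
  (fun u => measure_ge0 (match_kernel K0 M tau u) _).
apply: etrans (esym H) _.
by apply: eq_integral => u _; rewrite match_cdf_kernel.
Qed.

End cdf.

Section mean.
Hypothesis M0 : (0 < M)%N.
Hypothesis iY1 : mu1.-integrable setT (fun u => (u.1)%:E).
Hypothesis first_moment : \int[mu1]_u \int[K0 u.2]_v (`|v|)%:E < +oo.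

Let mK2 : measurable_kernel_fam (fun u : U => K0 u.2).
Proof. exact: (measurable_kernel_comp disint0 measurable_snd). Qed.

Let mabs : measurable_fun setT (fun v : R => (`|v|)%:E : \bar R).
Proof. by apply/measurable_EFinP; exact: normr_measurable. Qed.

Let mmean : measurable_fun setT (fun u : U => \int[K0 u.2]_v (`|v|)%:E).
Proof. exact: (measurable_kernel_mean mK2 mabs). Qed.

Lemma match_kernel_abs u : \int[match_kernel K0 M tau u]_s (`|s|)%:E <=
  (`|u.1|)%:E + (`|tau|)%:E + \int[K0 u.2]_v (`|v|)%:E.
Proof.
rewrite (_ : \int[match_kernel K0 M tau u]_s _ = \int[rV_powerP (K0 u.2) (n:=M)]_v
    (`|(u.1 - tau) + - M%:R^-1 * \sum_i v ord0 i|%R)%:E); last by rewrite ge0_integral_pushforward.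
have mc i : measurable_fun setT (fun v : 'rV[R]_M => (`|v ord0 i|)%:E : \bar R).
  by apply: (measurableT_comp mabs); exact: measurable_coord.
have ms : measurable_fun setT (fun v : 'rV[R]_M => \sum_i (`|v ord0 i|)%:E : \bar R).
  by apply: emeasurable_sum => i; exact: mc.
have s0 (v : 'rV[R]_M) : 0 <= \sum_i (`|v ord0 i|)%:E by apply: sume_ge0 => i _; rewrite lee_fin.
have M1 : 0 <= (M%:R^-1)%:E :> \bar R by rewrite lee_fin invr_ge0.
apply: (@le_trans _ _ (\int[rV_powerP (K0 u.2) (n:=M)]_v
    (((`|u.1| + `|tau|)%R)%:E + (M%:R^-1)%:E * \sum_i (`|v ord0 i|)%:E))).
  apply: ge0_le_integral => //.
  - apply: (measurableT_comp mabs); apply: measurable_funD => //.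
    by apply: measurable_funM => //; exact: measurable_sum_coord.
  - by apply: emeasurable_funD => //; exact: measurable_funeM.
  - move=> v _; rewrite sumEFin -EFinM -EFinD lee_fin.
    apply: (le_trans (ler_normD _ _)); rewrite lerD ?ler_normB//.
    by rewrite normrM normrN normfV normr_nat ler_wpM2l ?invr_ge0//; exact: ler_norm_sum.
rewrite ge0_integralD//; last 2 first.
- by move=> v _; rewrite mule_ge0.
- exact: measurable_funeM.
rewrite integral_cst// [X in _ * X + _]probability_setT mule1 EFinD leeD2l//.
rewrite ge0_integralZl// ge0_integral_sum//.
under eq_bigr => i _ do rewrite (ge0_integral_rV_power_coord _ i mabs)//.
(* An infinite conditional moment makes the bound trivial; a finite one, summed over [M] draws and
   divided by [M], appears once. *)
have [fin|] := ltP (\int[K0 u.2]_v (`|v|)%:E) +oo; last by rewrite leye_eq => /eqP ->; rewrite leey.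
have pf : \int[K0 u.2]_v (`|v|)%:E \is a fin_num by rewrite ge0_fin_numE// integral_ge0.
rewrite -(fineK pf) sumEFin big_const_ord iter_addr_0 -EFinM lee_fin -(mulr_natl (fine _)) mulrA mulVf ?mul1r//.
by rewrite pnatr_eq0 -lt0n.
Qed.

Lemma integrable_match_law : Law.-integrable setT EFin.
Proof.
apply/integrableP; split => //.
rewrite ge0_integral_mixture//.
have ma : measurable_fun setT (fun u : U => (`|u.1|)%:E : \bar R).
  exact: measurableT_comp mabs measurable_fst.
apply: (@le_lt_trans _ _ (\int[mu1]_u ((`|u.1|)%:E + (`|tau|)%:E + \int[K0 u.2]_v (`|v|)%:E))).
  apply: ge0_le_integral => //.
  - by move=> u _; apply: integral_ge0.
  - exact: (measurable_kernel_mean (measurable_match_kernel disint0 M tau) mabs).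
  - by apply: emeasurable_funD => //; exact: emeasurable_funD.
  - by move=> u _; exact: match_kernel_abs.
rewrite ge0_integralD//; last 3 first.
- by move=> u _; rewrite adde_ge0// lee_fin.
- exact: emeasurable_funD.
- by move=> u _; apply: integral_ge0.
rewrite lte_add_pinfty// ge0_integralD// lte_add_pinfty//.
  by case/integrableP : iY1.
by rewrite integral_cst// [X in _ * X]probability_setT mule1 ltry.
Qed.

Variable m0 : 'rV[R]_k -> R.
Hypothesis mm0 : measurable_fun setT m0.
Hypothesis m0E : {ae mu1, forall u, \int[K0 u.2]_v v%:E = (m0 u.2)%:E}.

Lemma match_law_mean : \int[Law]_s s%:E = \int[mu1]_u (u.1 - tau - m0 u.2)%:E.
Proof.
have mE : measurable_fun setT (EFin : R -> \bar R) by exact/measurable_EFinP.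
have mK := measurable_match_kernel disint0 M tau.
have [N [mN N0 HN]] : {ae mu1, forall u, \int[K0 u.2]_v (`|v|)%:E < +oo}.
  have : mu1.-integrable setT (fun u => \int[K0 u.2]_v (`|v|)%:E).
    apply/integrableP; split => //.
    by under eq_integral => u _ do rewrite gee0_abs ?integral_ge0//.
  move/(integrable_ae measurableT); apply: filterS => u /(_ I).
  by rewrite ge0_fin_numE// integral_ge0.
have E : {ae mu1, forall u, \int[match_kernel K0 M tau u]_s s%:E = (u.1 - tau - m0 u.2)%:E}.
  have afin : {ae mu1, forall u, \int[K0 u.2]_v (`|v|)%:E < +oo} by exists N.
  apply: filterS2 afin m0E => u fin mu.
  have ip : (K0 u.2).-integrable setT EFin by apply/integrableP; split.
  rewrite (_ : \int[match_kernel K0 M tau u]_s _ = \int[rV_powerP (K0 u.2) (n:=M)]_v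
    ((u.1 - tau) + - M%:R^-1 * \sum_i v ord0 i)%:E); last first.
    by rewrite integral_pushforward//=; exact: integrable_rV_power_sum.
  rewrite integral_rV_power_sum// mu -EFinM -EFinD; congr EFin.
  by rewrite mulNr mulVf ?mulN1r// pnatr_eq0 -lt0n.
rewrite integral_mixture//; last exact: integrable_match_law.
apply: ae_eq_integral => //; first exact: (measurable_kernel_mean mK mE).
  apply/measurable_EFinP/measurable_funB; last exact: measurableT_comp mm0 measurable_snd.
  by apply: measurable_funB => //; exact: measurable_fst.
by apply: filterS E => u.
Qed.


End mean.
End match_law_facts.

(** * From ramps to convergence in distribution *)

Lemma ramp_bracket d (T : measurableType d) (R : realType) (P : probability T R) (Z : T -> R) (t e : R) : measurable_fun setT Z -> 0 < e ->
  (P (Z @^-1` `]-oo, t]) <= \int[P]_w (ramp t e (Z w))%:E <= P (Z @^-1` `]-oo, (t + e)%R]))%E.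
Proof.
move=> mZ e0.
have mA s : measurable (Z @^-1` `]-oo, s]).
  by rewrite -[X in measurable X]setTI; apply: mZ => //; exact: measurable_itv.
have mr : measurable_fun setT (fun w => (ramp t e (Z w))%:E : \bar R).
  apply/measurable_EFinP; apply: (measurableT_comp (f := ramp t e) _ mZ); exact: measurable_ramp.
have r01 s := ramp01 t e s.
have mI s : measurable_fun setT (fun w => (\1_(Z @^-1` `]-oo, s]) w)%:E : \bar R).
  exact/measurable_EFinP/measurable_indic.
apply/andP; split; rewrite -integral_indicT//; apply: ge0_le_integral => //.
- move=> w _; rewrite lee_fin indicE.
  have [zt|zt] := leP (Z w) t; last by rewrite memNset ?(andP (r01 _)).1//= in_itv/= leNgt zt.
  by rewrite mem_set ?ramp1//= in_itv.
- by move=> w _; rewrite lee_fin (andP (r01 _)).1.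
- move=> w _; rewrite lee_fin indicE.
  have [zt|zt] := leP (Z w) (t + e).
    by rewrite mem_set ?(andP (r01 _)).2//= in_itv.
  by rewrite memNset ?ramp0// ?ltW//= in_itv/= leNgt zt.
Qed.

Section ramp_convergence.
Context d (T : measurableType d) (R : realType) (P : probability T R).
Local Open Scope ereal_scope.

(** The ramps that start to fall at [t] and at [t - e] bracket the distribution functions between
    [t - e] and [t + e]; continuity of the limit at [t] closes the gap. Only integrals occur, so the
    variables may live on different spaces. *)
Lemma cvg_in_distribution_ramp (Z' : T -> R) (dO : nat -> measure_display)
    (Omega : forall n, measurableType (dO n)) (Q : forall n, probability (Omega n) R)
    (Z : forall n, Omega n -> R) :
  measurable_fun setT Z' -> (forall n, measurable_fun setT (Z n)) ->
  (forall t e eps : R, (0 < e)%R -> (0 < eps)%R -> exists n0 : nat, forall n, (n0 <= n)%N ->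
    \int[Q n]_w (ramp t e (Z n w))%:E <= \int[P]_s (ramp t e (Z' s))%:E + eps%:E /\
    \int[P]_s (ramp t e (Z' s))%:E <= \int[Q n]_w (ramp t e (Z n w))%:E + eps%:E) ->
  cvg_in_distribution P Q Z Z'.
Proof.
move=> mZ' mZ H t ct.
pose F s := fine (P (Z' @^-1` `]-oo, s])).
have mA' s : measurable (Z' @^-1` `]-oo, s]).
  by rewrite -[X in measurable X]setTI; apply: mZ' => //; exact: measurable_itv.
have mA n s : measurable (Z n @^-1` `]-oo, s]).
  by rewrite -[X in measurable X]setTI; apply: mZ => //; exact: measurable_itv.
have FE s : P (Z' @^-1` `]-oo, s]) = (F s)%:E by rewrite fineK// fin_num_measure.
have cF : F s @[s --> t] --> F t.
  by have := fine_cvg (f := fun s => P (Z' @^-1` `]-oo, s])); rewrite /F; apply; rewrite fineK ?fin_num_measure.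
rewrite FE; apply/fine_cvgP; split.
  by apply: nearW => n; rewrite fin_num_measure.
apply/cvgrPdist_le => eps eps0; have e2 : (0 < eps / 2)%R by exact: divr_gt0.
have /cvgrPdist_le/(_ _ e2) := cF => /nbhs_ballP[dl dl0 Hd].
pose e := (dl / 2)%R.
have e0 : (0 < e)%R by exact: divr_gt0.
have edl : (e < dl)%R by rewrite /e; move: (dl0 : (0 < dl)%R); lra.
have Fp : (`|F t - F (t + e)| <= eps / 2)%R.
  by apply: Hd; rewrite -ball_normE /= opprD addrA subrr sub0r normrN gtr0_norm.
have Fm : (`|F t - F (t - e)| <= eps / 2)%R.
  by apply: Hd; rewrite -ball_normE /= opprB addrCA subrr addr0 gtr0_norm.
have [n1 H1] := H t e _ e0 e2; have [n2 H2] := H (t - e)%R e _ e0 e2.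
exists (maxn n1 n2) => // n /= ; rewrite geq_max => /andP[n1n n2n].
have [h1 _] := H1 n n1n; have [_ h2] := H2 n n2n.
have /andP[_ a2] := ramp_bracket P t mZ' e0.
have /andP[a3 _] := ramp_bracket P (t - e) mZ' e0.
have /andP[b1 _] := @ramp_bracket _ _ _ (Q n) _ t e (mZ n) e0.
have /andP[_ b2] := @ramp_bracket _ _ _ (Q n) _ (t - e) e (mZ n) e0.
rewrite subrK in b2.
have qE : Q n (Z n @^-1` `]-oo, t]) = (fine (Q n (Z n @^-1` `]-oo, t])))%:E.
  by rewrite fineK// fin_num_measure.
have up : (fine (Q n (Z n @^-1` `]-oo, t])) <= F (t + e) + eps / 2)%R.
  rewrite -lee_fin -qE EFinD -FE; apply: (le_trans b1); apply: (le_trans h1).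
  by rewrite leeD2r.
have lo : (F (t - e) <= fine (Q n (Z n @^-1` `]-oo, t])) + eps / 2)%R.
  rewrite -lee_fin -FE EFinD -qE; apply: (le_trans a3); apply: (le_trans h2).
  by rewrite leeD2r.
move: Fp Fm; rewrite !ler_norml => /andP[p1 p2] /andP[m1 m2].
by apply/andP; split; rewrite /=; lra.
Qed.

End ramp_convergence.

Section joint_law_integrals.
Context d (T : measurableType d) (R : realType) (P : probability T R).
Context d' (U : measurableType d') (X : {mfun T >-> U}) (Z : {mfun T >-> R}).
Local Open Scope ereal_scope.

Lemma ae_joint_law (S : set U) : {ae distribution P X, forall x, S x} ->
  {ae joint_law P X Z, forall u, S u.2}.
Proof.
move=> [N [mN N0 HN]]; exists (snd @^-1` N); split.
- by rewrite -[X in measurable X]setTI; exact: measurable_snd.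
- exact: N0.
- by move=> u /= Su; apply: HN.
Qed.

Variable f : R * U -> \bar R.
Hypothesis mf : measurable_fun setT f.
Hypothesis fi : P.-integrable setT (fun w => f (Z w, X w)).

Lemma integrable_joint_law : (joint_law P X Z).-integrable setT f.
Proof. exact: integrable_pushforward. Qed.

Lemma integral_joint_law A : measurable A ->
  \int[joint_law P X Z]_(u in A) f u = \int[P]_(w in [set w | A (Z w, X w)]) f (Z w, X w).
Proof.
move=> mA; rewrite integral_pushforward//.
apply: (integrableS measurableT) => //.
have := measurable_joint X Z measurableT mA; rewrite setTI.
exact.
Qed.

End joint_law_integrals.

(** * What the model hypotheses say about the two arms *)

Section reduction.
Context (R : realType) (k : nat) d (T : measurableType d) (P : probability T R).
Variables (Y0 Y1 : {mfun T >-> R}) (X : {mfun T >-> 'rV[R]_k}) (W : {mfun T >-> bool}).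
Hypothesis hW : (0 < P (W @^-1` [set true]) < 1)%E.
Hypothesis hY0 : P.-integrable [set: T] (EFin \o Y0).
Hypothesis hY1 : P.-integrable [set: T] (EFin \o Y1).
Let P1 := cond_prob P W true.
Let P0 := cond_prob P W false.
Let S1 := law_support (distribution P1 X).
Let S0 := law_support (distribution P0 X).
Let tau := fine ('E_P1[fun w => (Y1 w - Y0 w)%R])%E.
Variables (f1 f0 m0 : 'rV[R]_k -> R) (K1 K0 : 'rV[R]_k -> probability R R).
Hypothesis hf1 : density_on P1 X S1 f1.
Hypothesis hf0 : density_on P0 X S0 f0.
Hypothesis hm0 : cond_expectation P X Y0 m0.
Hypothesis hK1 : regular_cond_law P1 X Y1 K1.
Hypothesis hK0 : regular_cond_law P0 X Y0 K0.
Hypothesis hCIA : cond_independent P X Y0 W.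
Hypothesis S10 : S1 `<=` S0.
Hypothesis cS1 : compact S1.
Hypothesis cS0 : compact S0.
Hypothesis hf0_lb : exists2 c : R, 0 < c & forall x, S1 x -> c <= f0 x.

Let mS1 : measurable S1. Proof. exact: compact_measurable_rV. Qed.
Let mS0 : measurable S0. Proof. exact: compact_measurable_rV. Qed.

Lemma treated_covariates_dominated : distribution P1 X `<< distribution P0 X.
Proof.
have [c c0 cf] := hf0_lb.
exact: (density_on_dominates mS1 mS0 S10 hf1 hf0 c0 cf).
Qed.

Let dom := treated_covariates_dominated.

Definition treated_law := joint_law P1 X Y1.
Definition control_law := joint_law P0 X Y0.

Lemma control_disintegration : disintegration control_law K0.
Proof. exact: joint_law_disintegration. Qed.

Lemma treated_disintegration : disintegration treated_law K1.
Proof. exact: joint_law_disintegration. Qed.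

Let rK : regular_cond_law P X Y0 K0.
Proof. exact: (cond_independent_regular hW hK0 hCIA dom). Qed.

Let rK1 : regular_cond_law P1 X Y0 K0.
Proof. exact: (cond_independent_regular_treated hW hK0 hCIA dom). Qed.

Lemma control_balls (x : 'rV[R]_k) (e : R) : S1 x -> 0 < e ->
  (0 < control_law [set u | (`|x - u.2| < e)%R])%E.
Proof. by move=> /S10 Sx; exact: (law_support_ball Sx). Qed.

Lemma treated_support : {ae treated_law, forall u, S1 u.2}.
Proof. by apply: ae_joint_law; exact: density_on_ae hf1. Qed.

Lemma control_support : {ae control_law, forall u, S0 u.2}.
Proof. by apply: ae_joint_law; exact: density_on_ae hf0. Qed.

Let mfst : measurable_fun setT (fun u : R * 'rV[R]_k => u.1%:E).
Proof. by apply/measurable_EFinP; exact: measurable_fst. Qed.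

Let mm0 : measurable_fun setT m0. Proof. by case: hm0. Qed.

Let mm0X : measurable_fun setT (fun u : R * 'rV[R]_k => (m0 u.2)%:E).
Proof. by apply/measurable_EFinP; exact: measurableT_comp mm0 measurable_snd. Qed.

Let im0X b : (cond_prob P W b).-integrable setT (EFin \o (m0 \o X)).
Proof. by apply: integrable_cond_prob => //; case: hm0. Qed.

Let iY b (Y : {mfun T >-> R}) : P.-integrable setT (EFin \o Y) ->
  (cond_prob P W b).-integrable setT (EFin \o Y).
Proof. exact: integrable_cond_prob. Qed.

Lemma integrable_treated_outcome : treated_law.-integrable setT (fun u => (u.1)%:E).
Proof. by apply: integrable_joint_law => //; exact: iY. Qed.

Lemma integrable_control_outcome : control_law.-integrable setT (fun u => (u.1)%:E).
Proof. by apply: integrable_joint_law => //; exact: iY. Qed.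

Lemma integrable_control_mean_treated : treated_law.-integrable setT (fun u => (m0 u.2)%:E).
Proof. by apply: integrable_joint_law => //; exact: im0X. Qed.

Lemma integrable_control_mean : control_law.-integrable setT (fun u => (m0 u.2)%:E).
Proof. by apply: integrable_joint_law => //; exact: im0X. Qed.

Lemma ae_cond_covariates b (S : set 'rV[R]_k) : {ae distribution P X, forall x, S x} ->
  {ae distribution (cond_prob P W b) X, forall x, S x}.
Proof.
move=> [N [mN N0 HN]]; exists N; split => //.
by apply: (cond_prob_null hW) => //; rewrite -[X in measurable X]setTI; exact: measurable_funP.
Qed.

(** [m0] is a version in the whole population, and a set of covariates that is null there is null in
    each arm. *)
Lemma control_mean_version b :
  {ae distribution (cond_prob P W b) X, forall x, (\int[K0 x]_v v%:E = (m0 x)%:E)%E}.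
Proof.
apply: ae_cond_covariates.
exact: (cond_expectation_conditional_law rK (h := idfun) (@measurable_id _ _ _) hY0 hm0).
Qed.

Lemma integral_control_mean b A : regular_cond_law (cond_prob P W b) X Y0 K0 -> measurable A ->
  (\int[cond_prob P W b]_(w in X @^-1` A) (Y0 w)%:E =
   \int[cond_prob P W b]_(w in X @^-1` A) (m0 (X w))%:E)%E.
Proof.
move=> rKb mA.
rewrite (integral_conditional_law rKb (h := idfun) (@measurable_id _ _ _) (iY b hY0))//.
transitivity (\int[distribution (cond_prob P W b) X]_(x in A) (m0 x)%:E)%E.
  apply: ae_eq_integral => //.
  - by apply: measurable_funTS; exact: (measurable_conditional_mean rKb (h := idfun) (@measurable_id _ _ _) (iY b hY0)).
  - by apply: measurable_funTS; exact/measurable_EFinP.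
  - by apply: filterS (control_mean_version b) => x.
rewrite integral_pushforward//; first exact/measurable_EFinP.
apply: (integrableS measurableT) => //; last exact: im0X.
by rewrite -[X in measurable X]setTI; exact: measurable_funP.
Qed.

Lemma control_mean_residual B : measurable B ->
  (\int[control_law]_(u in snd @^-1` B) (u.1)%:E =
   \int[control_law]_(u in snd @^-1` B) (m0 u.2)%:E)%E.
Proof.
move=> mB; have mB' : measurable ((snd : R * 'rV[R]_k -> _) @^-1` B).
  by rewrite -[X in measurable X]setTI; exact: measurable_snd.
rewrite !integral_joint_law//; [|exact: im0X|exact: iY].
exact: integral_control_mean.
Qed.

(** Identification of the effect: since [K0] is also a conditional law of [Y0] among the treated,
    [m0 (X)] and [Y0] have the same mean in that arm. *)
Lemma treated_effect : (\int[treated_law]_u (u.1 - m0 u.2)%:E = tau%:E)%E.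
Proof.
have i1 := iY true hY1; have i0 := iY true hY0; have im := im0X true.
rewrite integral_joint_law//; last 2 first.
- by apply/measurable_EFinP; apply: measurable_funB; [exact: measurable_fst|exact: measurableT_comp mm0 measurable_snd].
- by under eq_fun => w do rewrite EFinB; exact: integrableB.
rewrite (_ : [set w | _] = setT); last by apply/seteqP; split.
transitivity (\int[P1]_w ((Y1 w)%:E - (m0 (X w))%:E))%E; first exact: eq_integral.
rewrite integralB//= -[X in (_ - X)%E](_ : (\int[P1]_w (Y0 w)%:E)%E = _); last first.
  by have := integral_control_mean rK1 measurableT; rewrite preimage_setT.
rewrite /tau unlock.
under [in RHS]eq_integral => w _ do rewrite EFinB.
rewrite integralB// fineK// fin_numB !integrable_fin_num//.
Qed.

(** For the same reason, the left side is the mean of the absolute value of [Y0] among the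
    treated. *)
Lemma control_first_moment : (\int[treated_law]_u \int[K0 u.2]_v (`|v|)%:E < +oo)%E.
Proof.
have mabs : measurable_fun setT (fun v : R => (`|v|)%:E : \bar R).
  by apply/measurable_EFinP; exact: normr_measurable.
have mk : measurable_fun setT (fun x => \int[K0 x]_v (`|v|)%:E)%E.
  exact: (measurable_kernel_mean hK0.1 mabs).
rewrite ge0_integral_joint_law//; last 2 first.
- exact: measurableT_comp mk measurable_snd.
- by move=> u; exact: integral_ge0.
have n0 (v : R) : (0 <= (`|v|)%:E)%E by rewrite lee_fin.
have := ge0_integral_conditional_law rK1 measurableT mabs n0.
rewrite preimage_setT ge0_integral_pushforward//= => [<-|x _]; last exact: integral_ge0.
by have /integrableP[_] := iY true hY0.
Qed.

Lemma control_law_continuity :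
  (forall h : R -> R, continuous h -> bounded_fun h ->
      exists h' : 'rV[R]_k -> R,
        [/\ cond_expectation P X (h \o Y0) h',
            {within S0, continuous h'} & [bounded h' x | x in S0]]) ->
  forall h : R -> R, continuous h -> bounded_fun h ->
  exists h' : 'rV[R]_k -> R, [/\ {within S0, continuous h'},
    {ae control_law, forall u, (\int[K0 u.2]_v (h v)%:E = (h' u.2)%:E)%E} &
    {ae treated_law, forall u, (\int[K0 u.2]_v (h v)%:E = (h' u.2)%:E)%E}].
Proof.
move=> H h ch bh; have [h' [ce ch' _]] := H h ch bh; exists h'.
have mh : measurable_fun setT h by exact: continuous_measurable_fun.
have ih : P.-integrable setT (EFin \o (h \o Y0)).
  have Pfin : (P [set: T] < +oo)%E by rewrite probability_setT ltry.
  apply: measurable_bounded_integrable => //.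
    exact: measurableT_comp.
  by case: bh => M [Mr HM]; exists M; split => // x /HM Hx w _; exact: Hx.
have ae := cond_expectation_conditional_law rK mh ih ce.
by split => //; apply: (@ae_joint_law _ _ _ _ _ _ _ _ [set x | \int[K0 x]_v (h v)%:E = (h' x)%:E]%E);
  exact: ae_cond_covariates.
Qed.

Lemma treated_small_balls : (0 < k)%N -> (exists C : R, forall x, S1 x -> f1 x <= C) ->
  exists2 C : R, 0 < C & forall (x : 'rV[R]_k) (r : R), 0 < r -> r <= 2^-1 ->
  (treated_law [set u | (`|x - u.2| < r)%R] <= (C * r)%:E)%E.
Proof.
move=> k0 [C fC]; pose C' := Num.max C 1.
have C'0 : 0 < C' by rewrite lt_max ltr01 orbT.
exists (C' * 2); first by rewrite mulr_gt0.
apply: (density_on_small_balls mS1 hf1 k0 C'0) => x Sx.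
by rewrite le_max fC.
Qed.

Let Yobs w := (W w)%:R * Y1 w + (1 - (W w)%:R) * Y0 w.

Let measurable_observed A : measurable A -> measurable [set w | A (Yobs w, X w)].
Proof.
move=> mA; have mW : measurable_fun setT (fun w => (W w)%:R : R).
  by apply: (measurableT_comp (f := fun b : bool => b%:R : R)) => //.
have mf : measurable_fun setT (fun w => (Yobs w, X w)).
  apply/measurable_fun_pairP; split => //; rewrite /comp /=.
  by apply: measurable_funD; apply: measurable_funM => //; exact: measurable_funB.
by have := mf measurableT _ mA; rewrite setTI.
Qed.

Lemma cond_prob_eq b E E' : measurable E -> measurable E' ->
  (forall w, W w = b -> E w <-> E' w) -> cond_prob P W b E = cond_prob P W b E'.
Proof.
move=> mE mE' EE'.
have : (((weight P W b)%:E * cond_prob P W b E) = ((weight P W b)%:E * cond_prob P W b E'))%E.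
  rewrite !(cond_probE hW)//; congr (P _); apply/seteqP.
  by split=> w [/= Ew Ww]; split => //; apply/(EE' w Ww).
move=> /(congr1 (fun y => (weight P W b)^-1%:E * y)%E).
by rewrite !muleA -!EFinM mulVf ?mul1e// gt_eqF//; exact: weight_gt0.
Qed.

Lemma treated_lawE A : measurable A -> P1 [set w | A (Yobs w, X w)] = treated_law A.
Proof.
move=> mA; apply: cond_prob_eq; first exact: measurable_observed.
  by have := measurable_joint X Y1 measurableT mA; rewrite setTI.
by move=> w Ww; rewrite /Yobs /= Ww mul1r subrr mul0r addr0.
Qed.

Lemma control_lawE A : measurable A -> P0 [set w | A (Yobs w, X w)] = control_law A.
Proof.
move=> mA; apply: cond_prob_eq; first exact: measurable_observed.
  by have := measurable_joint X Y0 measurableT mA; rewrite setTI.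
by move=> w Ww; rewrite /Yobs /= Ww mul0r add0r subr0 mul1r.
Qed.

End reduction.

(** Positive and negative parts are transported separately, so no integrability is assumed and
    expectations can be rewritten before they are known to be finite. *)
Lemma integral_distribution d1 d2 (T1 : measurableType d1) (T2 : measurableType d2) (R : realType)
  (P : probability T1 R) (phi : {mfun T1 >-> T2}) (f : T2 -> \bar R) : measurable_fun setT f ->
  (\int[distribution P phi]_y f y = \int[P]_x f (phi x))%E.
Proof.
move=> mf; rewrite integralE [RHS]integralE.
rewrite !ge0_integral_pushforward//; last 2 first.
- exact: measurable_funeneg.
- exact: measurable_funepos.
by congr (_ - _)%E; apply: eq_integral => x _; rewrite /= ?funeposE ?funenegE.
Qed.

Theorem proposition3p1 (R : realType) (k : nat) (hk : (0 < k)%N)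
  (d : measure_display) (T : measurableType d) (P : probability T R)
  (Y0 Y1 : {RV P >-> R}) (X : {RV P >-> 'rV[R]_k}) (W : {RV P >-> bool})
  (hW : (0 < P (W @^-1` [set true]) < 1)%E)
  (hY0 : P.-integrable [set: T] (EFin \o Y0))
  (hY1 : P.-integrable [set: T] (EFin \o Y1)) :
  let Y := fun w => (W w)%:R * Y1 w + (1 - (W w)%:R) * Y0 w in
  let P1 := cond_prob P W true in
  let P0 := cond_prob P W false in
  let X1 := law_support (distribution P1 X) in
  let X0 := law_support (distribution P0 X) in
  let lambda := lebesgue_rV R k in
  let tau := fine ('E_P1[fun w => (Y1 w - Y0 w)%R])%E in
  forall (f1 f0 mu1 mu0 : 'rV[R]_k -> R)
    (K1 K0 : 'rV[R]_k -> probability R R)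
    (hf1 : density_on P1 X X1 f1)
    (hf0 : density_on P0 X X0 f0)
    (hmu1 : cond_expectation P1 X Y1 mu1)
    (hmu0 : cond_expectation P X Y0 mu0)
    (hK1 : regular_cond_law P1 X Y1 K1)
    (hK0 : regular_cond_law P0 X Y0 K0)
    (V : 'M[R]_k) (hV : positive_definite V)
    (N1 M : nat) (hN1 : (0 < N1)%N) (hM : (0 < M)%N)
    (dO : nat -> measure_display) (Omega : forall n, measurableType (dO n))
    (Q : forall n, probability (Omega n) R)
    (treated : forall n, 'I_N1 -> {RV (Q n) >-> (R * 'rV[R]_k)%type})
    (control : forall n, 'I_n -> {RV (Q n) >-> (R * 'rV[R]_k)%type})
    (htreated : forall n i A, measurable A ->
       Q n (treated n i @^-1` A) = P1 [set w | A (Y w, X w)])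
    (hcontrol : forall n j A, measurable A ->
       Q n (control n j @^-1` A) = P0 [set w | A (Y w, X w)])
    (hindep : forall n, mutually_independent (Q n)
       (fun s : 'I_N1 + 'I_n =>
          match s with inl i => treated n i | inr j => control n j end))
    (hCIA : cond_independent P X Y0 W)
    (hX_ac : distribution P X `<< lambda)
    (hX_sub : X1 `<=` X0) (hX1_compact : compact X1) (hX0_compact : compact X0)
    (hf1_diff : forall x, X1° x -> differentiable f1 x)
    (hf0_diff : forall x, X0° x -> differentiable f0 x)
    (hf1_ub : exists C : R, forall x, X1 x -> f1 x <= C)
    (hf0_ub : exists C : R, forall x, X1 x -> f0 x <= C)
    (hf0_lb : exists2 c : R, 0 < c & forall x, X1 x -> c <= f0 x)
    (hX1_balls : exists phi rho0 : R, [/\ 0 < phi, 0 < rho0 &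
       forall x rho, X1 x -> 0 < rho <= rho0 ->
         (phi%:E * lambda (euclidean_ball x rho)
            <= lambda (euclidean_ball x rho `&` X1))%E]),
  let tau_hat := fun n w =>
    matching_estimator V M (treated n ^~ w) (control n ^~ w) in
  ({within X0, continuous mu0} ->
     ('E_(Q n)[tau_hat n])%E @[n --> \oo] --> tau%:E) /\
  ((forall h : R -> R, continuous h -> bounded_fun h ->
      exists h' : 'rV[R]_k -> R,
        [/\ cond_expectation P X (h \o Y0) h',
            {within X0, continuous h'} & [bounded h' x | x in X0]]) ->
   exists (dS : measure_display) (S : measurableType dS) (Pr : probability S R)
     (kappa : 'I_N1 -> {RV Pr >-> R}),
     [/\ mutually_independent Pr kappa,
         forall i t, cdf (kappa i) t =
           (\int[lambda]_(x in X1)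
              (match_cdf M K1 K0 mu1 mu0 tau t x * (f1 x)%:E))%E,
         forall i, Pr.-integrable [set: S] (EFin \o kappa i) /\
                   ('E_Pr[kappa i] = 0)%E &
         cvg_in_distribution Pr Q tau_hat
           (fun s => tau + N1%:R^-1 * \sum_(i < N1) kappa i s)]).
Proof.
move=> Y P1 P0 X1 X0 lambda tau f1 f0 mu1 mu0 K1 K0 hf1 hf0 hmu1 hmu0 hK1 hK0 V hV N1 M hN1 hM.
move=> dO Omega Q treated control htreated hcontrol hindep hCIA _ hsub cX1 cX0 _ _ f1ub _ f0lb _ tau_hat.
pose L1 := treated_law P Y1 X W; pose L0 := control_law P Y0 X W.
have balls : forall (x : 'rV[R]_k) (e : R), X1 x -> 0 < e ->
    (0 < L0 [set u | (`|x - u.2| < e)%R])%E.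
  by move=> x e Xx; apply: control_balls.
have supp1 : {ae L1, forall u, X1 u.2} by apply: treated_support; eassumption.
have supp0 : {ae L0, forall u, X0 u.2} by apply: control_support; eassumption.
have iY1 : L1.-integrable setT (fun u => (u.1)%:E) by exact: integrable_treated_outcome.
have effect : (\int[L1]_u (u.1 - mu0 u.2)%:E = tau%:E)%E by eapply treated_effect; eassumption.
(* Passing to the law of the pooled tuple replaces the unrelated sample spaces by tuples of units,
   on which redrawing a coordinate makes sense. *)
pose rho n := pooled_law (Q n) (treated n) (control n).
have boxE n : box_law (@unit_law _ _ L1 L0 N1 n) (rho n).
  apply: pooled_box_law => [i A mA|j A mA|]; last exact: hindep.
    by rewrite htreated//; exact: treated_lawE.
  by rewrite hcontrol//; exact: control_lawE.
have mm0 : measurable_fun setT mu0 by case: hmu0.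
have mse n : measurable_fun setT (fun z : (N1 + n).-tuple (R * 'rV[R]_k) =>
    sample_estimator V M z).
  exact: measurable_sample_estimator.
have mseE n := (measurable_EFinP _ _).2 (mse n).
have pooledE n (f : R -> \bar R) : measurable_fun setT (fun z : (N1 + n).-tuple (R * 'rV[R]_k) => f (sample_estimator V M z)) ->
    (\int[rho n]_z f (sample_estimator V M z) = \int[Q n]_w f (tau_hat n w))%E.
  move=> mf; rewrite /rho integral_distribution//.
  by apply: eq_integral => w _; congr f; exact: sample_estimator_pooled.
split.
  move=> mu0c.
  have E n : ('E_(Q n)[tau_hat n] = \int[rho n]_z (sample_estimator V M z)%:E)%E.
    by rewrite unlock; apply: esym; exact: pooledE (mseE n).
  have iY0 : L0.-integrable setT (fun u => (u.1)%:E) by exact: integrable_control_outcome.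
  have im0 : L0.-integrable setT (fun u => (mu0 u.2)%:E) by exact: integrable_control_mean.
  have im1 : L1.-integrable setT (fun u => (mu0 u.2)%:E) by eapply integrable_control_mean_treated; eassumption.
  have m0E B : measurable B -> (\int[L0]_(u in snd @^-1` B) (u.1)%:E =
      \int[L0]_(u in snd @^-1` B) (mu0 u.2)%:E)%E.
    by move=> mB; eapply control_mean_residual; eassumption.
  have est := estimator_mean_cvg hk hN1 hM hV cX1 cX0 hsub balls supp1 supp0 mm0 mu0c
    iY1 iY0 im0 im1 m0E effect.
  (* The expectation is extended-valued, so its finiteness is deduced from its distance to [tau]. *)
  have fin n (e : R) : (`|'E_(Q n)[tau_hat n] - tau%:E| <= e%:E)%E ->
      ('E_(Q n)[tau_hat n])%E \is a fin_num.
    move=> h; have : (`|'E_(Q n)[tau_hat n] - tau%:E|)%E \is a fin_num.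
      by rewrite ge0_fin_numE//; apply: le_lt_trans h (ltry _).
    by rewrite abse_fin_num fin_numB => /andP[].
  apply/fine_cvgP; split.
    have [n0 H] := est 1 ltr01; exists n0 => // n /= n0n; apply: (fin n 1).
    by rewrite E; exact: H.
  apply/cvgrPdist_le => eps eps0; have [n0 H] := est eps eps0.
  exists n0 => // n /= n0n; have := H n (rho n) n0n (boxE n); rewrite -E => h.
  by move: (h); rewrite -(fineK (fin _ _ h)) -EFinB lee_fin distrC.
move=> Hh.
have disint0 : disintegration L0 K0 by exact: control_disintegration.
have disint1 : disintegration L1 K1 by exact: treated_disintegration.
have fm : (\int[L1]_u \int[K0 u.2]_v (`|v|)%:E < +oo)%E.
  exact: (control_first_moment Y1 hW hY0 hf1 hf0 hK0 hCIA hsub cX1 cX0 f0lb).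
have [C C0 small] : exists2 C : R, 0 < C & forall (x : 'rV[R]_k) (r : R), 0 < r -> r <= 2^-1 ->
    (L1 [set u | (`|x - u.2| < r)%R] <= (C * r)%:E)%E.
  by apply: (treated_small_balls Y1 hf1 cX1 hk f1ub).
pose Law := match_law L1 disint0 M tau.
(* The limit variables are realized as the coordinates of a vector under the [N1]-fold power of
   [Law], which makes them independent with law [Law]. *)
pose kappa (i : 'I_N1) : {mfun 'rV[R]_N1 >-> R} := mfun_of (@measurable_coord R N1 i).
exists _, 'rV[R]_N1, (rV_powerP Law (n := N1)), kappa; split.
- move=> A mA; rewrite /rV_powerP rV_powerE//.
  by apply: eq_bigr => i _; exact/esym/rV_power_coord.
- move=> i t.
  transitivity (Law `]-oo, t]%classic); first exact: (rV_power_coord Law i (measurable_itv _)).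
  rewrite (match_law_cdf disint0 tau hM mu1 mu0 t disint1).
  have mG := measurable_match_cdf disint0 tau hM hK1.1 mu1 mu0 t.
  have G0 x : (0 <= match_cdf M K1 K0 mu1 mu0 tau t x)%E by exact: measure_ge0.
  rewrite ge0_integral_joint_law; last 2 first.
  - exact: measurableT_comp mG measurable_snd.
  - by move=> u; exact: G0.
  rewrite -(integral_density_on (compact_measurable_rV cX1) hf1 mG G0).
  by rewrite integral_distribution.
- move=> i.
  have iL : Law.-integrable setT EFin by exact: integrable_match_law.
  split; first exact: (integrable_rV_power_coord iL i).
  rewrite unlock; apply: etrans (integral_rV_power_coord iL i) _.
  have mE : {ae L1, forall u, (\int[K0 u.2]_v v%:E = (mu0 u.2)%:E)%E}.
    apply: (@ae_joint_law _ _ _ _ _ _ _ _ [set x | \int[K0 x]_v v%:E = (mu0 x)%:E]%E).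
    exact: (control_mean_version hW hY0 hf1 hf0 hmu0 hK0 hCIA hsub cX1 cX0 f0lb true).
  rewrite (match_law_mean disint0 tau hM iY1 fm mm0 mE).
  have iD : L1.-integrable setT (fun u => (u.1 - mu0 u.2)%:E).
    have im1 : L1.-integrable setT (fun u => (mu0 u.2)%:E) by eapply integrable_control_mean_treated; eassumption.
    exact: (integrableB measurableT iY1 im1).
  (* The limit mean is the treated mean of the outcome minus [mu0], which is [tau], minus [tau]. *)
  transitivity (\int[L1]_u ((u.1 - mu0 u.2)%:E - tau%:E))%E.
    by apply: eq_integral => u _; rewrite -EFinB addrAC.
  rewrite integralB//; last exact: finite_measure_integrable_cst.
  by rewrite effect integral_cst// [X in (_ * X)%E]probability_setT mule1 -EFinB subrr.
- apply: cvg_in_distribution_ramp.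
  + exact: measurableT_comp (measurable_affine tau N1%:R^-1) (@measurable_sum_coord R N1).
  + move=> n; rewrite (_ : tau_hat n = sample_estimator V M (n:=n) \o pooled (treated n) (control n)).
      by apply: (measurableT_comp (mse n)); exact: measurable_pooled.
    by apply/funext => w /=; rewrite sample_estimator_pooled.
  move=> t e eps e0 eps0.
  have K0c := control_law_continuity Y1 hW hf1 hf0 hK0 hCIA hsub cX1 cX0 f0lb.
  have {}K0c := K0c Hh.
  have [n0 H] := ramp_cvg tau hk hN1 hM hV cX1 cX0 hsub balls supp1 supp0 disint0 C0 small fm K0c t e0 eps0.
  have [r0 mr] : nice (eramp t e) by exact: nice_eramp.
  exists n0 => n n0n; have := H n (rho n) n0n (boxE n).
  have -> : (\int[rho n]_z (ramp t e (sample_estimator V M z))%:E =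
      \int[Q n]_w (ramp t e (tau_hat n w))%:E)%E.
    by apply: (pooledE n (eramp t e)); exact: measurableT_comp mr (mse n).
  (* Read backwards, the iterated convolution is the expectation of the ramp at [tau] plus the
     scaled sum of the coordinates. *)
  by rewrite -(rV_power_cvl Law N1 N1%:R^-1 tau r0 mr).
Qed.
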